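(* Let $U$ be a nonempty open subset of $\mathbb{R}^d$, let $(\mathcal{A},H)$ be an optimal regular system in $U$, and let $\varphi$ be a positive nonincreasing continuous function on $[0,\infty)$. Let $F_\varphi=\{x\in\mathbb{R}^d:|x-a|<\varphi(H(a))\text{ for infinitely many }a\in\mathcal{A}\}$ and $I_\varphi=\int_0^\infty\eta^{d-1}\varphi(\eta)^d\,d\eta$. If $I_\varphi=\infty$, then $F_\varphi$ has full Lebesgue measure in $U$. If $I_\varphi<\infty$, then $F_\varphi$ is $\mathfrak{n}_\varphi$-describable in $U$, where $\mathfrak{n}_\varphi$ is the Borel measure on $(0,1]$ characterized by $\int_{(0,1]}f\,d\mathfrak{n}_\varphi=\int_0^\infty\eta^{d-1}f(\varphi(\eta))\,d\eta$ for every nonnegative measurable $f$ supported in $(0,1]$.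
   Context: Let $\mathcal{A}\subseteq\mathbb{R}^d$ be countably infinite and $H:\mathcal{A}\to(0,\infty)$. $(\mathcal{A},H)$ is admissible if for every integer $m\ge1$ the set $\{a\in\mathcal{A}:|a|<m,\ H(a)\le m\}$ is finite. It is a regular system in an open set $U$ if it is admissible and there is $\kappa>0$ such that for every open ball $B\subseteq U$ there is $h_B>0$ such that for all $h>h_B$ there is $\mathcal{A}_{B,h}\subseteq\mathcal{A}\cap B$ with $\#\mathcal{A}_{B,h}\ge\kappa(\mathrm{diam}\,B)^dh^d$, $H(a)\le h$ for $a\in\mathcal{A}_{B,h}$, and $|a-a'|\ge1/h$ for distinct $a,a'\in\mathcal{A}_{B,h}$. It is an optimal system in $U$ if it is admissible and for every open ball $B$ there are $\kappa'_B,h'_B>0$ with $\#\{a\in\mathcal{A}\cap U\cap B:H(a)\le h\}\le\kappa'_Bh^d$ for $h>h'_B$. An optimal regular system is one that is both. Fix $d\ge1$ and a norm $|\cdot|$ on $\mathbb{R}^d$ (diameters are taken with respect to it); $\mathcal{L}^d$ is Lebesgue measure. A gauge function is a function $g:[0,\infty]\to[0,\infty]$ that is nondecreasing on a neighbourhood of $0$ and satisfies $\lim_{r\to0}g(r)=g(0)=0$, $g(\infty)=\infty$; $\mathfrak{G}$ denotes the set of gauge functions. $\mathcal{H}^g$ is the Hausdorff $g$-measure: $\mathcal{H}^g(E)=\lim_{\delta\downarrow0}\inf\{\sum_ng(\mathrm{diam}\,C_n):E\subseteq\bigcup_nC_n,\ \mathrm{diam}\,C_n\le\delta\}$. The $d$-normalization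 of $g$ is $g_d(r)=r^d\inf_{0<\rho\le r}g(\rho)/\rho^d$ for $r\in(0,\infty)$, $g_d(0)=0$, $g_d(\infty)=\infty$; $g$ is $d$-normalized if $g=g_d$ on a neighbourhood of $0$. Let $\ell_g=\liminf_{r\to0}g(r)/r^d$, $\mathfrak{G}^\infty=\{g\in\mathfrak{G}:\ell_g=\infty\}$, $\mathfrak{G}^*=\{g\in\mathfrak{G}:\ell_g\in(0,\infty]\}$. For $d$-normalized gauge functions $g,h$ write $h\prec g$ if $h(r)/g(r)$ increases monotonically to $\infty$ as $r\downarrow0$ (with the convention that $h\prec g$ for every $h$ if $g$ vanishes on a neighbourhood of $0$). Dyadic cubes are the sets $2^{-j}(k+[0,1)^d)$, $j\in\mathbb{Z}$, $k\in\mathbb{Z}^d$. For a $d$-normalized gauge function $h$, let $\varepsilon_h$ be the supremum of those $\varepsilon>0$ such that $h$ is nondecreasing on $[0,\varepsilon]$ and $r\mapsto h(r)/r^d$ is nonincreasing on $(0,\varepsilon]$, and let $\mathcal{M}^h_\infty(E)=\inf\sum_nh(\mathrm{diam}\,\lambda_n)$, the infimum over all countable coverings of $E$ by dyadic cubes $\lambda_n$ of diameter less than $\varepsilon_h$. For a gauge function $g$ and a nonempty open set $U\subseteq\mathbb{R}^d$, the large intersection class $G^g(U)$ is the collection of $G_\delta$ subsets $F\subseteq\mathbb{R}^d$ such that $\mathcal{M}^h_\infty(F\cap V)=\mathcal{M}^h_\infty(V)$ for every $d$-normalized gauge function $h$ with $h\prec g_d$ and every open $V\subseteq U$. Let $\mathcal{Z}(U)$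 be the set of Borel sets $E$ with $\mathcal{L}^d(E\cap U)=0$; for such $E$, the majorizing collection is $\mathfrak{M}(E,U)=\{g\in\mathfrak{G}^\infty:\mathcal{H}^g(E\cap U)=0\}$ and the minorizing collection is $\mathfrak{m}(E,U)=\{g\in\mathfrak{G}^*:\exists F\in G^g(U),\ F\subseteq E\}$. Let $\mathcal{R}$ be the set of positive Borel measures $\mathfrak{n}$ on $(0,1]$ with infinite total mass and $\mathfrak{n}([\rho,1])<\infty$ for all $\rho\in(0,1]$, and $\mathcal{R}_d=\{\mathfrak{n}\in\mathcal{R}:\int_{(0,1]}r^d\,\mathfrak{n}(dr)<\infty\}$. For $\mathfrak{n}\in\mathcal{R}_d$, $\mathfrak{G}(\mathfrak{n})=\{g\in\mathfrak{G}^\infty:\int_{(0,1]}g_d\,d\mathfrak{n}=\infty\}$ and $\mathfrak{G}(\mathfrak{n})^\complement=\mathfrak{G}^\infty\setminus\mathfrak{G}(\mathfrak{n})$. A set $E$ is $\mathfrak{n}$-describable in $U$ if $E\in\mathcal{Z}(U)$, $\mathfrak{M}(E,U)=\mathfrak{G}(\mathfrak{n})^\complement$ and $\mathfrak{m}(E,U)\cap\mathfrak{G}^\infty=\mathfrak{G}(\mathfrak{n})$. For $\mathfrak{s}\in[0,d)$, $\mathfrak{G}(\mathfrak{s})$ is the set of $g\in\mathfrak{G}^\infty$ such that for every $s>\mathfrak{s}$, $g_d(r)$ is not $o(r^s)$ as $r\to0$; $E$ is $\mathfrak{s}$-describable in $U$ if $E\in\mathcal{Z}(U)$, $\mathfrak{M}(E,U)=\mathfrak{G}^\infty\setminus\mathfrak{G}(\mathfrak{s})$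 and $\mathfrak{m}(E,U)\cap\mathfrak{G}^\infty=\mathfrak{G}(\mathfrak{s})$. *)

(* Defs.v *)
From mathcomp Require Import all_boot all_order all_algebra.
From mathcomp Require Import all_classical all_reals all_analysis.
From mathcomp Require Import measurable_realfun.
Set Implicit Arguments. Unset Strict Implicit. Unset Printing Implicit Defensive.
Import Order.TTheory GRing.Theory Num.Theory.
Import numFieldNormedType.Exports.
Local Open Scope classical_set_scope.
Local Open Scope ring_scope.

Section Defs.
Variables (R : realType) (d : nat).
Notation V := 'rV[R]_d.

Definition is_norm (N : V -> R) : Prop :=
  [/\ forall x, 0 <= N x,
      forall x, N x = 0 -> x = 0,
      forall (c : R) x, N (c *: x) = `|c| * N x
    & forall x y, N (x + y) <= N x + N y].

Definition ballN (N : V -> R) (c : V) (r : R) : set V := [set x | N (x - c) < r].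
Definition norm_open (N : V -> R) (O : set V) : Prop :=
  forall x, O x -> exists2 r : R, 0 < r & ballN N x r `<=` O.
Definition open_ballN (N : V -> R) (B : set V) : Prop :=
  exists c : V, exists2 r : R, 0 < r & B = ballN N c r.
Definition GdeltaN (N : V -> R) (F : set V) : Prop :=
  exists O : nat -> set V, (forall n, norm_open N (O n)) /\ F = \bigcap_n O n.
Definition borelN (N : V -> R) (E : set V) : Prop :=
  forall S : set (set V),
    (forall O, norm_open N O -> S O) ->
    S set0 -> (forall A, S A -> S (~` A)) ->
    (forall A : nat -> set V, (forall n, S (A n)) -> S (\bigcup_n A n)) ->
    S E.

(* diameter w.r.t. N (diam of the empty set is 0) *)
Definition diam (N : V -> R) (C : set V) : \bar R :=
  ereal_sup ([set 0%E] `|` [set (N (x - y))%:E | x in C & y in C]).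

Definition box (a b : V) : set V := [set x | forall i, a 0 i <= x 0 i <= b 0 i].
Definition box_vol (a b : V) : R := \prod_(i < d) (b 0 i - a 0 i).
Definition leb_null (E : set V) : Prop :=
  forall eps : R, 0 < eps ->
    exists a b : nat -> V,
      (forall n i, a n 0 i <= b n 0 i) /\
      E `<=` \bigcup_n box (a n) (b n) /\
      (\sum_(n <oo) (box_vol (a n) (b n))%:E < eps%:E)%E.

(* ---------- gauge_fun functions (represented on [0, oo); g(oo) = oo by convention) *)
Definition gauge_fun (g : R -> \bar R) : Prop :=
  [/\ forall r, 0 <= r -> (0 <= g r)%E,
      exists2 e : R, 0 < e & forall r s, 0 <= r -> r <= s -> s <= e -> (g r <= g s)%E,
      g 0 = 0%E
    & g r @[r --> 0^'+] --> 0%E].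

Definition gd (g : R -> \bar R) (r : R) : \bar R :=
  if 0 < r then
    let S := [set (g rho * (rho ^+ d)^-1%:E)%E | rho in `]0%R, r]] in
    ((r ^+ d)%:E * ereal_inf S)%E
  else 0%E.

Definition d_normalized (g : R -> \bar R) : Prop :=
  exists2 e : R, 0 < e & forall r, 0 <= r -> r <= e -> g r = gd g r.

(* ell_g = liminf_{r->0} g(r)/r^d *)
Definition Ginf (g : R -> \bar R) : Prop :=
  gauge_fun g /\ forall M : R, \forall r \near 0^'+, (M%:E <= g r * (r ^+ d)^-1%:E)%E.
Definition Gstar (g : R -> \bar R) : Prop :=
  gauge_fun g /\ exists2 c : R, 0 < c & \forall r \near 0^'+, (c%:E <= g r * (r ^+ d)^-1%:E)%E.

Definition prec (h g : R -> \bar R) : Prop :=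
  (exists2 e : R, 0 < e & forall r, 0 <= r -> r <= e -> g r = 0%E) \/
  (exists2 e : R, 0 < e &
     [/\ forall r, 0 < r -> r < e -> (0 < g r < +oo)%E,
         forall r s, 0 < r -> r <= s -> s < e ->
           (h s * (fine (g s))^-1%:E <= h r * (fine (g r))^-1%:E)%E
       & (h r * (fine (g r))^-1%:E)%E @[r --> 0^'+] --> +oo%E]).

Definition hausdorff_delta (N : V -> R) (g : R -> \bar R) (delta : R) (E : set V) : \bar R :=
  ereal_inf [set (\sum_(n <oo) g (fine (diam N (C n))))%E | C in
     [set C : nat -> set V | E `<=` \bigcup_n C n /\ forall n, (diam N (C n) <= delta%:E)%E]].
Definition hausdorff (N : V -> R) (g : R -> \bar R) (E : set V) : \bar R :=
  ereal_sup [set hausdorff_delta N g delta E | delta in `]0, +oo[].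

Definition dyadic (Q : set V) : Prop :=
  exists (j : int) (k : 'rV[int]_d),
    Q = [set x | forall i, (k 0 i)%:~R <= (2%:R ^ j) * x 0 i < (k 0 i)%:~R + 1].

Definition eps_h (h : R -> \bar R) : \bar R :=
  ereal_sup [set e%:E | e in [set e : R | 0 < e /\
     (forall r s, 0 <= r -> r <= s -> s <= e -> (h r <= h s)%E) /\
     (forall r s, 0 < r -> r <= s -> s <= e ->
        (h s * (s ^+ d)^-1%:E <= h r * (r ^+ d)^-1%:E)%E)]].

(* M^h_infty via countable (possibly finite: empty entries allowed) dyadic covers *)
Definition Mh (N : V -> R) (h : R -> \bar R) (E : set V) : \bar R :=
  ereal_inf [set (\sum_(n <oo) h (fine (diam N (C n))))%E | C in
     [set C : nat -> set V | E `<=` \bigcup_n C n /\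
        forall n, C n = set0 \/ (dyadic (C n) /\ (diam N (C n) < eps_h h)%E)]].

Definition large_int (N : V -> R) (g : R -> \bar R) (U : set V) : set (set V) :=
  [set F | GdeltaN N F /\
     forall h : R -> \bar R, gauge_fun h -> d_normalized h -> prec h (gd g) ->
     forall W : set V, norm_open N W -> W `<=` U -> Mh N h (F `&` W) = Mh N h W].

Definition Zset (N : V -> R) (U : set V) : set (set V) :=
  [set E | borelN N E /\ leb_null (E `&` U)].

Definition majorizing (N : V -> R) (E U : set V) : set (R -> \bar R) :=
  [set g | Ginf g /\ hausdorff N g (E `&` U) = 0%E].
Definition minorizing (N : V -> R) (E U : set V) : set (R -> \bar R) :=
  [set g | Gstar g /\ exists2 F, large_int N g U F & F `<=` E].

Definition Gn (n : {measure set R -> \bar R}) : set (R -> \bar R) :=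
  [set g | Ginf g /\ (\int[n]_(x in `]0%R, 1%R]) gd g x)%E = +oo%E].

Definition n_describable (N : V -> R) (U : set V) (n : {measure set R -> \bar R})
    (E : set V) : Prop :=
  [/\ Zset N U E,
      majorizing N E U = Ginf `\` Gn n
    & minorizing N E U `&` Ginf = Gn n].

Definition admissible (N : V -> R) (A : set V) (H : V -> R) : Prop :=
  forall m : nat, (1 <= m)%N ->
    finite_set [set a | A a /\ N a < m%:R /\ H a <= m%:R].

Definition regular_system (N : V -> R) (U : set V) (A : set V) (H : V -> R) : Prop :=
  admissible N A H /\
  exists2 kappa : R, 0 < kappa &
    forall B, open_ballN N B -> B `<=` U ->
      exists2 hB : R, 0 < hB & forall h : R, hB < h ->
        exists s : seq V, [/\ uniq s,
          forall a, a \in s -> A a /\ B a,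
          kappa * (fine (diam N B)) ^+ d * h ^+ d <= (size s)%:R,
          forall a, a \in s -> H a <= h
        & forall a a', a \in s -> a' \in s -> a != a' -> h^-1 <= N (a - a')].

Definition optimal_system (N : V -> R) (U : set V) (A : set V) (H : V -> R) : Prop :=
  admissible N A H /\
  forall B, open_ballN N B ->
    exists kappa' : R, exists hB' : R, [/\ 0 < kappa', 0 < hB' &
      forall h : R, hB' < h ->
        forall s : seq V, uniq s ->
          (forall a, a \in s -> [/\ A a, U a, B a & H a <= h]) ->
          (size s)%:R <= kappa' * h ^+ d].

Definition optimal_regular_system N U A H :=
  optimal_system N U A H /\ regular_system N U A H.

Definition F_phi (N : V -> R) (A : set V) (H : V -> R) (phi : R -> R) : set V :=
  [set x | infinite_set [set a | A a /\ N (x - a) < phi (H a)]].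

Definition I_phi (phi : R -> R) : \bar R :=
  (\int[@lebesgue_measure R]_(eta in `[0%R, +oo[) ((eta ^+ d.-1) * (phi eta) ^+ d)%:E)%E.

Definition is_n_phi (phi : R -> R) (n : {measure set R -> \bar R}) : Prop :=
  forall f : R -> \bar R, measurable_fun [set: R] f -> (forall x, (0 <= f x)%E) ->
    (forall x, ~ (0 < x <= 1) -> f x = 0%E) ->
    (\int[n]_(x in `]0%R, 1%R]) f x =
     \int[@lebesgue_measure R]_(eta in `[0%R, +oo[) ((eta ^+ d.-1)%:E * f (phi eta)))%E.
End Defs.

(* Main.v *)
(** In every ball a regular system contains families of balls that pack a fixed proportion of it, and
    the concentric balls of radii comparable to [phi (H a)] are as heavy as one wants for a gauge [h]
    as soon as the series of [b^(k d) h(phi(b^k))] diverges. Descending through such packings, always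
    into a ball that is light for a given cover, leads to a point of [F_phi] missed by the cover unless
    the cover already carries a fixed proportion of the content of the initial ball. For [h(r) = r^d]
    this gives full measure. For other gauges the constant is upgraded to an equality of net measures
    by replacing the tail of a cover with maximal dyadic cubes: the tail has arbitrarily small weight,
    and the uncovered cubes have a total weight at most a constant times that of the tail.

    When the series converges, optimality of the system bounds the weight of the natural covers of
    [F_phi], as in the Borel-Cantelli lemma, and the Hausdorff measure vanishes. If in this case [F_phi]
    contained a set of the large intersection class of [g], one would pick numbers [x_i] decreasing to 0
    so fast that the sum of the [min(g_d, x_i)] is a gauge [h] with [h < g_d] whose series still
    converges; its net measure would then both vanish and be positive on [F_phi]. *)

(* No measure is constructed on [F_phi]: lower bounds come from refuting covers. A packed ball fails
   to be light either because a piece at least as large as its packing radius meets it, or because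
   smaller pieces meeting it weigh too much, and the packing inequality limits what one piece
   contributes to either failure. This needs shrunken balls that are arbitrarily heavy relative to
   [r a ^+ d], hence [hr r / r ^+ d] unbounded near 0. The gauge [r ^+ d] itself is therefore out of
   reach of [F_phi_content]; full measure is drawn from the packings directly, by removing a fixed
   proportion of subcubes again and again. Heights are sampled at powers of a base [b] dictated by
   the system, so large that points of earlier generations are negligible; the integral test holds
   for every base. Finiteness of [I_phi] forces [phi] to tend to 0, so only values of a gauge near 0
   matter, where its normalization is monotone. Normalizing costs only a constant, since a ball can
   be covered at the scale that nearly attains the infimum in [gd]. *)
Require Import Defs.
From mathcomp Require Import all_boot all_order all_algebra.
From mathcomp Require Import all_classical all_reals all_analysis.
From mathcomp Require Import measurable_realfun.
From mathcomp Require Import ring lra.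
Import Order.TTheory GRing.Theory Num.Theory.
Import numFieldNormedType.Exports.
Local Open Scope classical_set_scope.
Local Open Scope ring_scope.
Set Implicit Arguments.
Unset Strict Implicit.
Unset Printing Implicit Defensive.

(** * Norms, packings and dyadic cubes *)

Section NormGeometry.
Variables (R : realType) (d : nat) (N : 'rV[R]_d -> R).
Hypothesis hN : is_norm N.
Implicit Types (x y : 'rV[R]_d).

Lemma norm_ge0 x : 0 <= N x. Proof. by have [] := hN. Qed.

Lemma norm0_eq0 x : N x = 0 -> x = 0. Proof. by have [_ + _ _] := hN; apply. Qed.

Lemma normZ (c : R) x : N (c *: x) = `|c| * N x. Proof. by have [_ _ + _] := hN. Qed.

Lemma norm_triangle x y : N (x + y) <= N x + N y. Proof. by have [] := hN. Qed.

Lemma norm0 : N 0 = 0.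
Proof. by rewrite -(scale0r (0 : 'rV[R]_d)) normZ normr0 mul0r. Qed.

Lemma normN x : N (- x) = N x.
Proof. by rewrite -scaleN1r normZ normrN normr1 mul1r. Qed.

Lemma norm_distC x y : N (x - y) = N (y - x).
Proof. by rewrite -normN opprB. Qed.

Lemma norm_distD z x y : N (x - y) <= N (x - z) + N (z - y).
Proof. by rewrite (le_trans _ (norm_triangle _ _))// addrA subrK. Qed.

Lemma norm_sum (I : Type) (s : seq I) (F : I -> 'rV[R]_d) :
  N (\sum_(i <- s) F i) <= \sum_(i <- s) N (F i).
Proof.
elim/big_ind2: _ => [|a b c e hab hce|//]; first by rewrite norm0.
by rewrite (le_trans (norm_triangle _ _))// lerD.
Qed.

Hypothesis hd : (1 <= d)%N.

Lemma norm_le_coord : exists2 C : R, 0 < C &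
  forall x (t : R), (forall i, `|x 0 i| <= t) -> N x <= C * t.
Proof.
exists (1 + \sum_(i < d) N (delta_mx 0 i)).
  by rewrite ltr_pwDl// sumr_ge0// => i _; exact: norm_ge0.
move=> x t xt; have t0 : 0 <= t by apply: le_trans (xt (Ordinal hd)).
rewrite {1}(row_sum_delta x) (le_trans (norm_sum _ _))// mulrDl mul1r mulr_suml.
rewrite (le_trans _ (ler_wpDl t0 (lexx _)))// ler_sum// => i _.
by rewrite normZ mulrC ler_wpM2l// norm_ge0.
Qed.

Lemma norm_continuous : continuous N.
Proof.
have [C C0 hC] := norm_le_coord.
move=> x; apply/(@cvgrPdist_le _ R^o _ (nbhs x) (nbhs_filter x)) => e e0.
have eC0 : 0 < e / C by rewrite divr_gt0.
have := @nbhsx_ballx R 'rV[R]_d x _ eC0; apply: filterS => y bxy.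
have xy : N (x - y) <= e.
  rewrite -(divfK (lt0r_neq0 C0) e) mulrC; apply: hC => i.
  by move: bxy => [_ /(_ 0 i)]; rewrite /ball/= => /ltW; rewrite !mxE; exact.
have h1 : N x <= N (x - y) + N y by rewrite -{1}(subrK y x) norm_triangle.
have h2 : N y <= N (x - y) + N x by rewrite norm_distC -{1}(subrK x y) norm_triangle.
by rewrite ler_norml; apply/andP; split; lra.
Qed.

(** The faces of the unit cube are compact, so the continuous function [N] has a positive minimum on
    each; dividing [x] by its largest coordinate moves it to a face. *)
Lemma coord_le_norm : exists2 C : R, 0 < C & forall x i, `|x 0 i| <= C * N x.
Proof.
pose face (i : 'I_d) : set 'rV[R]_d := [set v | forall j : 'I_d,
  (if j == i then [set 1 : R] else [set` `[(-1 : R), 1]]) (v 0 j)].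
have face_min i : exists2 m : R, 0 < m & forall v, face i v -> m <= N v.
  have [|||c ci cmin] := @EVT_min_rV R d N (face i).
  - exists (const_mx 1) => j /=; rewrite mxE; case: ifP => //= _.
    by rewrite in_itv/= lexx andbT; lra.
  - apply: (@rV_compact R d (fun j => if j == i then [set 1 : R] else [set` `[(-1 : R), 1]])).
    by move=> j; case: ifP => _; [exact: compact_set1|exact: segment_compact].
  - exact/continuous_subspaceT/norm_continuous.
  - exists (N c) => [|v fv]; last by apply: cmin; rewrite inE.
    rewrite lt0r norm_ge0 andbT; apply/eqP => /norm0_eq0 c0.
    by move: ci; rewrite inE => /(_ i); rewrite c0 mxE eqxx /= => /esym/eqP; rewrite oner_eq0.
have /choice[m hm] : forall i, exists m : R, 0 < m /\ forall v, face i v -> m <= N v.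
  by move=> i; have [m m0 mf] := face_min i; exists m.
have hm0 i : 0 < (m i)^-1 by rewrite invr_gt0; have [] := hm i.
exists (1 + \sum_(i < d) (m i)^-1).
  by rewrite ltr_pwDl// sumr_ge0// => i _; rewrite ltW.
move=> x i0.
have [i _ imax] := @Order.TotalTheory.arg_maxP _ R 'I_d i0 predT (fun j => `|x 0 j|) isT.
have [xi0|xi0] := eqVneq (x 0 i) 0.
  rewrite (le_trans (imax i0 isT))//= xi0 normr0 mulr_ge0 ?norm_ge0//.
  by rewrite addr_ge0// sumr_ge0// => j _; rewrite ltW.
rewrite (le_trans (imax i0 isT))//=.
have xip : 0 < `|x 0 i| by rewrite normr_gt0.
have : m i <= N ((x 0 i)^-1 *: x).
  apply: (hm i).2 => j /=; rewrite mxE; case: ifPn => [/eqP ->|_]/=; first by rewrite mulVf.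
  rewrite in_itv/= -ler_norml normrM normfV mulrC ler_pdivrMr// mul1r.
  exact: imax.
rewrite normZ normfV mulrC ler_pdivlMr// mulrC -ler_pdivlMr; last by have [] := hm i.
move=> /le_trans; apply; rewrite mulrC ler_wpM2r ?norm_ge0//.
rewrite (bigD1 i)//= addrCA lerDl addr_ge0// sumr_ge0// => j _; rewrite ltW//.
Qed.

Lemma norm_equiv : exists2 C : R, 1 <= C &
  (forall x (t : R), (forall i, `|x 0 i| <= t) -> N x <= C * t) /\
  (forall x i, `|x 0 i| <= C * N x).
Proof.
have [C C0 hC] := norm_le_coord; have [D D0 hD] := coord_le_norm.
exists (1 + C + D); first by rewrite -addrA lerDl addr_ge0// ltW.
split=> [x t xt|x i].
  have t0 : 0 <= t by apply: le_trans (xt (Ordinal hd)).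
  by rewrite (le_trans (hC _ _ xt))// ler_wpM2r//; lra.
by rewrite (le_trans (hD x i))// ler_wpM2r ?norm_ge0//; lra.
Qed.
End NormGeometry.

Lemma sum_card_disjoint (T : finType) (I : eqType) (s : seq I) (S : I -> {set T}) :
  uniq s ->
  (forall a b k, a \in s -> b \in s -> k \in S a -> k \in S b -> a = b) ->
  (\sum_(a <- s) #|S a| <= #|[pred k | has (fun a => k \in S a) s]|)%N.
Proof.
move=> us dis.
have -> : (\sum_(a <- s) #|S a| = \sum_(k : T) \sum_(a <- s) (k \in S a))%N.
  rewrite exchange_big/=; apply: eq_bigr => a _.
  by rewrite -sum1_card big_mkcond/=; apply: eq_bigr => k _; case: ifP.
rewrite -sum1_card [leqRHS]big_mkcond; apply: leq_sum => k _ /=.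
rewrite inE; case: hasP => [[a sa ka]|nk]; last first.
  rewrite big_seq big1// => a sa; case: (boolP (k \in S a)) => // ka.
  by exfalso; apply: nk; exists a.
rewrite (bigD1_seq a)//= ka big_seq_cond big1// => b /andP[sb ba].
by case: (boolP (k \in S b)) => // kb; rewrite (dis _ _ _ sb sa kb ka) eqxx in ba.
Qed.

Section Grid.
Variables (R : realType) (d : nat).

Definition cube (y : 'rV[R]_d) (L : R) : set 'rV[R]_d :=
  [set x | forall i, y 0 i <= x 0 i < y 0 i + L].

Definition subcube_corner (y : 'rV[R]_d) (L : R) (n : nat) (k : {ffun 'I_d -> 'I_n}) :
    'rV[R]_d :=
  \row_i (y 0 i + L / n%:R * (k i)%:R).

Lemma subcube_sub (y : 'rV[R]_d) (L : R) (n : nat) (k : {ffun 'I_d -> 'I_n}) :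
  0 < L -> cube (subcube_corner y L k) (L / n%:R) `<=` cube y L.
Proof.
move=> L0 x xk i; have := xk i; rewrite mxE => /andP[h1 h2].
have n0 : (0 < n)%N by apply: leq_ltn_trans (ltn_ord (k i)).
have dn : L / n%:R * n%:R = L by rewrite divfK// pnatr_eq0 -lt0n.
have dp : 0 < L / n%:R by rewrite divr_gt0// ltr0n.
have h3 : 0 <= L / n%:R * (k i)%:R by rewrite mulr_ge0// ltW.
have h4 : L / n%:R * ((k i)%:R + 1) <= L / n%:R * n%:R.
  by rewrite ler_wpM2l ?(ltW dp)// natr1 ler_nat.
apply/andP; split; lra.
Qed.

Lemma subcube_cover (y : 'rV[R]_d) (L : R) (n : nat) (x : 'rV[R]_d) :
  (0 < n)%N -> 0 < L -> cube y L x ->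
  exists k : {ffun 'I_d -> 'I_n}, cube (subcube_corner y L k) (L / n%:R) x.
Proof.
move=> n0 L0 xy.
have dp : 0 < L / n%:R by rewrite divr_gt0// ltr0n.
have dn : L / n%:R * n%:R = L by rewrite divfK// pnatr_eq0 -lt0n.
pose q i := (x 0 i - y 0 i) / (L / n%:R).
have q0 i : 0 <= q i by rewrite divr_ge0 ?(ltW dp)//; have := xy i; lra.
have qn i : (Num.truncn (q i) < n)%N.
  rewrite -(ltr_nat R); apply: le_lt_trans (_ : q i < _).
    by have /andP[] := truncn_itv (q0 i).
  by rewrite /q ltr_pdivrMr// mulrC dn; have := xy i; lra.
exists [ffun i => Ordinal (qn i)] => i.
rewrite mxE ffunE/=; have /andP[h1 h2] := truncn_itv (q0 i).
have e : x 0 i = y 0 i + L / n%:R * q i by rewrite /q mulrCA divff ?mulr1 ?subrKC// gt_eqF.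
have h3 : L / n%:R * (Num.truncn (q i))%:R <= L / n%:R * q i by rewrite ler_wpM2l// ltW.
have h4 : L / n%:R * q i < L / n%:R * ((Num.truncn (q i))%:R + 1) by rewrite ltr_pM2l// natr1.
apply/andP; split; lra.
Qed.

(** A count of grid cells stands in for volume. The assumption [2 * L <= t * n%:R] makes [t] at
    least two cells long, so rounding loses at most a factor 2 in each coordinate. *)
Lemma subcube_in_ball (y a : 'rV[R]_d) (L t : R) (n : nat) :
  0 < L -> 0 < t -> 2 * L <= t * n%:R ->
  (forall i, y 0 i <= a 0 i - t /\ a 0 i + t <= y 0 i + L) ->
  exists S : {set {ffun 'I_d -> 'I_n}},
    (t * n%:R / (2 * L)) ^+ d <= #|S|%:R /\
    forall k x, k \in S -> cube (subcube_corner y L k) (L / n%:R) x ->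
      forall i, `|x 0 i - a 0 i| <= t.
Proof.
move=> L0 t0 tn hy.
have n0 : (0 < n)%N.
  by rewrite lt0n; apply: contraTneq tn => ->; rewrite mulr0 -ltNge mulr_gt0.
set e := L / n%:R.
have e0 : 0 < e by rewrite divr_gt0// ltr0n.
have en : e * n%:R = L by rewrite divfK// pnatr_eq0 -lt0n.
have te : 2 <= t / e by rewrite ler_pdivlMr// /e mulrA ler_pdivrMr// ltr0n.
set m := Num.truncn (t / e).
have /andP[m1 m2] : m%:R <= t / e < m.+1%:R by apply: truncn_itv; lra.
(* The first cell that starts to the right of [a 0 i - t]; the [m] cells from there on end by
   [a 0 i + t], since [e * m%:R <= t] and [e <= t]. *)
pose lo i := (Num.truncn ((a 0 i - t - y 0 i) / e)).+1.
have lo_itv i : a 0 i - t - y 0 i < e * (lo i)%:R /\ e * (lo i)%:R <= a 0 i - t - y 0 i + e.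
  have /andP[h1 h2] : (Num.truncn ((a 0 i - t - y 0 i) / e))%:R <= (a 0 i - t - y 0 i) / e
      < (lo i)%:R.
    by apply: truncn_itv; rewrite divr_ge0 ?(ltW e0)//; have := hy i; lra.
  split; first by rewrite mulrC -ltr_pdivrMr.
  by rewrite /lo -natr1 mulrDr mulr1 lerD2r mulrC -ler_pdivlMr.
have em : e * m%:R <= t by rewrite mulrC -ler_pdivlMr.
have lon (f : {ffun 'I_d -> 'I_m}) i : (lo i + f i < n)%N.
  have hf : (f i).+1%:R <= m%:R :> R by rewrite ler_nat.
  have hf' : e * (f i).+1%:R <= e * m%:R by rewrite ler_wpM2l// ltW.
  rewrite -(ler_nat R) -(ler_pM2l e0) en -addnS natrD mulrDr.
  have [_ h] := lo_itv i; have := hy i.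
  have : e <= t by rewrite -(mul1r e) -ler_pdivlMr//; lra.
  lra.
pose F (f : {ffun 'I_d -> 'I_m}) : {ffun 'I_d -> 'I_n} := [ffun i => Ordinal (lon f i)].
have F_inj : injective F.
  move=> f g /ffunP fg; apply/ffunP => i; apply/val_inj.
  by have /(congr1 val) := fg i; rewrite !ffunE/= => /addnI.
exists [set F f | f in [set: {ffun 'I_d -> 'I_m}]]%SET; split.
  rewrite card_imset// cardsT card_ffun !card_ord natrX lerXn2r ?nnegrE ?ler0n//.
  - by rewrite divr_ge0 ?mulr_ge0// ltW.
  - have -> : t * n%:R / (2 * L) = (t / e) / 2.
      by rewrite /e -en; field; rewrite !gt_eqF//= ltr0n.
    by move: m2; rewrite -natr1; lra.
move=> _ x /imsetP[f _ ->] xk i; have := xk i.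
rewrite mxE ffunE/= -/e natrD mulrDr => /andP[x1 x2].
have hf : (f i).+1%:R <= m%:R :> R by rewrite ler_nat.
have hf' : e * (f i).+1%:R <= e * m%:R by rewrite ler_wpM2l// ltW.
have [h1 h2] := lo_itv i.
have : e <= t by rewrite -(mul1r e) -ler_pdivlMr//; lra.
have hf0 : 0 <= e * (f i)%:R by rewrite mulr_ge0// ltW.
rewrite -natr1 mulrDr mulr1 in hf'.
by rewrite ler_norml => et; apply/andP; split; lra.
Qed.
End Grid.

Section Packing.
Variables (R : realType) (d : nat) (N : 'rV[R]_d -> R).
Hypotheses (hN : is_norm N) (hd : (1 <= d)%N).

Definition coord_equiv (C : R) : Prop :=
  [/\ 1 <= C,
      forall (x : 'rV[R]_d) (t : R), (forall i, `|x 0 i| <= t) -> N x <= C * t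
    & forall (x : 'rV[R]_d) i, `|x 0 i| <= C * N x].

Lemma coord_equiv_ex : exists C, coord_equiv C.
Proof. by have [C C1 [hC hD]] := norm_equiv hN hd; exists C. Qed.

Variable C : R.
Hypothesis hC : coord_equiv C.

Let C1 : 1 <= C. Proof. by have [] := hC. Qed.
Let C0 : 0 < C. Proof. exact: lt_le_trans C1. Qed.

(** Volume comparison by counting cells of one fine grid on a cube of side [2 * (C * D)]: the ball
    of radius [r a / 2] around [c a] contains a share of the cells proportional to [r a ^+ d], and
    these shares are disjoint. *)
Lemma packing (I : eqType) (s : seq I) (c : I -> 'rV[R]_d) (r : I -> R) x (D : R) :
  0 <= D ->
  uniq s -> (forall a, a \in s -> 0 < r a /\ N (c a - x) + r a <= D) ->
  (forall a b, a \in s -> b \in s -> a != b -> r a + r b <= N (c a - c b)) ->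
  \sum_(a <- s) (r a) ^+ d <= (8 * C ^+ 2) ^+ d * D ^+ d.
Proof.
have [_ hC1 hC2] := hC.
move=> Dge0 us hs sep; rewrite -exprMn; have [D0|D0] := ltP 0 D; last first.
  rewrite big_seq big1 ?exprn_ge0 ?mulr_ge0 ?exprn_ge0 ?(ltW C0)// => a /hs[ra].
  by have := norm_ge0 hN (c a - x); lra.
pose L := 2 * (C * D); have L0 : 0 < L by rewrite !mulr_gt0.
(* The sup-norm ball of radius [t a] lies in the [N]-ball of radius [r a / 2]. *)
pose t a := r a / (2 * C).
have t0 a : a \in s -> 0 < t a by move=> /hs[ra _]; rewrite divr_gt0// mulr_gt0.
pose y : 'rV[R]_d := \row_i (x 0 i - C * D).
have [n n0 hn] : exists2 n : nat, (0 < n)%N & forall a, a \in s -> 2 * L <= t a * n%:R.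
  exists (Num.truncn (\sum_(a <- s) 2 * L / t a)).+1 => // a sa.
  rewrite [leRHS]mulrC -ler_pdivrMr ?t0// (le_trans _ (ltW (truncnS_gt _)))//.
  rewrite (bigD1_seq a)//= lerDl big_seq_cond sumr_ge0// => b /andP[sb _].
  by apply: divr_ge0; [rewrite mulr_ge0 ?(ltW L0)|exact: ltW (t0 _ sb)].
have tC a : a \in s -> C * t a = r a / 2 by move=> _; rewrite /t; field; rewrite gt_eqF.
have /choice[S hS] : forall a, exists S : {set {ffun 'I_d -> 'I_n}}, a \in s ->
    (t a * n%:R / (2 * L)) ^+ d <= #|S|%:R /\
    forall k z, k \in S -> cube (subcube_corner y L k) (L / n%:R) z -> N (z - c a) <= r a / 2.
  move=> a; have [sa|] := boolP (a \in s); last by exists finset.set0.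
  have [i|S [S1 S2]] := @subcube_in_ball R d y (c a) L (t a) n L0 (t0 _ sa) (hn _ sa).
    rewrite mxE; have := hC2 (c a - x) i; rewrite !mxE ler_norml => /andP[h1 h2].
    have [ra raD] := hs _ sa.
    have h3 : t a <= C * r a.
      rewrite /t ler_pdivrMr ?mulr_gt0//.
      have CC : 1 <= C * (2 * C) by have := C1; nra.
      have -> : C * r a * (2 * C) = r a * (C * (2 * C)) by ring.
      by rewrite -[leLHS]mulr1 ler_wpM2l// ltW.
    have h4 : C * N (c a - x) + C * r a <= C * D by rewrite -mulrDr ler_wpM2l ?(ltW C0).
    by rewrite /L; split; lra.
  exists S => _; split => // k z kS kz; rewrite -(tC _ sa); apply: hC1 => i.
  by rewrite !mxE; exact: S2 kz i.
have : (\sum_(a <- s) #|S a| <= #|{ffun 'I_d -> 'I_n}|)%N.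
  apply: leq_trans (max_card _); apply: sum_card_disjoint => // a b k sa sb ka kb; apply/eqP/negP => /negP ab.
  (* A cell shared by [a] and [b] would put its own corner within [r a / 2] of [c a] and within
     [r b / 2] of [c b], against the separation. *)
  pose z := subcube_corner y L k.
  have zz : cube z (L / n%:R) z by move=> i; rewrite lexx/= ltrDl divr_gt0// ltr0n.
  have h1 := (hS a sa).2 _ _ ka zz; have h2 := (hS b sb).2 _ _ kb zz.
  have := sep _ _ sa sb ab; have := norm_distD hN z (c a) (c b).
  rewrite (norm_distC hN (c a) z); have [ra _] := hs _ sa; have [rb _] := hs _ sb; lra.
rewrite card_ffun !card_ord -(ler_nat R) natr_sum natrX => hcard.
have nd : 0 < n%:R ^+ d / (8 * C ^+ 2 * D) ^+ d :> R.
  by rewrite divr_gt0// exprn_gt0 ?ltr0n// !mulr_gt0// exprn_gt0.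
rewrite -(ler_pM2r nd) [leRHS]mulrCA divff ?mulr1; last first.
  by rewrite expf_neq0// gt_eqF// !mulr_gt0// exprn_gt0.
apply: le_trans hcard; rewrite mulr_suml [leLHS]big_seq [leRHS]big_seq ler_sum// => a sa.
apply: le_trans (hS _ sa).1; rewrite -expr_div_n -exprMn lerXn2r ?nnegrE//.
- by rewrite mulr_ge0 ?divr_ge0 ?mulr_ge0 ?exprn_ge0// ltW//; exact: (hs _ sa).1.
- by apply: divr_ge0; [rewrite mulr_ge0 ?ler0n ?(ltW (t0 _ sa))|rewrite mulr_ge0 ?(ltW L0)].
rewrite /t /L le_eqVlt; apply/orP; left; apply/eqP; field.
by rewrite !gt_eqF.
Qed.

(** [24 = 8 * 3]: the constant of [packing] with the radius [D = 3 * q] absorbed. *)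
Definition packing_const : R := (24 * C ^+ 2) ^+ d.

Lemma packing_const_ge1 : 1 <= packing_const.
Proof.
rewrite /packing_const exprn_ege1//.
have : 1 <= C ^+ 2 by rewrite exprn_ege1.
lra.
Qed.

Lemma packing3 (I : eqType) (s : seq I) (c : I -> 'rV[R]_d) (r : I -> R) x (q : R) :
  0 <= q ->
  uniq s -> (forall a, a \in s -> 0 < r a /\ N (c a - x) + r a <= 3 * q) ->
  (forall a b, a \in s -> b \in s -> a != b -> r a + r b <= N (c a - c b)) ->
  \sum_(a <- s) (r a) ^+ d <= packing_const * q ^+ d.
Proof.
move=> q0 us h1 h2; rewrite (le_trans (packing _ us h1 h2)) ?mulr_ge0//.
by rewrite /packing_const -!exprMn; rewrite le_eqVlt; apply/orP; left; apply/eqP; congr (_ ^+ _); ring.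
Qed.

Lemma separated_count (s : seq 'rV[R]_d) x (D e : R) : 0 < e -> 0 <= D ->
  uniq s -> (forall a, a \in s -> N (a - x) <= D) ->
  (forall a b, a \in s -> b \in s -> a != b -> e <= N (a - b)) ->
  (size s)%:R <= packing_const * (2 * D / e + 1) ^+ d.
Proof.
move=> e0 D0 us sD sep.
have De : 0 <= D + e / 2 by rewrite addr_ge0// ltW// divr_gt0.
have := @packing3 _ s id (fun=> e / 2) x (D + e / 2) De us.
rewrite big_const_seq count_predT iter_addr_0 => H.
have e2 : 0 < (e / 2) ^+ d by rewrite exprn_gt0// divr_gt0.
rewrite -(ler_pM2r e2) [leLHS]mulr_natl -[leRHS]mulrA -exprMn.
have -> : (2 * D / e + 1) * (e / 2) = D + e / 2 by field; rewrite gt_eqF.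
apply: H => [a sa|a b sa sb ab]; last by rewrite -splitr; exact: sep.
by split; [lra|have := sD _ sa; lra].
Qed.

(** A hit point is within [r a / 2] of its centre and two hit points are within [q] of each other,
    so all the balls lie within [3 * q] of one point of [Q]. *)
Lemma packing_hits_small (s : seq 'rV[R]_d) (r : 'rV[R]_d -> R) (Q : set 'rV[R]_d) (q : R) :
  0 < q -> uniq s -> (forall x y, Q x -> Q y -> N (x - y) <= q) ->
  (forall a b, a \in s -> b \in s -> a != b -> r a + r b <= N (a - b)) ->
  (forall a, a \in s -> [/\ 0 < r a, r a <= q & exists2 u, Q u & N (u - a) <= r a / 2]) ->
  \sum_(a <- s) (r a) ^+ d <= packing_const * q ^+ d.
Proof.
move=> q0 us hQ sep hs; case: s us sep hs => [|a0 s'] us sep hs.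
  rewrite big_nil; apply: mulr_ge0; last exact/exprn_ge0/ltW.
  exact: le_trans ler01 packing_const_ge1.
have [_ _ [u0 Qu0 _]] := hs _ (mem_head _ _).
apply: (packing3 (c := id) (x := u0)) => //; first exact: ltW.
move=> a /hs[ra raq [u Qu ua]]; split=> //.
have := hQ _ _ Qu Qu0; have := norm_distD hN u a u0; rewrite (norm_distC hN a u); lra.
Qed.

(** Moving each centre to its hit point costs half of each radius, so the hit points are still at
    mutual distance at least [q], in a set of diameter at most [q]. Balls of radius [q / 2] around
    them are packed in a ball of radius [3 * (q / 2)]. *)
Lemma packing_hits_large (s : seq 'rV[R]_d) (r : 'rV[R]_d -> R) (Q : set 'rV[R]_d) (q : R) :
  0 < q -> uniq s -> (forall x y, Q x -> Q y -> N (x - y) <= q) ->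
  (forall a b, a \in s -> b \in s -> a != b -> r a + r b <= N (a - b)) ->
  (forall a, a \in s -> q <= r a /\ exists2 u, Q u & N (u - a) <= r a / 2) ->
  (size s)%:R <= packing_const.
Proof.
move=> q0 us hQ sep hs; case: s us sep hs => [|a0 s'] us sep hs.
  exact: le_trans ler01 packing_const_ge1.
set s := a0 :: s' in us sep hs *.
have /choice[u hu] : forall a, exists u, a \in s -> Q u /\ N (u - a) <= r a / 2.
  by move=> a; have [/hs[_ [u Qu ua]]|] := boolP (a \in s); [exists u|exists 0].
have q2 : 0 < q / 2 by lra.
have := @packing3 _ s u (fun=> q / 2) (u a0) (q / 2) (ltW q2) us.
rewrite big_const_seq count_predT iter_addr_0 => H.
rewrite -(ler_pM2r (exprn_gt0 d q2)) [leLHS]mulr_natl; apply: H.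
- move=> a sa; split=> //.
  have := hQ _ _ (hu _ sa).1 (hu _ (mem_head _ _)).1; lra.
- move=> a b sa sb ab; have := sep _ _ sa sb ab.
  have := norm_distD hN (u a) a b; have := norm_distD hN (u b) (u a) b.
  rewrite (norm_distC hN a (u a)).
  have [ra _] := hs _ sa; have [rb _] := hs _ sb.
  have [_ ua] := hu _ sa; have [_ ub] := hu _ sb; lra.
Qed.

End Packing.

Section Diameter.
Variables (R : realType) (d : nat) (N : 'rV[R]_d -> R).
Hypotheses (hN : is_norm N) (hd : (1 <= d)%N).

Lemma diam_ge0 (S : set 'rV[R]_d) : (0 <= diam N S)%E.
Proof. by apply: ereal_sup_ubound; left. Qed.

Lemma diam_ge (S : set 'rV[R]_d) x y : S x -> S y -> ((N (x - y))%:E <= diam N S)%E.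
Proof. by move=> Sx Sy; apply: ereal_sup_ubound; right; exists x => //; exists y. Qed.

Lemma diam_le (S : set 'rV[R]_d) (q : R) : 0 <= q ->
  (forall x y, S x -> S y -> N (x - y) <= q) -> (diam N S <= q%:E)%E.
Proof.
move=> q0 hS; apply: ge_ereal_sup => _ [->|[x Sx [y Sy <-]]]; first by rewrite lee_fin.
by rewrite lee_fin hS.
Qed.

Lemma diam_set0 : diam N set0 = 0%E.
Proof. by apply/eqP; rewrite eq_le diam_ge0 andbT diam_le. Qed.

Lemma diam_fin (S : set 'rV[R]_d) (q : R) : (diam N S <= q%:E)%E ->
  [/\ diam N S = (fine (diam N S))%:E, 0 <= fine (diam N S), fine (diam N S) <= q
    & forall x y, S x -> S y -> N (x - y) <= fine (diam N S)].
Proof.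
move=> Sq; have e : diam N S = (fine (diam N S))%:E.
  by rewrite fineK// ge0_fin_numE ?diam_ge0// (le_lt_trans Sq)// ltry.
split=> //; first exact/fine_ge0/diam_ge0.
- by rewrite -lee_fin -e.
- by move=> x y Sx Sy; rewrite -lee_fin -e; exact: diam_ge.
Qed.

Lemma unit_vector : exists v, N v = 1.
Proof.
pose v0 : 'rV[R]_d := delta_mx 0 (Ordinal hd).
have v00 : N v0 != 0.
  apply/eqP => /(norm0_eq0 hN) /rowP/(_ (Ordinal hd)).
  by rewrite !mxE !eqxx/= => /eqP; rewrite oner_eq0.
exists ((N v0)^-1 *: v0); rewrite normZ// normfV ger0_norm ?norm_ge0//.
by rewrite mulVf.
Qed.

Lemma diam_ball (S : set 'rV[R]_d) c r : 0 < r -> ballN N c r `<=` S -> (r%:E <= diam N S)%E.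
Proof.
move=> r0 hS; have [v v1] := unit_vector.
have hv (e : R) : `|e| = r / 2 -> S (c + e *: v).
  by move=> er; apply: hS; rewrite /ballN/= addrAC subrr add0r normZ// v1 mulr1 er; lra.
have r2 : `|r / 2| = r / 2 by rewrite gtr0_norm// divr_gt0.
have Sp := hv _ r2; have := hv (- (r / 2)); rewrite normrN => /(_ r2) Sm.
have := diam_ge Sp Sm; suff -> : N (c + (r / 2) *: v - (c + - (r / 2) *: v)) = r by [].
rewrite opprD addrACA subrr add0r scaleNr opprK -scalerDl normZ// v1 mulr1.
by rewrite gtr0_norm; lra.
Qed.

Lemma ball_diam_le c r : 0 <= r -> (diam N (ballN N c r) <= (2 * r)%:E)%E.
Proof.
move=> r0; apply: diam_le => [|x y]; first by rewrite mulr_ge0.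
rewrite /ballN/= => xc yc.
by have := norm_distD hN c x y; rewrite (norm_distC hN c y); lra.
Qed.
End Diameter.

Section Dyadic.
Variables (R : realType) (d : nat) (N : 'rV[R]_d -> R).
Hypotheses (hN : is_norm N) (hd : (1 <= d)%N).

Definition dcube (j : int) (k : 'rV[int]_d) : set 'rV[R]_d :=
  [set x | forall i, (k 0 i)%:~R <= (2%:R ^ j) * x 0 i < (k 0 i)%:~R + 1].

Definition dcube_index (j : int) (x : 'rV[R]_d) : 'rV[int]_d :=
  \row_i Num.floor ((2%:R ^ j) * x 0 i).

Lemma dcube_dyadic j k : dyadic (dcube j k).
Proof. by exists j, k. Qed.

Lemma dcube_mem j x : dcube j (dcube_index j x) x.
Proof. by move=> i; rewrite mxE -[X in _ + X]/(1%:~R) -intrD floor_itv. Qed.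

Lemma exp2z_gt0 (j : int) : 0 < 2%:R ^ j :> R.
Proof. by rewrite exprz_gt0. Qed.

(** At the finer scale all corners are integers, so the strict inequalities at the common point [x]
    become weak inequalities between corners, and these hold for the whole cube. *)
Lemma dcube_nested (j j' : int) k k' x : j <= j' ->
  dcube j k x -> dcube j' k' x -> dcube j' k' `<=` dcube j k.
Proof.
move=> jj' xk xk' y yk' i.
have [p pE] : exists p : nat, j' = j + p%:Z.
  by exists `|j' - j|%N; rewrite gez0_abs ?subr_ge0// subrKC.
have e : 2%:R ^ j' = 2 ^+ p * 2%:R ^ j :> R by rewrite pE expfzDr ?pnatr_eq0// mulrC.
have p0 : 0 < 2 ^+ p :> R by rewrite exprn_gt0.
have /andP[h1 h2] := xk i; have /andP[h3 h4] := xk' i; have /andP[h5 h6] := yk' i.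
rewrite e in h3 h4 h5 h6; rewrite -!mulrA in h3 h4 h5 h6.
have g1 : (2 ^ p%:Z * k 0 i <= k' 0 i)%R.
  rewrite -ltzD1 -(ltr_int R) intrD intrM -exprnP rmorphXn/=.
  by apply: le_lt_trans h4; rewrite ler_wpM2l// ltW.
have g2 : (k' 0 i + 1 <= 2 ^ p%:Z * (k 0 i + 1))%R.
  rewrite lezD1 -(ltr_int R) intrM intrD -exprnP rmorphXn/=.
  by apply: le_lt_trans h3 _; rewrite ltr_pM2l.
rewrite -(ler_int R) intrM -exprnP rmorphXn/= in g1.
rewrite -(ler_int R) intrM !intrD -exprnP rmorphXn/= in g2.
rewrite -(ler_pM2l p0) (le_trans g1 h5)/= -(ltr_pM2l p0).
exact: lt_le_trans h6 g2.
Qed.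

Variable C : R.
Hypothesis hC : coord_equiv N C.

Let C1 : 1 <= C. Proof. by have [] := hC. Qed.
Let C0 : 0 < C. Proof. exact: lt_le_trans C1. Qed.

Lemma dcube_dist j k x y : dcube j k x -> dcube j k y -> N (x - y) <= C * (2%:R ^ j)^-1.
Proof.
have [_ h _] := hC.
move=> xk yk; apply: h => i; rewrite !mxE -(ler_pM2l (exp2z_gt0 j)) divff ?gt_eqF ?exp2z_gt0//.
rewrite -{1}(gtr0_norm (exp2z_gt0 j)) -normrM mulrBr ler_norml.
have := xk i; have := yk i.
by move=> /andP[? ?] /andP[? ?]; apply/andP; split; lra.
Qed.

Lemma dcube_ball j k : exists z, ballN N z ((2%:R ^ j)^-1 / (2 * C)) `<=` dcube j k.
Proof.
have [_ _ h] := hC.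
have j0 := exp2z_gt0 j.
exists (\row_i ((2%:R ^ j)^-1 * ((k 0 i)%:~R + 1 / 2))) => x xz i.
have := h (x - \row_i ((2%:R ^ j)^-1 * ((k 0 i)%:~R + 1 / 2))) i.
rewrite !mxE => hx.
have {}hx : `|x 0 i - (2%:R ^ j)^-1 * ((k 0 i)%:~R + 1 / 2)| < (2%:R ^ j)^-1 / 2.
  apply: le_lt_trans hx _; rewrite mulrC -ltr_pdivlMr//.
  by move: xz; rewrite /ballN/= invfM mulrA.
move: hx; rewrite ltr_norml mulrDr => /andP[h1 h2].
by apply/andP; split; [rewrite -ler_pdivrMl//|rewrite -ltr_pdivlMl// mulrDr]; lra.
Qed.

Lemma dcube_diam j k :
  [/\ diam N (dcube j k) = (fine (diam N (dcube j k)))%:E,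
      (2%:R ^ j)^-1 / (2 * C) <= fine (diam N (dcube j k))
    & fine (diam N (dcube j k)) <= C * (2%:R ^ j)^-1].
Proof.
have j0 := exp2z_gt0 j.
have le : (diam N (dcube j k) <= (C * (2%:R ^ j)^-1)%:E)%E.
  by apply: diam_le => [|x y]; [rewrite mulr_ge0// ltW ?invr_gt0|exact: dcube_dist].
have [e _ h _] := diam_fin le.
split=> //; have [z hz] := dcube_ball j k.
rewrite -lee_fin -e; apply: diam_ball hz => //.
by rewrite divr_gt0 ?invr_gt0// mulr_gt0.
Qed.

Lemma dcube_diam_gt0 j k : 0 < fine (diam N (dcube j k)).
Proof.
have [_ + _] := dcube_diam j k; apply: lt_le_trans.
by rewrite divr_gt0 ?invr_gt0 ?exp2z_gt0// mulr_gt0.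
Qed.

Lemma dyadic_scale (u : R) : 0 < u -> u <= 1 ->
  exists j : nat, (2 ^+ j)^-1 <= u /\ u < 2 * (2 ^+ j)^-1.
Proof.
move=> u0 u1.
have ex : exists j, (2 ^+ j)^-1 <= u.
  exists (Num.truncn u^-1).+1; rewrite -[leRHS]invrK lef_pV2 ?posrE ?exprn_gt0 ?invr_gt0//.
  apply: le_trans (ltW (truncnS_gt _)) _; rewrite -natrX ler_nat.
  exact/ltnW/ltn_expl.
have [j hj jmin] := ex_minnP ex; exists j; split=> //.
case: j jmin hj => [|j] jmin _; first by rewrite expr0 invr1 mulr1; lra.
rewrite ltNge; apply/negP => h; suff /jmin : (2 ^+ j)^-1 <= u by rewrite ltnn.
by apply: le_trans h; rewrite exprS invfM mulrA divff ?mul1r// pnatr_eq0.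
Qed.

(** The scale [p] is kept free below [s]: it will be the one that nearly attains the infimum
    defining [gd g s], possibly far below [s]. *)
Lemma ball_dyadic_cover (a : 'rV[R]_d) (s p : R) : 0 < p -> p <= s -> p <= 1 ->
  exists (j : int) (l : seq 'rV[int]_d),
  [/\ (size l)%:R <= (6 * C ^+ 2) ^+ d * (s / p) ^+ d,
      forall k, (diam N (dcube j k) <= p%:E)%E
    & forall x, N (x - a) <= s -> exists2 k, k \in l & dcube j k x].
Proof.
move=> p0 ps p1; have [_ _ hC2] := hC.
have [||j [j1 j2]] := @dyadic_scale (p / C).
- by rewrite divr_gt0.
- by rewrite ler_pdivrMr// mul1r (le_trans p1).
have s0 : 0 < s by exact: lt_le_trans ps.
have q0 : 0 < 2 ^+ j :> R by rewrite exprn_gt0.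
pose lo i := Num.floor (2 ^+ j * (a 0 i - C * s)).
(* An interval of scaled length [l] has points in at most [Num.truncn l + 2] unit intervals with
   integer ends. *)
pose m := (Num.truncn (2 ^+ j * (2 * (C * s)))).+2.
exists (Posz j), [seq \row_i (lo i + (f i)%:Z) | f : {ffun 'I_d -> 'I_m}].
have m0 : 0 <= 2 ^+ j * (2 * (C * s)) by rewrite ltW// !mulr_gt0.
have /andP[m1 m2] := truncn_itv m0.
split.
- rewrite size_map -cardE card_ffun !card_ord natrX -exprMn lerXn2r ?nnegrE ?ler0n//.
    by apply: mulr_ge0; [rewrite mulr_ge0 ?exprn_ge0 ?(ltW C0)|apply: divr_ge0; exact: ltW].
  have q1 : 2 ^+ j <= 2 * C / p.
    rewrite ler_pdivlMr// -ler_pdivrMr// -mulrA.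
    by move/ltW: j2; rewrite -(ler_pM2l q0) [leRHS]mulrCA divff ?mulr1// gt_eqF.
  have sp : 1 <= s / p by rewrite ler_pdivlMr// mul1r.
  have CC : 1 <= C ^+ 2 by rewrite exprn_ege1.
  have h1 : 2 ^+ j * (2 * (C * s)) <= 2 * C / p * (2 * (C * s)).
    by rewrite ler_wpM2r// !mulr_ge0// ltW.
  have h2 : 2 * C / p * (2 * (C * s)) = 4 * (C ^+ 2 * (s / p)) by field; rewrite gt_eqF.
  have h3 : 1 * 1 <= C ^+ 2 * (s / p) by rewrite ler_pM.
  rewrite -mulrA /m -2!natr1; lra.
- move=> k; have [-> _ h] := dcube_diam (Posz j) k.
  by rewrite lee_fin (le_trans h)// mulrC -ler_pdivlMr.
- move=> x xa; exists (dcube_index (Posz j) x); last exact: dcube_mem.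
  have hx i : a 0 i - C * s <= x 0 i /\ x 0 i <= a 0 i + C * s.
    have := hC2 (x - a) i; rewrite !mxE ler_norml => /andP[h1 h2].
    have : C * N (x - a) <= C * s by rewrite ler_wpM2l// ltW.
    by split; lra.
  have fl i : lo i <= Num.floor (2 ^+ j * x 0 i).
    by apply: le_floor; rewrite ler_pM2l//; exact: (hx i).1.
  have fm i : (absz (Num.floor (2 ^+ j * x 0 i) - lo i)%R < m)%N.
    rewrite -(ltr_nat R) natr_absz ger0_norm ?subr_ge0// intrB /m.
    have h1 : 2 ^+ j * a 0 i - 2 ^+ j * (C * s) < (lo i)%:~R + 1.
      have := floor_itv (2 ^+ j * (a 0 i - C * s)); rewrite intrD mulrBr => /andP[_].
      by rewrite /lo mulrBr.
    have h2 := floor_le (2 ^+ j * x 0 i).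
    have h3 : 2 ^+ j * x 0 i <= 2 ^+ j * a 0 i + 2 ^+ j * (C * s).
      by rewrite -mulrDr ler_pM2l//; exact: (hx i).2.
    have h4 : 2 ^+ j * (2 * (C * s)) = 2 * (2 ^+ j * (C * s)) by rewrite mulrCA.
    have h5 : m%:R = (Num.truncn (2 ^+ j * (2 * (C * s))))%:R + 2 :> R by rewrite /m -addn2 natrD.
    have h6 : 2 * (2 ^+ j * (C * s)) < (Num.truncn (2 ^+ j * (2 * (C * s))))%:R + 1.
      by rewrite -h4 natr1.
    rewrite -/m h5; lra.
  apply/mapP; exists [ffun i => Ordinal (fm i)]; first by rewrite mem_enum.
  apply/rowP => i; rewrite !mxE ffunE/= gez0_abs ?subr_ge0//.
  by rewrite -exprnP subrKC.
Qed.

End Dyadic.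

(** * Nested balls and Hausdorff content *)

Lemma halving_small (R : realType) (s : nat -> R) (e : R) : 0 < e ->
  (forall k, s k.+1 <= s k / 2) -> forall k, exists2 m, (k <= m)%N & s m < e.
Proof.
move=> e0 hs k.
have h m : s (k + m)%N * 2 ^+ m <= s k.
  elim: m => [|m IH]; first by rewrite addn0 expr0 mulr1.
  apply: le_trans IH; rewrite addnS exprS mulrA ler_wpM2r ?exprn_ge0//.
  by have := hs (k + m)%N; lra.
exists (k + (Num.truncn (s k / e)).+1)%N; first exact: leq_addr.
set m := (Num.truncn (s k / e)).+1.
have p0 : 0 < 2 ^+ m :> R by rewrite exprn_gt0.
rewrite -(ltr_pM2r p0) (le_lt_trans (h _))// mulrC -ltr_pdivrMr//.
apply: lt_le_trans (truncnS_gt _) _; rewrite -natrX ler_nat.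
exact/ltnW/ltn_expl.
Qed.

Section NestedBalls.
Variables (R : realType) (d : nat) (N : 'rV[R]_d -> R).
Hypotheses (hN : is_norm N) (hd : (1 <= d)%N).
Variable C : R.
Hypothesis hC : coord_equiv N C.

Let C1 : 1 <= C. Proof. by have [] := hC. Qed.
Let C0 : 0 < C. Proof. exact: lt_le_trans C1. Qed.

Lemma nested_balls (a : nat -> 'rV[R]_d) (s : nat -> R) :
  (forall k, 0 < s k) -> (forall k, s k.+1 <= s k / 2) ->
  (forall k, N (a k.+1 - a k) + s k.+1 <= s k) ->
  exists z, forall k, N (z - a k) <= s k.
Proof.
have [_ hC1 hC2] := hC.
move=> s0 hs nest.
have dist k m : N (a (k + m)%N - a k) + s (k + m)%N <= s k.
  elim: m => [|m IH]; first by rewrite addn0 subrr norm0// add0r.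
  have := nest (k + m)%N; have := norm_distD hN (a (k + m)%N) (a (k + m.+1)%N) (a k).
  by rewrite addnS; lra.
have coord k m i : `|a (k + m)%N 0 i - a k 0 i| <= C * s k - C * s (k + m)%N.
  have := hC2 (a (k + m)%N - a k) i; rewrite !mxE => /le_trans; apply.
  by rewrite -mulrBr ler_wpM2l ?(ltW C0)//; have := dist k m; lra.
pose S i := [set a k 0 i - C * s k | k in [set: nat]].
have lohi i k m : a k 0 i - C * s k <= a m 0 i + C * s m.
  have Cs j : 0 < C * s j by rewrite mulr_gt0.
  have [/subnKC <-|/ltnW/subnKC <-] := leqP k m.
  - have := coord k (m - k)%N i; rewrite ler_norml => /andP[h1 h2].
    have := Cs (k + (m - k))%N; lra.
  - have := coord m (k - m)%N i; rewrite ler_norml => /andP[h1 h2].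
    have := Cs (m + (k - m))%N; lra.
pose z : 'rV[R]_d := \row_i sup (S i).
have zk k i : `|z 0 i - a k 0 i| <= C * s k.
  have hsup : has_sup (S i).
    split; first by exists (a 0%N 0 i - C * s 0%N), 0%N.
    by exists (a 0%N 0 i + C * s 0%N) => _ [m _ <-]; exact: lohi.
  have h1 : a k 0 i - C * s k <= sup (S i) by apply: ub_le_sup; [exact: hsup.2|exists k].
  have h2 : sup (S i) <= a k 0 i + C * s k.
    by apply: ge_sup; [exact: hsup.1|move=> _ [m _ <-]; exact: lohi].
  by rewrite mxE ler_norml; apply/andP; split; lra.
exists z => k; rewrite leNgt; apply/negP => hk.
(* The coordinates only give [N (z - a m) <= C * C * s m]. The loss disappears by passing through
   [a m] for a radius [s m] far smaller than the excess of [N (z - a k)] over [s k]. *)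
have e0 : 0 < (N (z - a k) - s k) / (C * C) by rewrite divr_gt0 ?mulr_gt0// subr_gt0.
have [m km] := halving_small e0 hs k.
rewrite ltr_pdivlMr ?mulr_gt0// => hm.
have : N (z - a m) <= C * (C * s m) by apply: hC1 => i; rewrite !mxE; have := zk m i; rewrite !mxE.
have := norm_distD hN (a m) z (a k); have := dist k (m - k)%N; rewrite subnKC//.
have := s0 m; have -> : C * (C * s m) = s m * (C * C) by rewrite mulrA mulrC.
lra.
Qed.

Definition hits (Q : set 'rV[R]_d) (x : 'rV[R]_d) (rho : R) : bool :=
  `[< exists2 u, Q u & N (u - x) <= rho >].

Variables (U : set 'rV[R]_d) (good : nat -> 'rV[R]_d -> R -> Prop) (hr : R -> R) (e c : R).
Hypotheses (c0 : 0 < c) (c1 : c <= 1).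
Hypothesis hr_gt0 : forall r : R, 0 < r -> r <= e -> 0 < hr r.
Hypothesis hr_homo : forall r s : R, 0 < r -> r <= s -> s <= e -> hr r <= hr s.
Hypothesis hr_scale : forall r s : R, 0 < r -> r <= s -> s <= e -> hr s * r ^+ d <= hr r * s ^+ d.

(* The hypothesis of a mass transference principle: the balls [B(a, r a)] pack a fixed proportion of
   the given ball, and their shrunken versions [B(a, t a)] are heavy for [hr]. *)
Definition ubiquitous : Prop := forall (x : 'rV[R]_d) (rho T : R) (K : nat),
  0 < rho -> 0 < T -> ballN N x rho `<=` U ->
  exists (s : seq 'rV[R]_d) (r t : 'rV[R]_d -> R),
  [/\ uniq s,
      forall a, a \in s -> [/\ 0 < t a, t a <= r a / 2, r a <= rho / 2 & N (a - x) + r a <= rho],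
      forall a, a \in s -> good K a (t a) /\ T * r a ^+ d <= hr (t a),
      forall a b, a \in s -> b \in s -> a != b -> r a + r b <= N (a - b)
    & c * rho ^+ d <= \sum_(a <- s) r a ^+ d].

Hypothesis hub : ubiquitous.

(** The factor 4 leaves slack: in [light_step] each of the two kinds of failure accounts for at most
    a quarter of the guaranteed packing sum. *)
Definition avoid_const : R := c / (4 * packing_const d C).

Let pc1 : 1 <= packing_const d C. Proof. exact: packing_const_ge1 hC. Qed.
Let pc0 : 0 < packing_const d C. Proof. exact: lt_le_trans pc1. Qed.

Lemma avoid_const_gt0 : 0 < avoid_const.
Proof. by rewrite divr_gt0// mulr_gt0. Qed.

Lemma avoid_const_lt1 : avoid_const < 1.
Proof. by rewrite ltr_pdivrMr ?mulr_gt0// mul1r; move: pc1 c1; move: (packing_const d C) => p; lra. Qed.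

Variables (Q : nat -> set 'rV[R]_d) (q : nat -> R).
Hypothesis q_itv : forall n, 0 < q n /\ q n <= e.
Hypothesis Qq : forall n x y, Q n x -> Q n y -> N (x - y) <= q n.

Let hrq n : 0 < hr (q n). Proof. by have [? ?] := q_itv n; exact: hr_gt0. Qed.

(** The first clause lets a limit of light balls avoid every piece: a piece containing the limit
    point would meet balls of radius below [q n]. *)
Definition light (x : 'rV[R]_d) (rho : R) : Prop :=
  (forall n, hits (Q n) x rho -> q n < rho) /\
  (forall M : nat, \sum_(0 <= n < M | hits (Q n) x rho) hr (q n) <= avoid_const * hr rho).

(** A single piece with [rho <= q n] already outweighs the threshold, as [avoid_const < 1], so
    failure of either clause of [light] is excess weight. The cut at [r] separates the pieces
    according to the two counting lemmas above. *)
Lemma not_light (x : 'rV[R]_d) (rho r : R) : 0 < rho -> rho <= e -> ~ light x rho ->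
  (exists2 n, hits (Q n) x rho & r <= q n) \/
  (exists M : nat, forall M', (M <= M')%N ->
     avoid_const * hr rho < \sum_(0 <= n < M' | hits (Q n) x rho && (q n < r)) hr (q n)).
Proof.
move=> rho0 rhoe nl.
have [|hsmall] := pselect (exists2 n, hits (Q n) x rho & r <= q n); first by left.
right.
have qr n : hits (Q n) x rho -> q n < r.
  by move=> hn; rewrite ltNge; apply/negP => rq; apply: hsmall; exists n.
have eqsum M : \sum_(0 <= n < M | hits (Q n) x rho && (q n < r)) hr (q n) =
    \sum_(0 <= n < M | hits (Q n) x rho) hr (q n).
  apply: eq_bigl => n; case: (boolP (hits (Q n) x rho)) => // /qr; exact.
have mono M M' : (M <= M')%N -> \sum_(0 <= n < M | hits (Q n) x rho) hr (q n) <=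
    \sum_(0 <= n < M' | hits (Q n) x rho) hr (q n).
  move=> MM; rewrite [leRHS](big_cat_nat (n := M))//= lerDl sumr_ge0// => n _.
  exact/ltW/hrq.
suff [M hM] : exists M : nat, avoid_const * hr rho < \sum_(0 <= n < M | hits (Q n) x rho) hr (q n).
  by exists M => M' MM; rewrite eqsum (lt_le_trans hM)// mono.
apply: contrapT => nM; apply: nl; split=> [n hn|M]; last first.
  by rewrite leNgt; apply/negP => hM; apply: nM; exists M.
rewrite ltNge; apply/negP => rq; apply: nM; exists n.+1.
rewrite big_mkcond big_nat_recr//= hn -[ltLHS]add0r ler_ltD//.
  by apply: sumr_ge0 => m _; case: ifP => // _; exact/ltW/hrq.
apply: lt_le_trans (hr_homo rho0 rq (q_itv n).2).
by rewrite gtr_pMl ?avoid_const_lt1// hr_gt0.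
Qed.

(** If no packed ball were light, the packing sum could be charged to the pieces: each ball to one
    piece of size at least [r a], or to the smaller pieces it meets. Lightness of the given ball
    bounds the total charge by half of [c * rho ^+ d], less than the packing sum. *)
Lemma light_step (x : 'rV[R]_d) (rho : R) (K : nat) : 0 < rho -> rho <= e -> ballN N x rho `<=` U -> light x rho ->
  exists a t, [/\ 0 < t, t <= rho / 4, N (a - x) + 2 * t <= rho, good K a t & light a t].
Proof.
move=> rho0 rhoe BU [l1 l2].
have hrho : 0 < hr rho by exact: hr_gt0.
have rd0 : 0 < rho ^+ d by rewrite exprn_gt0.
(* Chosen so that [avoid_const * T = hr rho / rho ^+ d]: a ball made heavy by small pieces then
   carries at least the weight [hr rho * (r a / rho) ^+ d]. *)
pose T := 4 * packing_const d C * hr rho / (c * rho ^+ d).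
have T0 : 0 < T by rewrite divr_gt0 ?mulr_gt0.
have [s [r [t [us hs hg sep hsum]]]] := hub K rho0 T0 BU.
apply: contrapT => nstep.
have r0 a : a \in s -> 0 < r a by move=> /hs[? ? ? _]; lra.
have te a : a \in s -> t a <= e by move=> /hs[? ? ? _]; lra.
have nl a : a \in s -> ~ light a (t a).
  move=> sa la; apply: nstep; exists a, (t a).
  by have [? ? ? ?] := hs _ sa; have [? _] := hg _ sa; split=> //; lra.
have /choice[m hm] : forall a, exists m : nat, a \in s ->
    (exists2 n, (n < m)%N & hits (Q n) a (t a) && (r a <= q n)) \/
    (forall M', (m <= M')%N -> avoid_const * hr (t a) <
        \sum_(0 <= n < M' | hits (Q n) a (t a) && (q n < r a)) hr (q n)).
  move=> a; have [sa|_] := boolP (a \in s); last by exists 0%N.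
  have [ta _ _ _] := hs _ sa.
  have [[n hn rq]|[M hM]] := not_light (r a) ta (te _ sa) (nl _ sa).
  - by exists n.+1 => _; left; exists n => //; rewrite hn.
  - by exists M => _; right.
(* One truncation index beyond every [m a] turns all sums over pieces into finite sums. *)
pose M := (\sum_(a <- s) m a)%N.
have mM a : a \in s -> (m a <= M)%N by move=> sa; rewrite /M (bigD1_seq a)//= leq_addr.
have hitsx n a : a \in s -> hits (Q n) a (t a) -> hits (Q n) x rho.
  move=> sa /asboolP[u Qu ua]; apply/asboolP; exists u => //.
  have [? ? ? ?] := hs _ sa; have := norm_distD hN a u x; lra.
have hitr a n : a \in s -> hits (Q n) a (t a) -> exists2 u, Q n u & N (u - a) <= r a / 2.
  by move=> sa /asboolP[u Qu ua]; exists u => //; have [? ? ? ?] := hs _ sa; lra.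
pose hitsA a n := hits (Q n) a (t a) && (r a <= q n).
pose hitsB a n := hits (Q n) a (t a) && (q n < r a).
pose A := \sum_(a <- s) \sum_(0 <= n < M | hitsA a n) r a ^+ d.
pose B := \sum_(a <- s) \sum_(0 <= n < M | hitsB a n) hr (q n).
have swap (P : 'rV[R]_d -> nat -> bool) (F : 'rV[R]_d -> nat -> R) :
    \sum_(a <- s) \sum_(0 <= n < M | P a n) F a n =
    \sum_(0 <= n < M) \sum_(a <- [seq a <- s | P a n]) F a n.
  under eq_bigr do rewrite big_mkcond/=.
  rewrite exchange_big/=; apply: eq_bigr => n _.
  by rewrite big_filter [RHS]big_mkcond.
have sepf n (P : 'rV[R]_d -> nat -> bool) a b : a \in [seq a <- s | P a n] ->
    b \in [seq a <- s | P a n] -> a != b -> r a + r b <= N (a - b).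
  by rewrite !mem_filter => /andP[_ sa] /andP[_ sb]; exact: sep.
(* A piece is charged at most [packing_const d C * q n ^+ d]; as [q n < rho], [hr_scale] bounds
   [q n ^+ d] by [hr (q n) * rho ^+ d / hr rho]. *)
have hA : A <= c * rho ^+ d / 4.
  rewrite /A swap.
  apply: (@le_trans _ _ (packing_const d C * (rho ^+ d / hr rho) *
      \sum_(0 <= n < M | hits (Q n) x rho) hr (q n))); last first.
    have -> : c * rho ^+ d / 4 =
        packing_const d C * (rho ^+ d / hr rho) * (avoid_const * hr rho).
      by rewrite /avoid_const; field; rewrite !gt_eqF.
    by rewrite ler_wpM2l// ?l2// mulr_ge0 ?divr_ge0 ?ltW.
  rewrite mulr_sumr [leRHS]big_mkcond ler_sum// => n _.
  have [q0 qe] := q_itv n.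
  have [hx|hx] := boolP (hits (Q n) x rho); last first.
    rewrite big_filter big_seq_cond big1// => a /and3P[sa ha _].
    by rewrite (hitsx _ _ sa ha) in hx.
  apply: le_trans (_ : packing_const d C * q n ^+ d <= _).
    apply: (packing_hits_small hN hC (r := r) q0 _ (@Qq n)) => //.
    - exact: filter_uniq.
    - exact: sepf.
    - move=> a; rewrite mem_filter => /andP[/andP[ha raq] sa]; split=> //; first exact: r0.
      exact: hitr sa ha.
  rewrite -mulrA ler_pM2l// mulrAC ler_pdivlMr//.
  by rewrite [leLHS]mulrC [leRHS]mulrC hr_scale// ltW// l1.
(* A piece smaller than the packing radii involved meets at most [packing_const d C] of the balls,
   which bounds its multiplicity in [B]. *)
have hB : B <= c * rho ^+ d / 4 * (avoid_const * T).
  rewrite /B swap.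
  apply: (@le_trans _ _ (packing_const d C *
      \sum_(0 <= n < M | hits (Q n) x rho) hr (q n))); last first.
    have -> : c * rho ^+ d / 4 * (avoid_const * T) = packing_const d C * (avoid_const * hr rho).
      by rewrite /avoid_const /T; field; rewrite !gt_eqF.
    by rewrite ler_pM2l.
  rewrite mulr_sumr [leRHS]big_mkcond ler_sum// => n _.
  have [q0 qe] := q_itv n.
  have [hx|hx] := boolP (hits (Q n) x rho); last first.
    rewrite big_filter big_seq_cond big1// => a /and3P[sa ha _].
    by rewrite (hitsx _ _ sa ha) in hx.
  rewrite big_const_seq count_predT iter_addr_0 -[leLHS]mulr_natl ler_pM2r//.
  apply: (packing_hits_large hN hC q0 _ (@Qq n) (r := r)).
  - exact: filter_uniq.
  - exact: sepf.
  - move=> a; rewrite mem_filter => /andP[/andP[ha raq] sa]; split; first exact: ltW.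
    exact: hitr sa ha.
have aT0 : 0 < avoid_const * T by rewrite mulr_gt0// avoid_const_gt0.
have hAB : \sum_(a <- s) r a ^+ d <= A + B / (avoid_const * T).
  rewrite /A /B mulr_suml -big_split/= [leLHS]big_seq [leRHS]big_seq ler_sum// => a sa.
  have rd : 0 <= r a ^+ d by rewrite exprn_ge0// ltW// r0.
  have [[n nm hn]|hM] := hm a sa.
  - rewrite -[leLHS]addr0 lerD//; last first.
      rewrite divr_ge0 ?(ltW aT0)// sumr_ge0// => k _; exact/ltW/hrq.
    have nM : (n < M)%N by exact: leq_trans nm (mM _ sa).
    rewrite big_mkcond (bigD1_seq n)/= ?iota_uniq ?mem_index_iota//.
    rewrite /hitsA hn lerDl sumr_ge0// => k _; by case: ifP.
  - rewrite -[leLHS]add0r lerD//; first by rewrite sumr_ge0.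
    rewrite ler_pdivlMr// mulrCA (le_trans _ (ltW (hM _ (mM _ sa))))//.
    rewrite ler_pM2l ?avoid_const_gt0// mulrC.
    exact: (hg _ sa).2.
have : c * rho ^+ d <= c * rho ^+ d / 4 + c * rho ^+ d / 4.
  apply: le_trans hsum (le_trans hAB _); rewrite lerD//.
  by rewrite ler_pdivrMr.
have : 0 < c * rho ^+ d by rewrite mulr_gt0.
lra.
Qed.

(* Descend through the packings, keeping at each stage a ball that is light for the cover [Q]. *)
Lemma ubiquity_avoid (x : 'rV[R]_d) (rho : R) :
  0 < rho -> rho <= e -> ballN N x rho `<=` U ->
  (forall M : nat, \sum_(0 <= n < M) hr (q n) <= avoid_const * hr rho) ->
  exists z, [/\ ballN N x rho z, forall n, ~ Q n z
    & forall K : nat, exists a t, good K a t /\ N (z - a) <= t].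
Proof.
move=> rho0 rhoe BU hsum.
have sum_le (P : pred nat) M : \sum_(0 <= n < M | P n) hr (q n) <= \sum_(0 <= n < M) hr (q n).
  rewrite [leLHS]big_mkcond ler_sum// => n _; case: ifP => // _; exact/ltW/hrq.
have l0 : light x rho.
  split=> [n _|M]; last exact: le_trans (hsum M).
  rewrite ltNge; apply/negP => rq.
  have := hsum n.+1; rewrite big_nat_recr//= leNgt => /negP; apply.
  apply: (@lt_le_trans _ _ (hr rho)).
    by rewrite gtr_pMl ?avoid_const_lt1// hr_gt0.
  rewrite ler_wpDl ?sumr_ge0//; first by move=> k _; exact/ltW/hrq.
  exact: hr_homo (q_itv n).2.
pose St (p : 'rV[R]_d * R) := [/\ 0 < p.2, p.2 <= e, ballN N p.1 p.2 `<=` U & light p.1 p.2].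
have /choice[F hF] : forall Kp : nat * ('rV[R]_d * R), exists p' : 'rV[R]_d * R, St Kp.2 ->
    [/\ St p', p'.2 <= Kp.2.2 / 4, N (p'.1 - Kp.2.1) + 2 * p'.2 <= Kp.2.2 & good Kp.1 p'.1 p'.2].
  move=> [K [y s]]; have [[/= s0 se BsU ls]|] := pselect (St (y, s)); last by exists (y, s).
  have [a [t [t0 ts tas gat la]]] := light_step K s0 se BsU ls.
  exists (a, t) => _; split=> //=; split=> //=; first lra.
  apply: subset_trans BsU => u; rewrite /ballN/= => ua.
  by have := norm_distD hN a u y; lra.
pose f := fix f k := if k is k'.+1 then F (k', f k') else (x, rho).
have fSt k : St (f k) by elim: k => [|k IH]; [split|have [] := hF (k, f k) IH].
have fstep k := hF (k, f k) (fSt k).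
have f0 k : 0 < (f k).2 by have [] := fSt k.
have [||z hz] := @nested_balls (fun k => (f k).1) (fun k => (f k).2) f0.
- by move=> k; have [_ h _ _] := fstep k; have := f0 k; move: h => /=; lra.
- by move=> k; have [_ _ h _] := fstep k; have := f0 k.+1; move: h => /=; lra.
exists z; split.
- rewrite /ballN/=.
  (* The limit point is only known to lie in closed balls; the factor 2 in
     [N (a - x) + 2 * t <= rho] puts the first of them inside the open ball. *)
  have [_ _ h _] := fstep 0%N; have := f0 1%N; have := hz 1%N; move: h => /=.
  by have := norm_distD hN (F (0%N, (x, rho))).1 z x; lra.
- move=> n Qz; have [q0 _] := q_itv n.
  have [k|m _ mq] := @halving_small R (fun k => (f k).2) (q n) q0 _ 0%N.
    by have [_ h _ _] := fstep k; have := f0 k; move: h => /=; lra.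
  have [_ _ _ [l1 _]] := fSt m.
  have : q n < (f m).2 by apply: l1; apply/asboolP; exists z => //; exact: hz.
  by move: mq => /=; lra.
- move=> K; exists (f K.+1).1, (f K.+1).2; split; last exact: hz.
  by have [_ _ _ h] := fstep K.
Qed.

End NestedBalls.

Section RealSums.
Variable R : realType.

Lemma geometric_sum_le (beta : R) (m n : nat) : 2 <= beta -> (m <= n)%N ->
  \sum_(m <= j < n) beta ^+ j <= 2 / beta * beta ^+ n.
Proof.
move=> b2 /subnKC <-; have b0 : 0 < beta by lra.
have b1 : 2 / beta <= 1 by rewrite ler_pdivrMr// mul1r.
elim: (n - m)%N => [|k IH].
  by rewrite addn0 big_geq// mulr_ge0 ?exprn_ge0 ?divr_ge0// ltW.
rewrite addnS big_nat_recr ?leq_addr//= (le_trans (lerD IH (lexx _)))//.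
rewrite -[X in _ + X]mul1r -mulrDl exprS mulrA divfK ?gt_eqF//.
by rewrite ler_wpM2r ?exprn_ge0 ?(ltW b0)//; lra.
Qed.

Lemma exprD_le (x y : R) (n : nat) : 0 <= x -> 0 <= y -> (x + y) ^+ n <= 2 ^+ n * (x ^+ n + y ^+ n).
Proof.
move=> x0 y0; have [xy|/ltW yx] := leP x y.
- apply: (@le_trans _ _ ((2 * y) ^+ n)); first by rewrite lerXn2r ?nnegrE; lra.
  by rewrite exprMn ler_wpM2l ?exprn_ge0// lerDr exprn_ge0.
- apply: (@le_trans _ _ ((2 * x) ^+ n)); first by rewrite lerXn2r ?nnegrE; lra.
  by rewrite exprMn ler_wpM2l ?exprn_ge0// lerDl exprn_ge0.
Qed.

(** For eventually nonnegative terms this is divergence of the series; the quantified starting index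
    lets finitely many terms be dropped. *)
Definition diverges (x : nat -> R) : Prop :=
  forall (k0 : nat) (B : R), exists2 k, (k0 <= k)%N & B < \sum_(k0 <= j < k) x j.

(** If the terms are eventually below [e], the cap is idle in the tail; otherwise infinitely many
    capped terms equal [e]. *)
Lemma diverges_min (x : nat -> R) (e : R) (k1 : nat) : 0 < e ->
  (forall k, (k1 <= k)%N -> 0 <= x k) -> diverges x -> diverges (fun k => Num.min (x k) e).
Proof.
move=> e0 x0 dx.
suff H k0 B : (k1 <= k0)%N -> exists2 k, (k0 <= k)%N & B < \sum_(k0 <= j < k) Num.min (x j) e.
  move=> k0 B; pose S := \sum_(k0 <= j < maxn k0 k1) Num.min (x j) e.
  have [k hk Bk] := H (maxn k0 k1) (B - S) (leq_maxr _ _).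
  have hk0 := leq_trans (leq_maxl k0 k1) hk.
  by exists k => //; rewrite (big_cat_nat (n := maxn k0 k1)) ?leq_maxl//= -/S; lra.
move=> k10.
have [[K k0K small]|nsmall] := pselect (exists2 K, (k0 <= K)%N & forall k, (K <= k)%N -> x k < e).
  pose S := \sum_(k0 <= j < K) Num.min (x j) e.
  have [k hk Bk] := dx K (B - S).
  exists k; first exact: leq_trans hk.
  rewrite (big_cat_nat (n := K))//= -/S.
  rewrite (eq_big_nat _ _ (F2 := x)); first lra.
  by move=> j /andP[Kj _]; apply/min_idPl/ltW/small.
have large K : (k0 <= K)%N -> exists2 k, (K <= k)%N & e <= x k.
  move=> k0K; apply: contrapT => nk; apply: nsmall; exists K => // k Kk.
  by rewrite ltNge; apply/negP => ek; apply: nk; exists k.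
suff /(_ (Num.truncn (B / e)).+1)[k hk Bk] : forall m : nat, exists2 k, (k0 <= k)%N &
    m%:R * e <= \sum_(k0 <= j < k) Num.min (x j) e.
  exists k => //; apply: lt_le_trans Bk; rewrite -ltr_pdivrMr//.
  exact: truncnS_gt.
elim=> [|m [k k0k IH]]; first by exists k0; rewrite // big_geq// mul0r.
have [k' kk' ek'] := large k k0k; exists k'.+1; first exact: leq_trans k0k (leqW kk').
have h0 : 0 <= \sum_(k <= j < k') Num.min (x j) e.
  rewrite big_nat_cond sumr_ge0// => j /andP[/andP[kj _] _].
  by rewrite le_min x0 ?(ltW e0)//; exact: leq_trans k10 (leq_trans k0k kj).
rewrite big_nat_recr/=; last exact: leq_trans k0k kk'.
rewrite (big_cat_nat (n := k))//= -natr1 mulrDl mul1r (min_idPr ek').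
lra.
Qed.
End RealSums.

Section Greedy.
Variables (R : realType) (d : nat) (N : 'rV[R]_d -> R).
Hypotheses (hN : is_norm N) (hd : (1 <= d)%N).
Variable C : R.
Hypothesis hC : coord_equiv N C.

Let pc := packing_const d C.
Let pc1 : 1 <= pc. Proof. exact: packing_const_ge1 hC. Qed.
Let pc0 : 0 < pc. Proof. exact: lt_le_trans pc1. Qed.

Lemma filter_count_le (S F L : seq 'rV[R]_d) (P : 'rV[R]_d -> 'rV[R]_d -> bool) : uniq S ->
  (size S <= size [seq a <- S | (a \notin F) && all (P a) L] + size F
     + \sum_(b <- L) size [seq a <- S | ~~ P a b])%N.
Proof.
move=> uS.
have -> : (\sum_(b <- L) size [seq a <- S | ~~ P a b] = \sum_(a <- S) \sum_(b <- L) ~~ P a b)%N.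
  rewrite exchange_big/=; apply: eq_bigr => b _.
  by rewrite size_filter -sum1_count big_mkcond.
have hF : (size [seq a <- S | a \in F] <= size F)%N.
  apply: uniq_leq_size; first exact: filter_uniq.
  by move=> a; rewrite mem_filter => /andP[].
apply: (@leq_trans (size [seq a <- S | (a \notin F) && all (P a) L]
    + size [seq a <- S | a \in F] + \sum_(a <- S) \sum_(b <- L) ~~ P a b)); last first.
  by rewrite leq_add2r leq_add2l.
rewrite !size_filter -!sum1_count !(big_mkcond (fun a => _ && _)) !(big_mkcond (fun a => a \in F))/=.
rewrite -sum1_size -!big_split/=; apply: leq_sum => a _.
have [aF|aF] := boolP (a \in F); first by rewrite /= add0n leq_addr.
have [aL|/allPn[b bL Pb]] := boolP (all (P a) L); first by rewrite /= addn0 leq_addr.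
rewrite /= !add0n; case/splitPr: bL => L1 L2.
by rewrite big_cat/= big_cons Pb/= addnCA leq_addr.
Qed.

(** Points are lost in [F] or within [rr b + rk] of an earlier [b]. Near [b] there are at most a
    constant times [(h * rr b) ^+ d + 1] of them, so both the packed sum and [size L] must be
    controlled. The three losses take [kappa / 8] each. The upper bound on [New] controls [size L]
    at later stages. *)
Lemma greedy_stage (kappa c h rk : R) (x : 'rV[R]_d) (S F L : seq 'rV[R]_d)
    (rr : 'rV[R]_d -> R) (rho : R) :
  0 <= kappa -> 0 < rho -> 0 < h -> 1 <= rho * h -> uniq S ->
  (forall a, a \in S -> N (a - x) <= rho / 2) ->
  (forall a b, a \in S -> b \in S -> a != b -> h^-1 <= N (a - b)) ->
  kappa * (rho * h) ^+ d <= (size S)%:R ->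
  0 < rk -> rk <= (4 * h)^-1 ->
  (forall b, b \in L -> 0 < rr b) ->
  \sum_(b <- L) rr b ^+ d <= c * rho ^+ d ->
  pc * 4 ^+ d * c <= kappa / 8 ->
  pc * 4 ^+ d * (size L)%:R <= kappa / 8 * (rho * h) ^+ d ->
  (size F)%:R <= kappa / 8 * (rho * h) ^+ d ->
  let New := [seq a <- S | (a \notin F) && all (fun b => rr b + rk <= N (a - b)) L] in
  kappa / 2 * (rho * h) ^+ d <= (size New)%:R <= pc * 2 ^+ d * (rho * h) ^+ d.
Proof.
move=> kappa0 rho0 h0 rh uS Sx sep hS rk0 rkh L0 hL hc hsL hF /=.
have hi : 0 < h^-1 by rewrite invr_gt0.
apply/andP; split; last first.
  have := @separated_count R d N hN C hC [seq a <- S | (a \notin F) && all (fun b => rr b + rk <= N (a - b)) L]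
    x (rho / 2) h^-1 hi.
  move=> /(_ (ltW (divr_gt0 rho0 (ltr0Sn _ 1)))) H.
  apply: le_trans (H _ _ _) _.
  - exact: filter_uniq.
  - by move=> a; rewrite mem_filter => /andP[_]; exact: Sx.
  - by move=> a b; rewrite !mem_filter => /andP[_ ?] /andP[_ ?]; exact: sep.
  have -> : pc * 2 ^+ d * (rho * h) ^+ d = pc * (2 * (rho * h)) ^+ d by rewrite [in RHS]exprMn mulrA.
  rewrite ler_pM2l// invrK mulrCA divff// mulr1.
  by rewrite lerXn2r ?nnegrE; lra.
have := filter_count_le F L (fun a b => rr b + rk <= N (a - b)) uS.
rewrite -(ler_nat R) !natrD natr_sum.
set New := [seq a <- S | _] => hcount.
have hb b : b \in L -> (size [seq a <- S | ~~ (rr b + rk <= N (a - b))])%:R <=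
    pc * 4 ^+ d * (h ^+ d * rr b ^+ d + 1).
  move=> bL; have rb := L0 _ bL.
  have D0 : 0 <= rr b + rk by lra.
  apply: le_trans (@separated_count R d N hN C hC _ b (rr b + rk) h^-1 hi D0 _ _ _) _.
  - exact: filter_uniq.
  - by move=> a; rewrite mem_filter -ltNge => /andP[/ltW].
  - by move=> a a'; rewrite !mem_filter => /andP[_ ?] /andP[_ ?]; exact: sep.
  rewrite -[leRHS]mulrA ler_pM2l// invrK.
  have rkh' : rk * h <= 4^-1 by rewrite -ler_pdivlMr// -invfM.
  have hr0 : 0 <= h * rr b by rewrite mulr_ge0// ltW.
  have hk0 : 0 <= rk * h by rewrite mulr_ge0// ltW.
  have -> : 2 * (rr b + rk) * h + 1 = 2 * (h * rr b) + (2 * (rk * h) + 1) by ring.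
  apply: (@le_trans _ _ ((2 * (h * rr b + 1)) ^+ d)).
    by rewrite lerXn2r ?nnegrE; lra.
  rewrite exprMn (_ : 4 = 2 * 2 :> R); last by lra.
  rewrite exprMn -mulrA ler_pM2l ?exprn_gt0//.
  by apply: le_trans (exprD_le _ _ _) _; rewrite // expr1n exprMn.
have hsum : \sum_(b <- L) (size [seq a <- S | ~~ (rr b + rk <= N (a - b))])%:R <=
    kappa / 4 * (rho * h) ^+ d.
  apply: (@le_trans _ _ (\sum_(b <- L) pc * 4 ^+ d * (h ^+ d * rr b ^+ d + 1))).
    rewrite [leLHS]big_seq [leRHS]big_seq ler_sum// => b bL; exact: hb.
  rewrite -mulr_sumr big_split/= -mulr_sumr big_const_seq count_predT iter_addr_0 mulrDr.
  have h1 : pc * 4 ^+ d * (h ^+ d * \sum_(b <- L) rr b ^+ d) <= kappa / 8 * (rho * h) ^+ d.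
    apply: (@le_trans _ _ (pc * 4 ^+ d * (h ^+ d * (c * rho ^+ d)))).
      apply: ler_wpM2l; first by apply: mulr_ge0; [exact: ltW|exact: exprn_ge0].
      by apply: ler_wpM2l => //; exact/exprn_ge0/ltW.
    have -> : pc * 4 ^+ d * (h ^+ d * (c * rho ^+ d)) = pc * 4 ^+ d * c * (rho * h) ^+ d.
      by rewrite exprMn; ring.
    by rewrite ler_wpM2r// exprn_ge0// mulr_ge0 ?ltW.
  move: hsL h1; lra.
have Z0 : 0 <= kappa * (rho * h) ^+ d by rewrite mulr_ge0// exprn_ge0// mulr_ge0 ?ltW.
lra.
Qed.
End Greedy.

(** * Packings in regular systems *)

Section RegularUbiquity.
Variables (R : realType) (d : nat) (N : 'rV[R]_d -> R).
Hypotheses (hN : is_norm N) (hd : (1 <= d)%N).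
Variable C : R.
Hypothesis hC : coord_equiv N C.
Variables (U A : set 'rV[R]_d) (H : 'rV[R]_d -> R).

Lemma admissible_bounded (x : 'rV[R]_d) (D K : R) : admissible N A H ->
  exists F : seq 'rV[R]_d, forall a, A a -> N (a - x) <= D -> H a <= K -> a \in F.
Proof.
move=> adm.
pose m := (Num.truncn (N x + `|D| + `|K|)).+1.
have hm : N x + `|D| + `|K| < m%:R by exact: truncnS_gt.
have /finite_seqP[F hF] := adm m (ltn0Sn _).
exists F => a Aa aD aK.
have : [set a | A a /\ N a < m%:R /\ H a <= m%:R] a.
  have := norm_ge0 hN x; have := ler_norm D; have := ler_norm K.
  have := normr_ge0 D; have := normr_ge0 K.
  have := norm_distD hN x a 0; rewrite !subr0 => ? ? ? ? ? ?.
  by split=> //; split; lra.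
by rewrite hF.
Qed.

(** Only points of the half ball are taken, so that balls of radius at most [rho / 2] around them
    stay in the given ball. *)
Lemma regular_count (kappa : R) (x : 'rV[R]_d) (rho : R) : 0 < kappa -> 0 < rho ->
  (forall B, open_ballN N B -> B `<=` U ->
      exists2 hB : R, 0 < hB & forall h : R, hB < h ->
        exists s : seq 'rV[R]_d, [/\ uniq s,
          forall a, a \in s -> A a /\ B a,
          kappa * (fine (diam N B)) ^+ d * h ^+ d <= (size s)%:R,
          forall a, a \in s -> H a <= h
        & forall a a', a \in s -> a' \in s -> a != a' -> h^-1 <= N (a - a')]) ->
  ballN N x rho `<=` U ->
  exists hB : R, forall h : R, hB < h -> 0 < h ->
    exists s : seq 'rV[R]_d, [/\ uniq s,
      forall a, a \in s -> [/\ A a, N (a - x) < rho / 2 & H a <= h],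
      kappa / 2 ^+ d * (rho * h) ^+ d <= (size s)%:R
    & forall a a', a \in s -> a' \in s -> a != a' -> h^-1 <= N (a - a')].
Proof.
move=> k0 rho0 hreg BU.
have r2 : 0 < rho / 2 by lra.
have [||hB _ hhB] := hreg (ballN N x (rho / 2)).
- by exists x, (rho / 2).
- by apply: subset_trans BU => u; rewrite /ballN/=; lra.
exists hB => h hBh h0; have [s [us sA sc sH sep]] := hhB _ hBh.
exists s; split=> // [a sa|].
  by have [Aa Ba] := sA _ sa; split=> //; exact: sH.
apply: le_trans sc.
rewrite exprMn mulrA ler_wpM2r ?exprn_ge0 ?(ltW h0)// -mulrA ler_wpM2l ?(ltW k0)//.
rewrite -exprVn -exprMn lerXn2r ?nnegrE//.
- by rewrite mulr_ge0// ltW.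
- exact/fine_ge0/diam_ge0.
have [e _ _ _] := diam_fin (ball_diam_le hN x (ltW r2)).
by rewrite -lee_fin -e mulrC; apply: (diam_ball hN hd r2); exact: subset_refl.
Qed.

(** Points are added greedily, generation by generation, with radius [r k] at height [b ^ k]. While
    the packed sum is below [c * rho ^+ d], generation [k] adds at least a constant times
    [rho ^+ d * (b ^ k * r k) ^+ d], and divergence ends this after finitely many generations. [c]
    and [b] do not depend on the ball, on [K] or on [r]. *)
Lemma greedy_packing : regular_system N U A H ->
  exists (c : R) (b : nat), [/\ 0 < c, c <= 1, (2 <= b)%N
  & forall (x : 'rV[R]_d) (rho K : R), 0 < rho -> ballN N x rho `<=` U ->
    exists k1 : nat, forall (k0 : nat) (r : nat -> R), (k1 <= k0)%N ->
      (forall k, (k0 <= k)%N -> 0 < r k /\ r k <= (4 * b%:R ^+ k)^-1) ->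
      diverges (fun k => (b%:R ^+ k * r k) ^+ d) ->
      exists (L : seq 'rV[R]_d) (idx : 'rV[R]_d -> nat),
      [/\ uniq L,
          forall a, a \in L -> [/\ A a, K < H a, H a <= b%:R ^+ idx a,
            N (a - x) < rho / 2 & (k0 <= idx a)%N],
          forall a a', a \in L -> a' \in L -> a != a' ->
            r (idx a) + r (idx a') <= N (a - a')
        & c * rho ^+ d <= \sum_(a <- L) r (idx a) ^+ d]].
Proof.
move=> [adm [kappa kappa0 hreg]].
pose pc := packing_const d C.
have pc1 : 1 <= pc by exact: packing_const_ge1 hC.
have pc0 : 0 < pc by exact: lt_le_trans pc1.
have q0 n : 0 < n.+1%:R ^+ d :> R by rewrite exprn_gt0.
pose k' := kappa / 2 ^+ d; have k'0 : 0 < k' by rewrite divr_gt0.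
have p4 : 0 < pc * 4 ^+ d by rewrite mulr_gt0.
have p2 : 0 < pc * 2 ^+ d by rewrite mulr_gt0.
(* While the packed sum is at most [c * rho ^+ d], the volume of the balls already packed excludes
   at most the share [k' / 8] of the new points. *)
pose c := Num.min 1 (k' / 8 / (pc * 4 ^+ d)).
have c0 : 0 < c by rewrite lt_min ltr01/= !divr_gt0.
have c1 : c <= 1 by rewrite ge_min lexx.
have hc : pc * 4 ^+ d * c <= k' / 8 by rewrite mulrC -ler_pdivlMr// ge_min lexx orbT.
(* The number of earlier points is bounded by a geometric sum of ratio [b ^ d], which its last term
   dominates; [W / b ^ d] then compares the loss it causes with the permitted share [k' / 8], whence
   [W <= b]. *)
pose W := pc * 4 ^+ d * (pc * 2 ^+ d) * 2 / (k' / 8).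
have W0 : 0 < W by rewrite !divr_gt0 ?mulr_gt0.
pose b := (Num.truncn W).+2.
have bW : W <= b%:R by apply: le_trans (ltW (truncnS_gt W)) _; rewrite ler_nat.
have b2 : 2 <= b%:R :> R by rewrite (ler_nat R 2).
have b1 : 1 <= b%:R :> R by rewrite ler1n.
have b0 : 0 < b%:R :> R by lra.
have bk0 k : 0 < b%:R ^+ k :> R by rewrite exprn_gt0.
exists c, b; split=> // x rho K rho0 BU.
have [hB hcount] := regular_count kappa0 rho0 hreg BU.
have [F hF] := @admissible_bounded x (rho / 2) K adm.
have rd : 0 < rho ^+ d by rewrite exprn_gt0.
(* From [k1] on the radius exceeds the separation of the new points, and the finite list [F], which
   holds the points of height at most [K], is a negligible loss. *)
pose k1 := (Num.truncn (`|hB| + rho^-1 + (size F)%:R * 8 / (k' * rho))).+1.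
have hk1 k : (k1 <= k)%N -> [/\ hB < b%:R ^+ k, 1 <= rho * b%:R ^+ k &
    (size F)%:R <= k' / 8 * (rho * b%:R ^+ k) ^+ d].
  move=> kk; have k_gt0 : (0 < k)%N by exact: leq_ltn_trans kk.
  have : `|hB| + rho^-1 + (size F)%:R * 8 / (k' * rho) < b%:R ^+ k.
    apply: lt_le_trans (truncnS_gt _) _.
    rewrite -natrX ler_nat; apply: leq_trans kk (leq_trans (ltnW (ltn_expl k (ltnSn 1))) _).
    by rewrite leq_exp2r.
  have : 0 <= rho^-1 by rewrite invr_ge0 ltW.
  have : 0 <= (size F)%:R * 8 / (k' * rho) by rewrite divr_ge0 ?mulr_ge0// ltW.
  have := ler_norm hB; have := normr_ge0 hB => ? ? ? ? ?.
  have h1 : 1 <= rho * b%:R ^+ k by rewrite -ler_pdivrMl// mulr1; lra.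
  split=> //; first lra.
  have h2 : rho * b%:R ^+ k <= (rho * b%:R ^+ k) ^+ d by apply: ler_eXnr.
  apply: le_trans (ler_wpM2l _ h2); last by rewrite ltW// divr_gt0.
  have : (size F)%:R * 8 / (k' * rho) <= b%:R ^+ k by lra.
  by rewrite ler_pdivrMr ?mulr_gt0//; lra.
exists k1 => k0 r k10 hr hdiv.
suff Hstep n : exists (L : seq 'rV[R]_d) (idx : 'rV[R]_d -> nat),
    [/\ uniq L,
        forall a, a \in L -> [/\ A a, K < H a, H a <= b%:R ^+ idx a,
          N (a - x) < rho / 2 & (k0 <= idx a)%N],
        forall a a', a \in L -> a' \in L -> a != a' -> r (idx a) + r (idx a') <= N (a - a'),
        (size L)%:R <= pc * 2 ^+ d * \sum_(k0 <= j < k0 + n) (rho * b%:R ^+ j) ^+ d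
      & c * rho ^+ d <= \sum_(a <- L) r (idx a) ^+ d \/
        k' / 2 * rho ^+ d * \sum_(k0 <= j < k0 + n) (b%:R ^+ j * r j) ^+ d
          <= \sum_(a <- L) r (idx a) ^+ d].
  have [k k0k Hk] := hdiv k0 (c * rho ^+ d / (k' / 2 * rho ^+ d)).
  have [L [idx [uL hL sep _ hor]]] := Hstep (k - k0)%N.
  exists L, idx; split=> //; case: hor => //; rewrite subnKC// => /(le_trans _); apply.
  have kr0 : 0 < k' / 2 * rho ^+ d by rewrite mulr_gt0// divr_gt0.
  by rewrite ltr_pdivrMr// in Hk; rewrite [leRHS]mulrC ltW.
elim: n => [|n [L [idx [uL hL sep sizeL hor]]]].
  exists [::], (fun=> 0%N); split=> //; first by rewrite addn0 big_geq// mulr0.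
  by right; rewrite addn0 big_geq// mulr0 big_nil.
set k := (k0 + n)%N in sizeL hor *.
have k0k : (k0 <= k)%N by exact: leq_addr.
rewrite addnS -/k.
have hk := bk0 k.
have [done|/ltW notdone] := leP (c * rho ^+ d) (\sum_(a <- L) r (idx a) ^+ d).
  exists L, idx; split=> //; last by left.
  apply: le_trans sizeL _; rewrite ler_pM2l// big_nat_recr//= lerDl exprn_ge0// mulr_ge0// ltW//.
have [hBk rhk Fk] := hk1 k (leq_trans k10 k0k).
have [S [uS hS sS sepS]] := hcount _ hBk hk.
have [rk0 rk4] := hr k k0k.
have sizeL' : pc * 4 ^+ d * (size L)%:R <= k' / 8 * (rho * b%:R ^+ k) ^+ d.
  have bd2 : 2 <= b%:R ^+ d :> R.
    by apply: le_trans b2 _; exact: ler_eXnr.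
  have hsum : \sum_(k0 <= j < k) (rho * b%:R ^+ j) ^+ d <=
      rho ^+ d * (2 / b%:R ^+ d * (b%:R ^+ d) ^+ k).
    under eq_bigr do rewrite exprMn exprAC.
    by rewrite -mulr_sumr ler_pM2l// geometric_sum_le.
  have h1 : pc * 4 ^+ d * (size L)%:R <=
      pc * 4 ^+ d * (pc * 2 ^+ d * (rho ^+ d * (2 / b%:R ^+ d * (b%:R ^+ d) ^+ k))).
    by rewrite ler_pM2l// (le_trans sizeL)// ler_pM2l.
  apply: le_trans h1 _.
  have -> : (rho * b%:R ^+ k) ^+ d = rho ^+ d * (b%:R ^+ d) ^+ k by rewrite exprMn exprAC.
  have -> : pc * 4 ^+ d * (pc * 2 ^+ d * (rho ^+ d * (2 / b%:R ^+ d * (b%:R ^+ d) ^+ k))) =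
      W / b%:R ^+ d * (k' / 8 * (rho ^+ d * (b%:R ^+ d) ^+ k)).
    rewrite /W; field; rewrite (gt_eqF k'0) expf_neq0// gt_eqF//.
  rewrite ger_pMl; last by rewrite mulr_gt0 ?divr_gt0// mulr_gt0// exprn_gt0// exprn_gt0.
  rewrite ler_pdivrMr ?exprn_gt0// mul1r (le_trans bW)//.
  by exact: ler_eXnr.
have rL a : a \in L -> 0 < r (idx a) by move=> /hL[_ _ _ _ ki]; have [] := hr _ ki.
have Srho a : a \in S -> N (a - x) <= rho / 2 by move=> /hS[_ /ltW].
have := greedy_stage hN hC (ltW k'0) rho0 hk rhk uS Srho sepS sS rk0 rk4 rL notdone hc sizeL' Fk.
set New := [seq a <- S | _] => /andP[New1 New2].
have NewL a : a \in New -> a \notin L.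
  rewrite mem_filter => /andP[/andP[_ /allP aL] _]; apply/negP => /[dup] aL' /aL.
  by rewrite subrr norm0//; have := rL _ aL'; lra.
(* A generation index is defined on all vectors; this extension is consistent because no new point
   belongs to [L]. *)
pose idx' a := if a \in L then idx a else k.
have idxL a : a \in L -> idx' a = idx a by rewrite /idx' => ->.
have idxN a : a \in New -> idx' a = k by rewrite /idx' => /NewL/negbTE ->.
have NewP a : a \in New -> [/\ a \in S, a \notin F & forall a', a' \in L -> r (idx a') + r k <= N (a - a')].
  by rewrite mem_filter => /andP[/andP[aF /allP aL] aS].
exists (L ++ New), idx'; split.
- rewrite cat_uniq uL filter_uniq// andbT/=; apply/hasPn => a; exact: NewL.
- move=> a; rewrite mem_cat => /orP[aL|aN]; first by rewrite idxL//; exact: hL.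
  rewrite idxN//; have [aS aF _] := NewP _ aN; have [Aa ax Ha] := hS _ aS.
  split=> //; rewrite ltNge; apply: contra aF; apply: hF => //; exact: ltW.
- move=> a a'; rewrite !mem_cat => /orP[aL|aN] /orP[a'L|a'N] aa'.
  + by rewrite !idxL//; exact: sep.
  + rewrite idxL// idxN// norm_distC//; have [_ _] := NewP _ a'N; exact.
  + rewrite idxN// idxL// addrC; have [_ _] := NewP _ aN; exact.
  + rewrite !idxN//; have [aS _ _] := NewP _ aN; have [a'S _ _] := NewP _ a'N.
    apply: le_trans (sepS _ _ aS a'S aa').
    have bi : 0 < (b%:R ^+ k)^-1 :> R by rewrite invr_gt0.
    by move: rk4; rewrite invfM; lra.
- rewrite size_cat natrD big_nat_recr//= mulrDr lerD//.
- have sumE : \sum_(a <- L ++ New) r (idx' a) ^+ d =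
      \sum_(a <- L) r (idx a) ^+ d + (size New)%:R * r k ^+ d.
    rewrite big_cat/=; congr (_ + _).
      by rewrite big_seq [RHS]big_seq; apply: eq_bigr => a /idxL ->.
    rewrite big_seq; under eq_bigr do rewrite idxN//.
    by rewrite -big_seq big_const_seq count_predT iter_addr_0 mulr_natl.
  have rkd : 0 < r k ^+ d by rewrite exprn_gt0.
  case: hor => hor.
    left; rewrite sumE (le_trans hor)// lerDl mulr_ge0// ltW//.
  right; rewrite sumE big_nat_recr//= mulrDr lerD//.
  have -> : k' / 2 * rho ^+ d * (b%:R ^+ k * r k) ^+ d = k' / 2 * (rho * b%:R ^+ k) ^+ d * r k ^+ d.
    by rewrite !exprMn; ring.
  by rewrite ler_pM2r.
Qed.
End RegularUbiquity.

Lemma pos_root (R : realType) (d : nat) (y : R) : (0 < d)%N -> 0 < y ->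
  exists2 r : R, 0 < r & r ^+ d = y.
Proof.
move=> d0 y0; exists (y `^ (d%:R^-1)); first exact: powR_gt0.
by rewrite -powR_mulrn ?powR_ge0// -powRrM mulVf ?powRr1 ?ltW// pnatr_eq0 -lt0n.
Qed.

Section LimsupContent.
Variables (R : realType) (d : nat) (N : 'rV[R]_d -> R).
Hypotheses (hN : is_norm N) (hd : (1 <= d)%N).
Variables (U A : set 'rV[R]_d) (H : 'rV[R]_d -> R).
Hypothesis hreg : regular_system N U A H.

(** The last two clauses are the cross-multiplied form of: [hr r / r ^+ d] increases to infinity as
    [r] decreases to 0. *)
Definition gauge_on (hr : R -> R) (e : R) : Prop :=
  [/\ 0 < e,
      forall r, 0 < r -> r <= e -> 0 < hr r,
      forall r s, 0 < r -> r <= s -> s <= e -> hr r <= hr s,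
      forall r s, 0 < r -> r <= s -> s <= e -> hr s * r ^+ d <= hr r * s ^+ d
    & forall T : R, 0 < T -> exists2 e' : R, 0 < e' &
        forall r, 0 < r -> r <= e' -> T * r ^+ d <= hr r].

Definition admissible_rate (phi : R -> R) : Prop :=
  (forall t, 0 <= t -> 0 < phi t) /\ (forall s t, 0 <= s -> s <= t -> phi t <= phi s).

Lemma F_phi_intro (phi : R -> R) z :
  (forall K : nat, exists a, [/\ A a, K%:R < H a & N (z - a) < phi (H a)]) ->
  F_phi N A H phi z.
Proof.
move=> hz /finite_seqP[s hs].
have [a [Aa Ka za]] := hz (Num.truncn (\sum_(a <- s) `|H a|)).+1.
have sa : a \in s by move/seteqP: hs => [h _]; exact: (h a).
have : H a < H a; last by rewrite ltxx.
apply: lt_trans Ka; apply: le_lt_trans (truncnS_gt _).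
rewrite (le_trans (ler_norm _))// (big_rem a)//= lerDl sumr_ge0//.
Qed.

(** The packing radii are fixed by taking for [r k ^+ d] the smaller of the heaviness bound
    [hr (t' k) / T] and the packing limit, so divergence for [hr] becomes divergence for the
    packing. Halving [phi] gives room to pass from closed to open balls. [c] and [b] are uniform in
    [phi], [hr] and [e], which later permits a constant [phi]. *)
Lemma F_phi_content : exists (c : R) (b : nat), [/\ 0 < c, c <= 1, (2 <= b)%N
  & forall (phi hr : R -> R) (e : R), admissible_rate phi -> gauge_on hr e ->
    diverges (fun k => (b%:R ^+ k) ^+ d * hr (Num.min (phi (b%:R ^+ k) / 2) e)) ->
    forall (x : 'rV[R]_d) (rho : R), 0 < rho -> rho <= e -> ballN N x rho `<=` U ->
    forall (Q : nat -> set 'rV[R]_d) (q : nat -> R),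
      (forall n, 0 < q n /\ q n <= e) ->
      (forall n y z, Q n y -> Q n z -> N (y - z) <= q n) ->
      F_phi N A H phi `&` ballN N x rho `<=` \bigcup_n Q n ->
      exists M : nat, c * hr rho < \sum_(0 <= n < M) hr (q n)].
Proof.
have [C hC] := coord_equiv_ex hN hd.
have [c [b [c0 c1 b2 hgreedy]]] := greedy_packing hN hd hC hreg.
exists (avoid_const d C c), b; split=> //.
- exact: (avoid_const_gt0 hC).
- exact/ltW/(avoid_const_lt1 hC).
move=> phi hr e [phi0 phiD] [e0 hr0 hrD hrS hrT] hdiv x rho rho0 rhoe BU Q q q0 hQ cover.
have b0 : 0 < b%:R :> R by rewrite ltr0n; exact: leq_trans b2.
have b1 : 1 <= b%:R :> R by rewrite ler1n; exact: leq_trans b2.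
have bk0 k : 0 < b%:R ^+ k :> R by rewrite exprn_gt0.
pose good (K : nat) a t := [/\ A a, K%:R < H a & t <= phi (H a) / 2].
have hub : ubiquitous N U good hr c.
  move=> {x rho rho0 rhoe BU cover} x rho T K rho0 T0 BU.
  have [k1 hk1] := hgreedy x rho K%:R rho0 BU.
  (* [2 ^+ d] compensates for the half in [t a <= r a / 2]. *)
  have T'0 : 0 < 2 ^+ d * T by rewrite mulr_gt0// exprn_gt0.
  have [e' e'0 he'] := hrT _ T'0.
  pose t' k := Num.min (phi (b%:R ^+ k) / 2) e.
  have t'0 k : 0 < t' k by rewrite lt_min e0 andbT divr_gt0// phi0// ltW.
  have t'e k : t' k <= e by rewrite ge_min lexx orbT.
  pose v k := hr (t' k).
  have v0 k : 0 < v k by exact: hr0.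
  have h4 k : 0 < (4 * b%:R ^+ k)^-1 :> R by rewrite invr_gt0 mulr_gt0.
  have /choice[r hr'] : forall k, exists r, 0 < r /\
      r ^+ d = Num.min (v k / T) ((4 * b%:R ^+ k)^-1 ^+ d).
    move=> k; have [|r r0 rE] := @pos_root R d (Num.min (v k / T) ((4 * b%:R ^+ k)^-1 ^+ d)) hd.
      by rewrite lt_min divr_gt0//= exprn_gt0.
    by exists r.
  have r0 k : 0 < r k by have [] := hr' k.
  have r4 k : r k <= (4 * b%:R ^+ k)^-1.
    by rewrite -(ler_pXn2r hd) ?nnegrE ?(ltW (r0 k)) ?(ltW (h4 k))// (hr' k).2 ge_min lexx orbT.
  have rv k : T * r k ^+ d <= v k.
    by rewrite mulrC -ler_pdivlMr// (hr' k).2 ge_min lexx.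
  have rdiv : diverges (fun k => (b%:R ^+ k * r k) ^+ d).
    have q4 : 0 < 4^-1 ^+ d :> R by rewrite exprn_gt0.
    have -> : (fun k => (b%:R ^+ k * r k) ^+ d) =
        (fun k => Num.min ((b%:R ^+ k) ^+ d * v k / T) (4^-1 ^+ d)).
      apply/funext => k; rewrite exprMn (hr' k).2 minr_pMr; last by rewrite exprn_ge0// ltW.
      by rewrite mulrA; congr Num.min; rewrite -exprMn; congr (_ ^+ _); field; rewrite gt_eqF.
    apply: (@diverges_min _ _ _ 0) => //.
      by move=> k _; rewrite !mulr_ge0 ?exprn_ge0 ?invr_ge0 ?ltW.
    move=> k0 B; have [k k0k hk] := hdiv k0 (B * T).
    by exists k => //; rewrite -mulr_suml ltr_pdivlMr.
  have m0 : 0 < Num.min (rho / 2) e' by rewrite lt_min e'0 andbT divr_gt0.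
  pose k2 := (Num.truncn (Num.min (rho / 2) e')^-1).+1.
  have hk2 k : (k2 <= k)%N -> (4 * b%:R ^+ k)^-1 <= Num.min (rho / 2) e'.
    move=> kk; have k_gt0 : (0 < k)%N by exact: leq_ltn_trans kk.
    rewrite -[leRHS]invrK lef_pV2 ?posrE ?invr_gt0// ?mulr_gt0//.
    apply: le_trans (ltW (truncnS_gt _)) _.
    apply: (@le_trans _ _ (b%:R ^+ k)); last by have := bk0 k; lra.
    rewrite -natrX ler_nat; apply: leq_trans kk (leq_trans (ltnW (ltn_expl k (ltnSn 1))) _).
    by rewrite leq_exp2r.
  have [L [idx [uL hL sep hsum]]] := hk1 (maxn k1 k2) r (leq_maxl _ _) (fun k _ => conj (r0 k) (r4 k)) rdiv.
  (* When [r / 2] is the smaller radius, heaviness comes from the growth of [hr] below [e'] rather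
     than from the choice of [r]. *)
  exists L, (r \o idx), (fun a => Num.min (t' (idx a)) (r (idx a) / 2)); split=> //= a aL.
    have [Aa Ka Ha ax kx] := hL a aL.
    have rk : r (idx a) <= Num.min (rho / 2) e'.
      by apply: le_trans (r4 _) (hk2 _ _); exact: leq_trans (leq_maxr _ _) kx.
    rewrite le_min in rk; have /andP[rk1 rk2] := rk.
    split=> //; last lra.
    - by rewrite lt_min t'0 divr_gt0.
    - by rewrite ge_min lexx orbT.
  have [Aa Ka Ha ax kx] := hL a aL.
  have rk : r (idx a) <= Num.min (rho / 2) e'.
    by apply: le_trans (r4 _) (hk2 _ _); exact: leq_trans (leq_maxr _ _) kx.
  rewrite le_min in rk; have /andP[rk1 rk2] := rk.
  have Ha0 : 0 <= H a by apply: le_trans (ltW Ka).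
  split.
    split=> //; apply: (@le_trans _ _ (t' (idx a))); first by rewrite ge_min lexx.
    apply: (@le_trans _ _ (phi (b%:R ^+ idx a) / 2)); first by rewrite ge_min lexx.
    by rewrite ler_pM2r// phiD.
  rewrite /Num.min/=; case: ifP => _; first exact: rv.
  have ra := r0 (idx a).
  have := he' (r (idx a) / 2); rewrite divr_gt0// => /(_ isT).
  have -> : 2 ^+ d * T * (r (idx a) / 2) ^+ d = T * r (idx a) ^+ d.
    by rewrite mulrAC -exprMn mulrC; congr (_ * _ ^+ _); field.
  by apply; lra.
apply: contrapT => nM.
have hsum M : \sum_(0 <= n < M) hr (q n) <= avoid_const d C c * hr rho.
  by rewrite leNgt; apply/negP => hM; apply: nM; exists M.
have [z [zB zQ hz]] := ubiquity_avoid hN hC c0 c1 hr0 hrD hrS hub q0 hQ rho0 rhoe BU hsum.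
have [n _ Qz] : (\bigcup_n Q n) z.
  apply: cover; split=> //; apply: F_phi_intro => K.
  have [a [t [[Aa Ka ta] za]]] := hz K; exists a; split=> //.
  have : 0 < phi (H a) by apply: phi0; apply: le_trans (ltW Ka).
  lra.
exact: zQ Qz.
Qed.

End LimsupContent.

(** * Covers and Lebesgue measure *)

Lemma nneseries_le (R : realType) (u : nat -> \bar R) (v : \bar R) :
  (forall n, 0 <= u n)%E -> (forall M, \sum_(0 <= n < M) u n <= v)%E ->
  (\sum_(n <oo) u n <= v)%E.
Proof.
move=> u0 hM; apply: lime_le; first exact: is_cvg_nneseries.
by apply: nearW => M; exact: hM.
Qed.

Lemma nneseries_finite (R : realType) (u : nat -> \bar R) (M : nat) :
  (forall n, 0 <= u n)%E -> (forall n, (M <= n)%N -> u n = 0%E) ->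
  (\sum_(n <oo) u n = \sum_(0 <= n < M) u n)%E.
Proof.
move=> u0 uM; rewrite (nneseries_split 0 M) ?add0n//.
by rewrite eseries0 ?adde0// => k kM _; exact: uM.
Qed.

Section Cover.
Variables (R : realType) (T X : Type) (adm : set X) (piece : X -> set T) (cost : X -> \bar R).

(** One notion of countable cover with costs serves boxes, small dyadic cubes and the covers of
    [Mh], so that countable subadditivity is proved once. *)
Definition covered (E : set T) (v : \bar R) : Prop :=
  exists C : nat -> X, [/\ forall n, adm (C n), E `<=` \bigcup_n piece (C n)
    & (\sum_(n <oo) cost (C n) <= v)%E].

Hypothesis cost_ge0 : forall x, adm x -> (0 <= cost x)%E.

Lemma covered_sub E E' v v' : E `<=` E' -> (v' <= v)%E -> covered E' v' -> covered E v.
Proof.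
move=> EE' vv' [C [aC cC sC]]; exists C; split=> //; first exact: subset_trans cC.
exact: le_trans vv'.
Qed.

Lemma covered_bigcup (E : nat -> set T) (v : nat -> \bar R) :
  (forall n, covered (E n) (v n)) -> covered (\bigcup_n E n) (\sum_(n <oo) v n)%E.
Proof.
move=> /choice[C hC].
have /card_set_bijP[f [_ finj fsurj]] := card_nat2.
have /card_set_bijP[g gbij] : ([set: nat] #= [set: nat * nat])%card.
  by rewrite card_eq_sym card_nat2.
exists (fun i => C (g i).1 (g i).2); split.
- by move=> i; have [h _ _] := hC (g i).1.
- move=> x [n _ En]; have [_ h _] := hC n; have [m _ xm] := h _ En.
  have [_ _ gsurj] := gbij; have [i _ gi] := gsurj (n, m) I.
  by exists i => //; rewrite gi.
have c0 n m : (0 <= cost (C n m))%E by have [h _ _] := hC n; exact: cost_ge0.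
rewrite nneseries_esumT//.
rewrite -(@reindex_esum R nat (nat * nat)%type setT setT g (fun p => cost (C p.1 p.2)))//.
have <- : setT `*`` (fun=> setT) = [set: nat * nat] by rewrite predeqE.
rewrite -(@esum_esum R nat nat setT (fun=> setT) (fun n m => cost (C n m)))//.
rewrite -nneseries_esumT; last by move=> n; exact: esum_ge0.
apply: lee_nneseries => [n _ _|n _]; first exact: esum_ge0.
by rewrite -nneseries_esumT//; have [_ _] := hC n.
Qed.

Hypothesis cost_null : exists2 x0, adm x0 & cost x0 = 0%E.

Lemma covered_set0 : covered set0 0%E.
Proof.
have [x0 ax0 cx0] := cost_null; exists (fun=> x0); split=> //.
by rewrite eseries0.
Qed.

Lemma covered1 x : adm x -> covered (piece x) (cost x).
Proof.
move=> ax; have [x0 ax0 cx0] := cost_null.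
exists (fun n => if n is 0%N then x else x0); split=> [[|n]//|y xy|].
  by exists 0%N.
rewrite (@nneseries_finite R _ 1) ?big_nat1//.
- by case=> [|n]; exact: cost_ge0.
- by case.
Qed.

Lemma covered_setU E E' v v' : covered E v -> covered E' v' -> covered (E `|` E') (v + v')%E.
Proof.
have pos F w : covered F w -> (0 <= w)%E.
  move=> [D [aD _ sD]]; apply: le_trans sD; apply: nneseries_ge0 => n _ _; exact: cost_ge0.
move=> hE hE'.
have := @covered_bigcup (fun n => if n is 0%N then E else if n is 1%N then E' else set0)
  (fun n => if n is 0%N then v else if n is 1%N then v' else 0%E).
move=> /(_ _)/covered_sub; apply.
- by move=> x [Ex|E'x]; [exists 0%N|exists 1%N].
- rewrite (@nneseries_finite R _ 2)//.
  + by rewrite big_nat_recl// big_nat1.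
  + by move=> [|[|n]]//; [exact: pos hE|exact: pos hE'].
  + by move=> [|[|n]].
- move=> [|[|n]]//; exact: covered_set0.
Qed.

Lemma covered_seq (I : eqType) (s : seq I) (E : I -> set T) (v : I -> \bar R) :
  (forall i, i \in s -> covered (E i) (v i)) ->
  covered [set x | exists2 i, i \in s & E i x] (\sum_(i <- s) v i)%E.
Proof.
elim: s => [|i s IH] hs.
  rewrite big_nil; apply: covered_sub covered_set0 => //.
  by move=> x [].
rewrite big_cons.
have hi := hs i (mem_head _ _).
have hs' : forall j, j \in s -> covered (E j) (v j) by move=> j js; apply: hs; rewrite inE js orbT.
apply: covered_sub (covered_setU hi (IH hs')) => // x [j].
by rewrite inE => /orP[/eqP -> ?|js Ej]; [left|right; exists j].
Qed.

Lemma covered_null_bigcup (E : nat -> set T) :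
  (forall n (e : R), 0 < e -> covered (E n) e%:E) ->
  forall e : R, 0 < e -> covered (\bigcup_n E n) e%:E.
Proof.
move=> hE e e0; have e2 n : 0 < e / (2 ^ n.+1)%N%:R by rewrite divr_gt0// ltr0n expn_gt0.
apply: covered_sub (covered_bigcup (fun n => hE n _ (e2 n))) => //.
by apply: (epsilon_trick0 xpredT); exact: ltW.
Qed.

End Cover.

Section LebesgueNull.
Variables (R : realType) (d : nat).
Hypothesis hd : (1 <= d)%N.

Definition box_adm : set ('rV[R]_d * 'rV[R]_d) := 
  [set p : 'rV[R]_d * 'rV[R]_d | forall i, p.1 0 i <= p.2 0 i].
Definition box_piece (p : 'rV[R]_d * 'rV[R]_d) : set 'rV[R]_d := box p.1 p.2.
Definition box_cost (p : 'rV[R]_d * 'rV[R]_d) : \bar R := (box_vol p.1 p.2)%:E.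

Notation box_covered := (covered box_adm box_piece box_cost).

Lemma box_cost_ge0 p : box_adm p -> (0 <= box_cost p)%E.
Proof. by move=> hp; rewrite lee_fin prodr_ge0// => i _; rewrite subr_ge0 hp. Qed.

Lemma box_cost_null : exists2 p, box_adm p & box_cost p = 0%E.
Proof.
exists (0, 0) => [i//|]; rewrite /box_cost /box_vol (bigD1 (Ordinal hd))//=.
by rewrite subrr mul0r.
Qed.

Lemma leb_null_covered (E : set 'rV[R]_d) :
  (forall e : R, 0 < e -> box_covered E e%:E) -> leb_null E.
Proof.
move=> hE e e0; have e2 : 0 < e / 2 by rewrite divr_gt0.
have [C [aC cC sC]] := hE _ e2.
exists (fun n => (C n).1), (fun n => (C n).2); split; first by move=> n; exact: aC.
split=> //; apply: le_lt_trans sC _; rewrite lte_fin; lra.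
Qed.

Lemma cube_covered (y : 'rV[R]_d) (L : R) : 0 < L -> box_covered (cube y L) (L ^+ d)%:E.
Proof.
move=> L0; pose p : 'rV[R]_d * 'rV[R]_d := (y, \row_i (y 0 i + L)).
have ap : box_adm p by move=> i; rewrite mxE; lra.
have -> : (L ^+ d)%:E = box_cost p.
  rewrite /box_cost /box_vol; congr (_%:E).
  under eq_bigr do rewrite mxE addrAC subrr add0r.
  by rewrite prodr_const card_ord.
apply: covered_sub (covered1 box_piece box_cost_ge0 box_cost_null ap) => //.
by move=> x xy i; have /andP[h1 h2] := xy i; rewrite h1 mxE ltW.
Qed.

Lemma dcubeE (j : nat) (k : 'rV[int]_d) :
  dcube (Posz j) k = cube (\row_i ((2 ^+ j)^-1 * (k 0 i)%:~R)) (2 ^+ j)^-1 :> set 'rV[R]_d.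
Proof.
have j0 : 0 < 2 ^+ j :> R by rewrite exprn_gt0.
have q0 : 0 < (2 ^+ j)^-1 :> R by rewrite invr_gt0.
have xE (x : 'rV[R]_d) i : x 0 i = (2 ^+ j)^-1 * (2 ^+ j * x 0 i) by rewrite mulKf// gt_eqF.
have iff (x : 'rV[R]_d) i :
    ((2 ^+ j)^-1 * (k 0 i)%:~R <= x 0 i < (2 ^+ j)^-1 * (k 0 i)%:~R + (2 ^+ j)^-1) =
    ((k 0 i)%:~R <= 2 ^+ j * x 0 i < (k 0 i)%:~R + 1).
  by rewrite {1 2}(xE x i) -[X in _ < _ + X]mulr1 -mulrDr ler_pM2l// ltr_pM2l.
by apply/seteqP; split=> x xk i; have := xk i; rewrite mxE -exprnP iff.
Qed.

Lemma open_dcube_cover (N : 'rV[R]_d -> R) (U : set 'rV[R]_d) : is_norm N -> norm_open N U ->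
  forall (x : 'rV[R]_d) (J : nat), U x ->
  exists2 j : nat, (J <= j)%N & dcube (Posz j) (dcube_index (Posz j) x) `<=` U.
Proof.
move=> hN Uo x J Ux; have [C hC] := coord_equiv_ex hN hd.
have [C1 _ _] := hC; have C0 : 0 < C by exact: lt_le_trans C1.
have [r r0 BU] := Uo _ Ux.
have half (j : nat) : C * (2 ^+ j.+1)^-1 <= C * (2 ^+ j)^-1 / 2 :> R.
  by rewrite exprS invfM mulrCA [leRHS]mulrC.
have [j Jj hj] := halving_small r0 half J.
exists j => // y yj; apply: BU; rewrite /ballN/=.
by apply: le_lt_trans hj; exact: dcube_dist hC _ _ _ _ yj (dcube_mem _ _).
Qed.

End LebesgueNull.

Arguments box_adm {R d}.
Arguments box_piece {R d}.
Arguments box_cost {R d}.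

(** * Full Lebesgue measure in the divergence case *)

Section FullMeasure.
Variables (R : realType) (d : nat) (N : 'rV[R]_d -> R).
Hypotheses (hN : is_norm N) (hd : (1 <= d)%N).
Variables (U A : set 'rV[R]_d) (H : 'rV[R]_d -> R).
Hypothesis hreg : regular_system N U A H.
Hypothesis hUo : norm_open N U.
Variable phi : R -> R.
Hypothesis hphi : admissible_rate phi.
Hypothesis hH : forall a, A a -> 0 < H a.

Definition tail_union (K : nat) : set 'rV[R]_d :=
  [set x | exists a, [/\ A a, K%:R < H a & N (x - a) < phi (H a)]].

Hypothesis hdiv : forall b : nat, (2 <= b)%N -> diverges (fun k => (b%:R ^+ k * phi (b%:R ^+ k)) ^+ d).

(** [theta] depends neither on the cube nor on [K], so the estimate can be iterated on the remaining
    subcubes. It is the packing proportion [c] divided by [(8 * C ^+ 2) ^+ d], which collects the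
    inscribed ball of radius [L / (2 * C)] and the losses in [subcube_in_ball]. *)
Lemma subcubes_in_tail_union : exists theta : R, [/\ 0 < theta, theta <= 1
  & forall (y : 'rV[R]_d) (L : R) (K : nat), 0 < L -> cube y L `<=` U ->
    exists n : nat, (0 < n)%N /\ exists S : pred {ffun 'I_d -> 'I_n},
      theta * n%:R ^+ d <= #|S|%:R /\
      forall k, S k -> cube (subcube_corner y L k) (L / n%:R) `<=` tail_union K].
Proof.
have [C hC] := coord_equiv_ex hN hd.
have [C1 hC1 hC2] := hC; have C0 : 0 < C by exact: lt_le_trans C1.
have [phi0 phiD] := hphi.
have [c [b [c0 c1 b2 hgreedy]]] := greedy_packing hN hd hC hreg.
have b0 : 0 < b%:R :> R by rewrite ltr0n; exact: leq_trans b2.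
have bk0 k : 0 < b%:R ^+ k :> R by rewrite exprn_gt0.
exists (c / (8 * C ^+ 2) ^+ d).
have C8 : 0 < (8 * C ^+ 2) ^+ d by rewrite exprn_gt0// mulr_gt0// exprn_gt0.
split.
- by rewrite divr_gt0.
- rewrite ler_pdivrMr// mul1r (le_trans c1)// exprn_ege1//.
  have : 1 <= C ^+ 2 by rewrite exprn_ege1.
  lra.
move=> y L K L0 QU.
pose z : 'rV[R]_d := \row_i (y 0 i + L / 2).
pose rho := L / (2 * C).
have rho0 : 0 < rho by rewrite divr_gt0// mulr_gt0.
have rhoC : C * rho = L / 2 by rewrite /rho; field; rewrite gt_eqF.
have BQ : ballN N z rho `<=` cube y L.
  move=> u; rewrite /ballN/= => uz i.
  have h1 : C * N (u - z) < L / 2 by rewrite -rhoC ltr_pM2l.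
  have := hC2 (u - z) i; rewrite !mxE ler_norml => /andP[h2 h3].
  by apply/andP; split; lra.
have [k1 hk1] := hgreedy z rho K%:R rho0 (subset_trans BQ QU).
pose h4 k : R := (4 * b%:R ^+ k)^-1.
have h40 k : 0 < h4 k by rewrite invr_gt0 mulr_gt0.
have h4E k : b%:R ^+ k * h4 k = 4^-1 by rewrite /h4; field; rewrite gt_eqF.
(* The cap is the radius allowed by [greedy_packing]; [diverges_min] keeps the divergence. *)
pose r k := Num.min (phi (b%:R ^+ k)) (h4 k).
have r0 k : 0 < r k by rewrite lt_min h40 andbT phi0// ltW.
have r4 k : r k <= h4 k by rewrite ge_min lexx orbT.
have rdiv : diverges (fun k => (b%:R ^+ k * r k) ^+ d).
  have q4 : 0 < 4^-1 ^+ d :> R by rewrite exprn_gt0.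
  have hd' := hdiv b2.
  have -> : (fun k => (b%:R ^+ k * r k) ^+ d) =
      (fun k => Num.min ((b%:R ^+ k * phi (b%:R ^+ k)) ^+ d) (4^-1 ^+ d)).
    apply/funext => k; rewrite /r minr_pMr ?(ltW (bk0 k))// h4E.
    set u := b%:R ^+ k * phi _; have u0 : 0 < u by rewrite mulr_gt0// phi0// ltW.
    have [uv|/ltW vu] := leP u 4^-1.
    - by apply/esym/min_idPl; rewrite lerXn2r ?nnegrE// ltW.
    - by apply/esym/min_idPr; rewrite lerXn2r ?nnegrE// ltW.
  apply: (@diverges_min _ _ _ 0) => // k _.
  by rewrite exprn_ge0// mulr_ge0// ltW// phi0// ltW.
have half4 k : h4 k.+1 <= h4 k / 2.
  rewrite /h4 exprS mulrCA invfM mulrC ler_wpM2l ?(ltW (h40 k))//.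
  by rewrite lef_pV2 ?posrE// ler_nat.
have rho2 : 0 < rho / 2 by rewrite divr_gt0.
have [k2 _ hk2] := halving_small rho2 half4 0%N.
have hk2' k : (k2 <= k)%N -> h4 k <= rho / 2.
  move=> kk; apply: le_trans (ltW hk2); rewrite lef_pV2 ?posrE ?mulr_gt0//.
  by rewrite ler_pM2l// ler_weXn2l// ler1n; exact: leq_trans b2.
have [s [idx [us hs sep hsum]]] := hk1 (maxn k1 k2) r (leq_maxl _ _)
  (fun k _ => conj (r0 k) (r4 k)) rdiv.
have hs' a : a \in s -> N (a - z) + r (idx a) <= rho /\ r (idx a) <= phi (H a).
  move=> /hs[Aa Ka Ha az kx].
  have h1 : r (idx a) <= rho / 2.
    by apply: le_trans (r4 _) (hk2' _ _); exact: leq_trans (leq_maxr _ _) kx.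
  split; first lra.
  apply: (@le_trans _ _ (phi (b%:R ^+ idx a))); first by rewrite ge_min lexx.
  by apply: phiD => //; exact/ltW/hH.
pose t a := r (idx a) / (2 * C).
have t0 a : 0 < t a by rewrite divr_gt0// mulr_gt0.
have tC a : C * t a = r (idx a) / 2 by rewrite /t; field; rewrite gt_eqF.
have [n n0 hn] : exists2 n : nat, (0 < n)%N & forall a, a \in s -> 2 * L <= t a * n%:R.
  exists (Num.truncn (\sum_(a <- s) 2 * L / t a)).+1 => // a sa.
  rewrite [leRHS]mulrC -ler_pdivrMr ?t0// (le_trans _ (ltW (truncnS_gt _)))//.
  rewrite (bigD1_seq a)//= lerDl big_seq_cond sumr_ge0// => a' _.
  by apply: divr_ge0; [rewrite mulr_ge0 ?(ltW L0)|exact: ltW (t0 _)].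
have /choice[S hS] : forall a, exists S : {set {ffun 'I_d -> 'I_n}}, a \in s ->
    (t a * n%:R / (2 * L)) ^+ d <= #|S|%:R /\
    forall k u, k \in S -> cube (subcube_corner y L k) (L / n%:R) u -> N (u - a) <= r (idx a) / 2.
  move=> a; have [sa|] := boolP (a \in s); last by exists finset.set0.
  have [i|S [S1 S2]] := @subcube_in_ball R d y a L (t a) n L0 (t0 _) (hn _ sa).
    have := hC2 (a - z) i; rewrite !mxE ler_norml => /andP[h1 h2].
    have [raD _] := hs' _ sa.
    have h3 : C * N (a - z) + C * r (idx a) <= L / 2 by rewrite -rhoC -mulrDr ler_pM2l.
    have h4' : t a <= C * r (idx a).
      rewrite /t ler_pdivrMr ?mulr_gt0//.
      have CC : 1 <= C * (2 * C) by have := C1; nra.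
      have -> : C * r (idx a) * (2 * C) = r (idx a) * (C * (2 * C)) by ring.
      by rewrite -[leLHS]mulr1 ler_wpM2l// ltW.
    by split; lra.
  exists S => _; split => // k u kS ku; rewrite -tC; apply: hC1 => i.
  by rewrite !mxE; exact: S2 ku i.
exists n; split=> //; exists [pred k | has (fun a => k \in S a) s]; split; last first.
  move=> k /hasP[a sa ka] u uk; have ua := (hS a sa).2 k u ka uk.
  have [Aa Ka _ _ _] := hs _ sa; exists a; split=> //.
  by have [_ rphi] := hs' _ sa; have := r0 (idx a); lra.
have : (\sum_(a <- s) #|S a| <= #|[pred k | has (fun a => k \in S a) s]|)%N.
  apply: sum_card_disjoint => // a a' k sa sa' ka ka'; apply/eqP/negP => /negP aa'.
  pose u := subcube_corner y L k.
  have uu : cube u (L / n%:R) u by move=> i; rewrite lexx/= ltrDl divr_gt0// ltr0n.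
  have h1 := (hS a sa).2 _ _ ka uu; have h2 := (hS a' sa').2 _ _ ka' uu.
  have := sep _ _ sa sa' aa'; have := norm_distD hN u a a'.
  by rewrite (norm_distC hN a u); have := r0 (idx a); have := r0 (idx a'); lra.
rewrite -(ler_nat R) natr_sum; apply: le_trans.
apply: (@le_trans _ _ (\sum_(a <- s) r (idx a) ^+ d * (n%:R / (4 * C * L)) ^+ d)); last first.
  rewrite [leLHS]big_seq [leRHS]big_seq ler_sum// => a sa; apply: le_trans (hS _ sa).1.
  rewrite -exprMn le_eqVlt; apply/orP; left; apply/eqP; congr (_ ^+ _).
  by rewrite /t; field; rewrite !gt_eqF.
rewrite -mulr_suml.
have -> : c / (8 * C ^+ 2) ^+ d * n%:R ^+ d = c * rho ^+ d * (n%:R / (4 * C * L)) ^+ d.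
  rewrite -[in RHS]mulrA -exprMn -mulrA -exprVn -exprMn; congr (_ * _ ^+ _).
  by rewrite /rho; field; rewrite !gt_eqF.
by rewrite ler_wpM2r// exprn_ge0// divr_ge0// !mulr_ge0// ltW.
Qed.

(** The subcubes not filled by [tail_union K] are again cubes in [U], so [k] rounds leave at most
    the proportion [(1 - theta) ^+ k] of a cube. *)
Lemma full_measure : leb_null (U `\` F_phi N A H phi).
Proof.
apply: leb_null_covered => //.
have [theta [th0 th1 hcubes]] := subcubes_in_tail_union.
have base (K k : nat) : forall (y : 'rV[R]_d) (L : R), 0 < L -> cube y L `<=` U ->
    covered box_adm box_piece box_cost (cube y L `\` tail_union K)
      ((1 - theta) ^+ k * L ^+ d)%:E.
  elim: k => [|k IH] y L L0 QU.
    rewrite expr0 mul1r; apply: covered_sub (cube_covered hd y L0) => //.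
  have [n [n0 [S [hS Stail]]]] := hcubes y L K L0 QU.
  have nn0 : 0 < n%:R :> R by rewrite ltr0n.
  have Ln0 : 0 < L / n%:R by rewrite divr_gt0.
  have sub (k' : {ffun 'I_d -> 'I_n}) : cube (subcube_corner y L k') (L / n%:R) `<=` cube y L by exact: (subcube_sub L0).
  have hcov k' : k' \in enum [predC S] -> covered box_adm box_piece box_cost
      (cube (subcube_corner y L k') (L / n%:R) `\` tail_union K)
      ((1 - theta) ^+ k * (L / n%:R) ^+ d)%:E.
    by move=> _; apply: IH => //; exact: subset_trans (sub _) QU.
  apply: covered_sub (covered_seq (box_cost_ge0 (d := d)) (box_cost_null R hd) hcov).
    move=> x [xy xnt]; have [k' xk'] := subcube_cover n0 L0 xy.
    exists k'; last by split.
    rewrite mem_enum; apply/negP => Sk'; exact: xnt (Stail _ Sk' _ xk').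
  rewrite sumEFin lee_fin big_const_seq count_predT iter_addr_0 -cardE.
  have hcard : #|[predC S]|%:R <= (1 - theta) * n%:R ^+ d.
    have := cardC S; rewrite card_ffun !card_ord => /(congr1 (fun m => m%:R : R)).
    by rewrite natrD natrX; lra.
  rewrite -[leLHS]mulr_natr.
  have p0 : 0 <= (1 - theta) ^+ k * (L / n%:R) ^+ d.
    by rewrite mulr_ge0 ?exprn_ge0 ?(ltW Ln0)//; lra.
  apply: le_trans (ler_wpM2l p0 hcard) _.
  rewrite exprS expr_div_n le_eqVlt; apply/orP; left; apply/eqP; field.
  by rewrite expf_neq0// gt_eqF.
have small (y : 'rV[R]_d) (L : R) (K : nat) (e : R) : 0 < e -> 0 < L -> cube y L `<=` U ->
    covered box_adm box_piece box_cost (cube y L `\` tail_union K) e%:E.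
  move=> e0 L0 QU.
  have Ld : 0 < L ^+ d by rewrite exprn_gt0.
  have [k hk] : exists k, (1 - theta) ^+ k * L ^+ d <= e.
    have : (fun k => (1 - theta) ^+ k : R) @ \oo --> 0.
      by apply: cvg_expr; rewrite ger0_norm; lra.
    move=> /cvgrPdist_le/(_ (e / L ^+ d)) []; first by rewrite divr_gt0.
    move=> k _ /(_ k (leqnn k)); rewrite sub0r normrN ger0_norm ?exprn_ge0//; last lra.
    by rewrite ler_pdivlMr// => hk; exists k.
  by apply: covered_sub (base K k y L L0 QU).
have dsmall (x : nat * 'rV[int]_d) K (e : R) : 0 < e ->
    covered box_adm box_piece box_cost
     ((if `[< dcube (Posz x.1) x.2 `<=` U >] then dcube (Posz x.1) x.2 else set0) `\` tail_union K) e%:E.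
  move=> e0; case: asboolP => [|_].
    by rewrite dcubeE => QU; apply: small => //; rewrite invr_gt0 exprn_gt0.
  apply: covered_sub (covered_set0 box_piece (box_cost_null R hd)); last by rewrite lee_fin ltW.
  by rewrite set0D.
(* [U] is the union of countably many dyadic cubes, indexed through [pickle]; cubes not inside [U]
   are replaced by the empty set. *)
pose E (K m : nat) : set 'rV[R]_d := if unpickle m is Some x then
  (if `[< dcube (Posz x.1) x.2 `<=` U >] then dcube (Posz x.1) x.2 else set0) `\` tail_union K
  else set0.
move=> e e0.
apply: (@covered_sub _ _ _ box_adm box_piece _ _ (\bigcup_K \bigcup_m E K m) _ e%:E) => //.
  move=> x [Ux nF]; apply: contrapT => nx; apply: nF; apply: F_phi_intro => K.
  apply: contrapT => nK; apply: nx; exists K => //.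
  have [j _ jU] := open_dcube_cover hd hN hUo 0 Ux.
  exists (pickle (j, dcube_index (Posz j) x)) => //; rewrite /E pickleK; split=> //.
  by case: asboolP => // _; exact: dcube_mem.
apply: (covered_null_bigcup (box_cost_ge0 (d := d))) e0 => K {}e e0.
apply: (covered_null_bigcup (box_cost_ge0 (d := d))) e0 => m {}e e0.
rewrite /E; case: unpickle => [x|]; first exact: dsmall.
by apply: covered_sub (covered_set0 box_piece (box_cost_null R hd)); last by rewrite lee_fin ltW.
Qed.
End FullMeasure.

(** * Integral tests *)

Section Divergence.
Variable R : realType.
Implicit Types x y : nat -> R.

Lemma diverges_le x y (M : R) (k1 : nat) : 0 < M -> (forall k, 0 <= y k) ->
  (forall k, (k1 <= k)%N -> x k <= M * y k) -> diverges x -> diverges y.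
Proof.
move=> M0 y0 xy dx k0 B.
pose S := \sum_(k0 <= j < maxn k0 k1) x j.
have [k hk Bk] := dx (maxn k0 k1) (M * B).
have k0k := leq_trans (leq_maxl k0 k1) hk; exists k => //.
rewrite -(ltr_pM2l M0) (lt_le_trans Bk)// mulr_sumr.
rewrite [leRHS](big_cat_nat (n := maxn k0 k1)) ?leq_maxl//= -[leLHS]add0r lerD//.
  by rewrite sumr_ge0// => j _; rewrite mulr_ge0// ltW.
rewrite big_nat_cond [leRHS]big_nat_cond ler_sum// => j /andP[/andP[kj _] _].
by apply: xy; exact: leq_trans (leq_maxr _ _) kj.
Qed.

Lemma not_diverges_bound x : (forall k, 0 <= x k) -> ~ diverges x ->
  exists B, forall k, \sum_(0 <= j < k) x j <= B.
Proof.
move=> x0 nd; apply: contrapT => nB; apply: nd => k0 B.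
apply: contrapT => nk; apply: nB; exists (\sum_(0 <= j < k0) x j + B) => k.
have hB k' : (k0 <= k')%N -> \sum_(k0 <= j < k') x j <= B.
  by move=> k0k; rewrite leNgt; apply/negP => h; apply: nk; exists k'.
have [kk0|/ltnW k0k] := leqP k k0.
- rewrite [X in _ <= X + _](big_cat_nat (n := k))//= -addrA lerDl addr_ge0//.
    by rewrite sumr_ge0.
  by have := hB k0 (leqnn _); rewrite big_geq.
- by rewrite (big_cat_nat (n := k0))//= lerD2l hB.
Qed.

Lemma not_diverges_tail x (e : R) : (forall k, 0 <= x k) -> ~ diverges x -> 0 < e ->
  exists k0, forall k, \sum_(k0 <= j < k) x j <= e.
Proof.
move=> x0 nd e0; have [B hB] := not_diverges_bound x0 nd.
pose S := [set \sum_(0 <= j < k) x j | k in [set: nat]].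
have supS : has_sup S.
  by split; [exists (\sum_(0 <= j < 0) x j), 0%N|exists B => _ [k _ <-]].
have [_ [k0 _ <-] hk0] := sup_adherent e0 supS.
exists k0 => k; have [kk0|/ltnW k0k] := leqP k k0; first by rewrite big_geq// ltW.
have : \sum_(0 <= j < k) x j <= sup S by apply: ub_le_sup; [exact: supS.2|exists k].
by rewrite (big_cat_nat (n := k0))//=; lra.
Qed.
End Divergence.

Section IntegralTest.
Variables (R : realType) (d b : nat).
Hypotheses (hd : (1 <= d)%N) (b2 : (2 <= b)%N).
Variable psi : R -> R.
Hypothesis mpsi : measurable_fun (`[0%R, +oo[%classic : set R) psi.
Hypothesis psi0 : forall t, 0 <= t -> 0 <= psi t.
Variable eta0 : R.
Hypothesis psiD : forall s t, eta0 <= s -> s <= t -> psi t <= psi s.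

Let f (x : R) : \bar R := (x ^+ d.-1 * psi x)%:E.
Notation mu := (@lebesgue_measure R).

Let f0 x : (`[0%R, +oo[%classic : set R) x -> (0 <= f x)%E.
Proof. by rewrite /= in_itv/= andbT => x0; rewrite lee_fin mulr_ge0 ?exprn_ge0// psi0. Qed.

Let mf : measurable_fun (`[0%R, +oo[%classic : set R) f.
Proof.
apply/measurable_EFinP; by apply: measurable_funM.
Qed.

Let b0 : 0 < b%:R :> R. Proof. by rewrite ltr0n; exact: leq_trans b2. Qed.
Let b1 : 1 <= b%:R :> R. Proof. by rewrite ler1n; exact: leq_trans b2. Qed.
Let bk0 k : 0 < b%:R ^+ k :> R. Proof. by rewrite exprn_gt0. Qed.

Variable k1 : nat.
Hypothesis hk1 : eta0 <= b%:R ^+ k1.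

(** End points of the blocks; starting the powers at [k1] leaves the region where [psi] may fail to
    be monotone to the first block alone. *)
Let u (n : nat) : R := if n is m.+1 then b%:R ^+ (k1 + m) else 0.

Let u_homo n : u n <= u n.+1.
Proof.
case: n => [|n] /=; first exact/ltW/bk0.
by rewrite addnS exprS ler_peMl// ltW// bk0.
Qed.

Let u_ge0 n : 0 <= u n. Proof. by case: n => [|n]//; exact/ltW/bk0. Qed.

Let u_le m n : (m <= n)%N -> u m <= u n.
Proof.
move=> /subnKC <-; elim: (n - m)%N => [|k IH]; first by rewrite addn0.
by rewrite addnS; exact: le_trans IH (u_homo _).
Qed.

Lemma integral_pieces : (\int[mu]_(x in `[0%R, +oo[) f x =
  \sum_(n <oo) \int[mu]_(x in `[u n, u n.+1[) f x)%E.
Proof.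
have e : `[0%R, +oo[%classic = \bigcup_n [set` `[u n, u n.+1[].
  apply/seteqP; split=> x /=.
    rewrite in_itv/= andbT => x0.
    have ex : exists n, x < u n.
      exists (Num.truncn x).+2; apply: lt_le_trans (truncnS_gt x) _.
      rewrite /u -natrX ler_nat; apply: leq_trans (ltnW (ltn_expl _ (ltnSn 1))) _.
      apply: (@leq_trans (b ^ (Num.truncn x).+1)); first by rewrite leq_exp2r.
      by rewrite leq_exp2l// leq_addl.
    have [[|n] hn nmin] := ex_minnP ex; first by move: hn; rewrite /u ltNge x0.
    exists n => //=; rewrite in_itv/= hn andbT leNgt; apply/negP => xn.
    by have := nmin _ xn; rewrite ltnn.
  by move=> [n _] /=; rewrite !in_itv/= andbT => /andP[h _]; exact: le_trans h.
rewrite e; apply: ge0_integral_bigcup => //.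
- by rewrite -e.
- by rewrite -e.
- apply/trivIsetP => m n _ _ mn; apply/seteqP; split => x //= [].
  wlog mn' : m n mn / (m < n)%N => [hw|].
    move: (mn); rewrite neq_ltn => /orP[|nm]; first exact: hw.
    by move=> hm hn; apply: (hw n m) => //; rewrite eq_sym.
  rewrite !in_itv/= => /andP[_ h1] /andP[h2 _].
  by have := u_le mn'; rewrite leNgt (le_lt_trans h2 h1).
Qed.

Let mpiece n : measurable_fun (`[u n, u n.+1[%classic : set R) f.
Proof.
apply: measurable_funS mf => // x /=; rewrite !in_itv/= andbT => /andP[h _].
exact: le_trans h.
Qed.

Let piece0 n x : (`[u n, u n.+1[%classic : set R) x -> (0 <= f x)%E.
Proof.
rewrite /= in_itv/= => /andP[h _]; apply: f0; rewrite /= in_itv/= andbT.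
exact: le_trans h.
Qed.

Let int_cst n (c : R) : (\int[mu]_(x in `[u n, u n.+1[) c%:E = (c * (u n.+1 - u n))%:E)%E.
Proof.
rewrite integral_cst//= lebesgue_measure_itv/= lte_fin; case: ltP => [_|h].
  by rewrite -EFinB -EFinM.
rewrite -/(u n.+1); have -> : u n.+1 = u n by apply/eqP; rewrite eq_le h u_homo.
by rewrite mule0 subrr mulr0.
Qed.

Lemma piece_le n (c : R) : (forall x, u n <= x -> x <= u n.+1 -> x ^+ d.-1 * psi x <= c) ->
  (\int[mu]_(x in `[u n, u n.+1[) f x <= (c * (u n.+1 - u n))%:E)%E.
Proof.
move=> h; rewrite -int_cst; apply: ge0_le_integral => //; [exact: piece0|exact: mpiece|].
by move=> x /=; rewrite in_itv/= => /andP[h1 h2]; rewrite lee_fin h// ltW.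
Qed.

Lemma piece_ge n (c : R) : 0 <= c -> (forall x, u n <= x -> x <= u n.+1 -> c <= x ^+ d.-1 * psi x) ->
  ((c * (u n.+1 - u n))%:E <= \int[mu]_(x in `[u n, u n.+1[) f x)%E.
Proof.
move=> c0 h; rewrite -int_cst; apply: ge0_le_integral => //; first exact: mpiece.
by move=> x /=; rewrite in_itv/= => /andP[h1 h2]; rewrite lee_fin h// ltW.
Qed.

Let xk k := (b%:R ^+ k) ^+ d * psi (b%:R ^+ k).

Let xk0 k : 0 <= xk k. Proof. by rewrite mulr_ge0 ?exprn_ge0 ?psi0// ltW. Qed.

Let dE (x : R) : x ^+ d = x * x ^+ d.-1. Proof. by rewrite -exprS prednK. Qed.

Let hk n : eta0 <= u n.+1.
Proof. by apply: le_trans hk1 _; rewrite /u ler_weXn2l// leq_addr. Qed.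

Let uS n : u n.+2 = b%:R * u n.+1. Proof. by rewrite /u addnS exprS. Qed.

(** Later blocks are compared with [xk] at their left end, at the price of [b ^ d]; the bound [B]
    serves the first block. *)
Lemma integral_infty_diverges (B : R) : (forall t, 0 <= t -> psi t <= B) ->
  (\int[mu]_(x in `[0%R, +oo[) f x = +oo)%E -> diverges xk.
Proof.
move=> psiB Ioo; apply: contrapT => /(not_diverges_bound xk0)[B' hB'].
have B0 : 0 <= B by apply: le_trans (psi0 (lexx 0)) (psiB _ (lexx 0)).
have piece n : (\int[mu]_(x in `[u n.+1, u n.+2[) f x <= (b%:R ^+ d * xk (k1 + n))%:E)%E.
  apply: le_trans (@piece_le n.+1 ((u n.+2) ^+ d.-1 * psi (u n.+1)) _) _.
    move=> x x1 x2; have x0 : 0 <= x by exact: le_trans x1.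
    by rewrite ler_pM ?exprn_ge0 ?psi0 ?lerXn2r ?nnegrE// psiD.
  rewrite lee_fin /xk -[b%:R ^+ (k1 + n)]/(u n.+1).
  have -> : b%:R ^+ d * (u n.+1 ^+ d * psi (u n.+1)) = u n.+2 ^+ d.-1 * psi (u n.+1) * u n.+2.
    by rewrite uS exprMn !dE; ring.
  rewrite ler_wpM2l; [by []|by rewrite mulr_ge0 ?exprn_ge0// psi0|].
  by rewrite gerBl.
have piece_0 : (\int[mu]_(x in `[u 0%N, u 1%N[) f x <= (u 1%N ^+ d.-1 * B * u 1%N)%:E)%E.
  apply: le_trans (@piece_le 0%N ((u 1%N) ^+ d.-1 * B) _) _.
    move=> x x1 x2; have x0 : 0 <= x by exact: x1.
    by rewrite ler_pM ?exprn_ge0 ?psi0 ?lerXn2r ?nnegrE// psiB.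
  by rewrite lee_fin subr0.
pose W := u 1%N ^+ d.-1 * B * u 1%N + b%:R ^+ d * B'.
have W0 : 0 <= W.
  rewrite addr_ge0// ?mulr_ge0 ?exprn_ge0 ?(ltW b0)//.
  by have := hB' 0%N; rewrite big_geq.
suff : (+oo <= W%:E :> \bar R)%E by [].
rewrite -Ioo integral_pieces; apply: nneseries_le => [n|[|M]].
- by apply: integral_ge0 => x; exact: piece0.
- by rewrite big_geq// lee_fin.
rewrite big_nat_recl// EFinD leeD//.
apply: (@le_trans _ _ (\sum_(0 <= n < M) (b%:R ^+ d * xk (k1 + n))%:E)%E).
  by apply: lee_sum => n _; exact: piece.
rewrite sumEFin lee_fin -mulr_sumr ler_wpM2l ?exprn_ge0 ?(ltW b0)//.
apply: le_trans (hB' (k1 + M)%N).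
rewrite [leRHS](big_cat_nat (n := k1)) ?leq_addr//= -[leLHS]add0r lerD ?sumr_ge0//.
by rewrite -{2}[k1]add0n big_addn addKn; under [leRHS]eq_bigr do rewrite addnC.
Qed.

(** Later blocks are compared with [xk] at their right end; by [2 <= b] the length of such a block
    is at least its left end point. *)
Lemma integral_fin_not_diverges :
  (\int[mu]_(x in `[0%R, +oo[) f x < +oo)%E -> ~ diverges xk.
Proof.
move=> Ifin dx.
have I0 : (0 <= \int[mu]_(x in `[0%R, +oo[) f x)%E by exact: integral_ge0.
have piece n : ((b%:R ^- d * xk (k1 + n.+1))%:E <= \int[mu]_(x in `[u n.+1, u n.+2[) f x)%E.
  apply: le_trans (@piece_ge n.+1 ((u n.+1) ^+ d.-1 * psi (u n.+2)) _ _).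
  - rewrite lee_fin /xk -[b%:R ^+ (k1 + n.+1)]/(u n.+2).
    have -> : b%:R ^- d * (u n.+2 ^+ d * psi (u n.+2)) = u n.+1 ^+ d.-1 * psi (u n.+2) * u n.+1.
      by rewrite {1}uS exprMn -!mulrA mulKf ?expf_neq0 ?gt_eqF// (dE (u n.+1)); ring.
    rewrite ler_wpM2l ?mulr_ge0 ?exprn_ge0 ?psi0//.
    have b2' : 2 <= b%:R :> R by rewrite (ler_nat R 2).
    have := ler_wpM2r (u_ge0 n.+1) b2'; rewrite uS; lra.
  - by rewrite mulr_ge0 ?exprn_ge0 ?psi0.
  - move=> x x1 x2; have x0 : 0 <= x by exact: le_trans x1.
    have xh : eta0 <= x by exact: le_trans x1.
    by rewrite ler_pM ?exprn_ge0 ?psi0 ?lerXn2r ?nnegrE// psiD.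
set I := (\int[mu]_(x in `[0%R, +oo[) f x)%E in Ifin I0.
have IE : I = (fine I)%:E by rewrite fineK// ge0_fin_numE.
have [k k0k hsum] := dx k1.+1 (b%:R ^+ d * fine I).
suff : \sum_(k1.+1 <= j < k) xk j <= b%:R ^+ d * fine I by lra.
have bd0 : 0 < b%:R ^+ d :> R by rewrite exprn_gt0.
rewrite -ler_pdivrMl// mulr_sumr -lee_fin -IE -sumEFin /I integral_pieces.
pose g n := (\int[mu]_(x in `[u n, u n.+1[) f x)%E.
have g0 n : (0 <= g n)%E by apply: integral_ge0 => x; exact: piece0.
apply: le_trans (nneseries_lim_ge (k - k1.+1).+1 _); last by move=> n _ _; exact: g0.
rewrite big_nat_recl// -[leLHS]add0e leeD//; first exact: (g0 0%N).
rewrite -{1}[k1.+1]add0n big_addn; apply: lee_sum => n _.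
have -> : (n + k1.+1 = k1 + n.+1)%N by rewrite addnC addSnnS.
exact: piece.
Qed.
End IntegralTest.

(** * Gauge functions and net measures *)

Section Normalization.
Variables (R : realType) (d : nat).
Implicit Types (g h : R -> \bar R).

Lemma near0P (P : R -> Prop) :
  (\forall r \near 0^'+, P r) <-> exists2 e : R, 0 < e & forall r, 0 < r -> r <= e -> P r.
Proof.
split=> [[e /= e0 he]|[e e0 he]].
  exists (e / 2) => [|r r0 re]; first by rewrite divr_gt0.
  by apply: he => //=; rewrite sub0r normrN gtr0_norm//; lra.
exists e => //= r /=; rewrite sub0r normrN => re r0; apply: he => //.
by rewrite gtr0_norm// in re; exact: ltW.
Qed.

Lemma gd_gt0 g r : 0 < r -> gd d g r =
  ((r ^+ d)%:E * ereal_inf [set (g rho * (rho ^+ d)^-1%:E)%E | rho in `]0%R, r]])%E.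
Proof. by rewrite /gd => ->. Qed.

Lemma gd0 g : gd d g 0 = 0%E. Proof. by rewrite /gd ltxx. Qed.

Lemma gd_le g r : gauge_fun g -> 0 <= r -> (gd d g r <= g r)%E.
Proof.
move=> [g0 _ g00 _]; rewrite le_eqVlt => /orP[/eqP <-|r0]; first by rewrite gd0 g00.
have rd : 0 < r ^+ d by rewrite exprn_gt0.
rewrite gd_gt0// -[leRHS]mul1e -(divff (lt0r_neq0 rd)) EFinM -muleA.
rewrite lee_pmul2l ?lte_fin// muleC; apply: ereal_inf_lbound; exists r => //=.
by rewrite in_itv/= r0 lexx.
Qed.

Lemma gd_ge0 g r : gauge_fun g -> (0 <= gd d g r)%E.
Proof.
move=> [g0 _ _ _]; rewrite /gd; case: ifP => // r0.
apply: mule_ge0; first by rewrite lee_fin exprn_ge0// ltW.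
apply/ereal_infP => _ [rho /= + <-]; rewrite in_itv/= => /andP[rho0 _].
by rewrite mule_ge0 ?g0 ?lee_fin ?invr_ge0 ?exprn_ge0// ltW.
Qed.

Lemma gauge_small g (e : R) : gauge_fun g -> 0 < e ->
  exists2 e' : R, 0 < e' & forall r, 0 < r -> r <= e' -> (g r <= e%:E)%E.
Proof.
move=> [g0 _ _ gcvg] e0.
have h : \forall r \near 0^'+, (g r <= e%:E)%E.
  have := gcvg _ (@open_ereal_lt' R 0%E e%:E (etrans (lte_fin _ _) e0)).
  by apply: (@filterS _ (0 : R)^'+ _ (fun r => (g r < e%:E)%E)) => r /ltW.
by have /near0P[e' e'0 he'] := h; exists e'.
Qed.

(** [g] may be infinite away from 0, but the infimum in [gd] also sees points near 0, where [g] is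
    finite. Hence [gdr] loses nothing. *)
Lemma gd_fin g r : gauge_fun g -> gd d g r \is a fin_num.
Proof.
move=> hg; rewrite ge0_fin_numE ?gd_ge0//.
rewrite /gd; case: ifP => // r0.
have [e e0 he] := gauge_small hg ltr01.
set rho := Num.min r e.
have rho0 : 0 < rho by rewrite lt_min r0.
have rhod : 0 < rho ^+ d by rewrite exprn_gt0.
apply: (@le_lt_trans _ _ ((r ^+ d)%:E * (1%:E * (rho ^+ d)^-1%:E))%E); last by rewrite -!EFinM ltry.
rewrite lee_pmul2l ?lte_fin ?exprn_gt0//.
apply: (@le_trans _ _ (g rho * (rho ^+ d)^-1%:E)%E).
  by apply: ereal_inf_lbound; exists rho => //=; rewrite in_itv/= rho0 ge_min lexx.
by rewrite lee_pmul2r ?lte_fin ?invr_gt0// he// ge_min lexx orbT.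
Qed.

Definition gdr g (r : R) : R := fine (gd d g r).

Lemma gdrE g r : gauge_fun g -> gd d g r = (gdr g r)%:E.
Proof. by move=> hg; rewrite fineK// gd_fin. Qed.

Lemma gdr_ge0 g r : gauge_fun g -> 0 <= gdr g r.
Proof. by move=> hg; apply: fine_ge0; exact: gd_ge0. Qed.

Lemma ereal_inf_gdr g r : gauge_fun g -> 0 < r ->
  ereal_inf [set (g rho * (rho ^+ d)^-1%:E)%E | rho in `]0%R, r]] = (gdr g r / r ^+ d)%:E.
Proof.
move=> hg r0; have rd0 : 0 < r ^+ d by rewrite exprn_gt0.
rewrite mulrC EFinM -gdrE// gd_gt0// muleA -EFinM mulVf ?mul1e// gt_eqF//.
Qed.

Lemma gdr_lb g r rho : gauge_fun g -> 0 < rho -> rho <= r ->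
  ((gdr g r / r ^+ d)%:E <= g rho * (rho ^+ d)^-1%:E)%E.
Proof.
move=> hg rho0 rr; rewrite -ereal_inf_gdr//; last exact: lt_le_trans rr.
by apply: ereal_inf_lbound; exists rho => //=; rewrite in_itv/= rho0.
Qed.

Lemma gdr_scale g r s : gauge_fun g -> 0 < r -> r <= s -> gdr g s * r ^+ d <= gdr g r * s ^+ d.
Proof.
move=> hg r0 rs; have s0 : 0 < s by exact: lt_le_trans rs.
have : gdr g s / s ^+ d <= gdr g r / r ^+ d.
  rewrite -lee_fin -!ereal_inf_gdr//.
  apply: le_ereal_inf => _ [rho /= + <-]; rewrite in_itv/= => /andP[h1 h2].
  by exists rho => //=; rewrite in_itv/= h1 (le_trans h2).
by rewrite ler_pdivrMr ?exprn_gt0// mulrAC ler_pdivlMr ?exprn_gt0.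
Qed.

(** A competitor [rho <= r] in the infimum at [s] also competes at [r]; a competitor between [r] and
    [s] satisfies [g rho >= g r >= gd d g r] and [rho ^+ d <= s ^+ d]. *)
Lemma gdr_homo g : gauge_fun g -> exists2 e : R, 0 < e &
  forall r s, 0 < r -> r <= s -> s <= e -> gdr g r <= gdr g s.
Proof.
move=> hg; have [g0 [e e0 he] _ _] := hg; exists e => // r s r0 rs se.
have s0 : 0 < s by exact: lt_le_trans rs.
have sd0 : 0 < s ^+ d by rewrite exprn_gt0.
suff : gdr g r / s ^+ d <= gdr g s / s ^+ d by rewrite ler_pM2r// invr_gt0.
rewrite -lee_fin -ereal_inf_gdr//.
apply/ereal_infP => _ [rho /= + <-]; rewrite in_itv/= => /andP[rho0 rhos].
have [rhor|/ltW rrho] := leP rho r.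
- apply: le_trans (gdr_lb hg rho0 rhor); rewrite lee_fin ler_wpM2l ?gdr_ge0//.
  by rewrite lef_pV2 ?posrE ?exprn_gt0// lerXn2r ?nnegrE// ltW.
- have rhod : 0 < rho ^+ d by rewrite exprn_gt0.
  apply: (@le_trans _ _ ((gdr g r)%:E * (rho ^+ d)^-1%:E)%E).
    rewrite -EFinM lee_fin ler_wpM2l ?gdr_ge0//.
    by rewrite lef_pV2 ?posrE ?exprn_gt0// lerXn2r ?nnegrE// ltW.
  rewrite lee_pmul2r ?lte_fin ?invr_gt0// -gdrE//.
  apply: le_trans (gd_le hg (ltW r0)) _; apply: he => //; first exact: ltW.
  exact: le_trans se.
Qed.

Lemma gdr_large g (T : R) : Ginf d g -> 0 < T -> exists2 e : R, 0 < e &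
  forall r, 0 < r -> r <= e -> T * r ^+ d <= gdr g r.
Proof.
move=> [hg hinf] T0; have /near0P[e e0 he] := hinf T; exists e => // r r0 re.
rewrite -lee_fin -gdrE// gd_gt0// mulrC EFinM lee_pmul2l ?lte_fin ?exprn_gt0//.
apply/ereal_infP => _ [rho /= + <-]; rewrite in_itv/= => /andP[rho0 rhor].
by apply: he => //; exact: le_trans re.
Qed.

Lemma gdr_small g (e : R) : gauge_fun g -> 0 < e ->
  exists2 e' : R, 0 < e' & forall r, 0 < r -> r <= e' -> gdr g r <= e.
Proof.
move=> hg e0; have [e' e'0 he] := gauge_small hg e0; exists e' => // r r0 re.
rewrite -lee_fin -gdrE//; apply: le_trans (gd_le hg (ltW r0)) (he _ r0 re).
Qed.

Lemma gauge_on_gdr g : Ginf d g -> exists e, gauge_on d (gdr g) e.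
Proof.
move=> hg; have [hg' _] := hg.
have [e1 e10 h1] := gdr_homo hg'; have [e2 e20 h2] := gdr_large hg ltr01.
exists (Num.min e1 e2); split.
- by rewrite lt_min e10.
- move=> r r0; rewrite le_min => /andP[_ re2]; apply: lt_le_trans (h2 _ r0 re2).
  by rewrite mul1r exprn_gt0.
- by move=> r s r0 rs; rewrite le_min => /andP[se1 _]; exact: h1.
- by move=> r s r0 rs _; exact: gdr_scale.
- by move=> T T0; exact: gdr_large.
Qed.

(** With [rho] nearly minimizing, about [(r / rho) ^+ d] sets of diameter at most [rho] cost a
    multiple of [gdr d g r] instead of [g r]. *)
Lemma gdr_witness g (r : R) : gauge_fun g -> 0 < r -> 0 < gdr g r ->
  exists rho : R, [/\ 0 < rho, rho <= r & (g rho <= (2 * gdr g r * (rho / r) ^+ d)%:E)%E].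
Proof.
move=> hg r0 G0.
have rd0 : 0 < r ^+ d by rewrite exprn_gt0.
have [_ [rho /= + <-] hrho] : exists2 x,
    [set (g rho * (rho ^+ d)^-1%:E)%E | rho in `]0%R, r]] x & (x < (2 * gdr g r / r ^+ d)%:E)%E.
  apply: ereal_inf_lt; rewrite ereal_inf_gdr// lte_fin -mulrA ltr_pMl ?divr_gt0//.
  by rewrite ltr1n.
rewrite in_itv/= => /andP[rho0 rhor].
have rhod : 0 < rho ^+ d by rewrite exprn_gt0.
exists rho; split=> //.
rewrite -(@lee_pmul2r _ (rho ^+ d)^-1%:E) ?lte_fin ?invr_gt0// (le_trans (ltW hrho))//.
rewrite -EFinM lee_fin expr_div_n le_eqVlt; apply/orP; left; apply/eqP; field.
by rewrite !gt_eqF.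
Qed.
End Normalization.

(** * From content bounds to equality of net measures *)

Section NetMeasure.
Variables (R : realType) (d : nat) (N : 'rV[R]_d -> R).
Hypotheses (hN : is_norm N) (hd : (1 <= d)%N).
Variables (U F : set 'rV[R]_d).

Definition content_lower (hr : R -> R) (e c : R) : Prop :=
  forall (x : 'rV[R]_d) (rho : R), 0 < rho -> rho <= e -> ballN N x rho `<=` U ->
  forall (Q : nat -> set 'rV[R]_d) (q : nat -> R),
    (forall n, 0 < q n /\ q n <= e) ->
    (forall n y z, Q n y -> Q n z -> N (y - z) <= q n) ->
    F `&` ballN N x rho `<=` \bigcup_n Q n ->
    exists M : nat, c * hr rho < \sum_(0 <= n < M) hr (q n).

(** A piece of diameter 0 has weight 0 but needs a positive size [q]; it gets a small one, at the
    price of errors [eta] of total [eps]. *)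
Lemma content_weights (hr : R -> R) (e c : R) : content_lower hr e c ->
  forall (x : 'rV[R]_d) (rho : R), 0 < rho -> rho <= e -> ballN N x rho `<=` U ->
  forall (Q : nat -> set 'rV[R]_d) (w : nat -> \bar R),
    (forall n, 0 <= w n)%E ->
    (forall n (eta : R), 0 < eta -> exists q, [/\ 0 < q, q <= e,
        forall y z, Q n y -> Q n z -> N (y - z) <= q & ((hr q)%:E <= w n + eta%:E)%E]) ->
    F `&` ballN N x rho `<=` \bigcup_n Q n ->
    ((c * hr rho)%:E <= \sum_(n <oo) w n)%E.
Proof.
move=> hlow x rho rho0 rhoe BU Q w w0 hw cover.
apply/lee_addgt0Pr => eps eps0.
have eta0 n : 0 < eps / (2 ^ n.+1)%N%:R by rewrite divr_gt0// ltr0n expn_gt0.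
have /choice[q hq] := fun n => hw n _ (eta0 n).
have [n|n|//|M hM] := hlow x rho rho0 rhoe BU Q q.
- by have [? ? _ _] := hq n.
- by have [_ _ h _] := hq n; exact: h.
apply: le_trans (epsilon_trick xpredT w0 (ltW eps0)).
apply: (@le_trans _ _ (\sum_(0 <= n < M) (hr (q n))%:E)%E); first by rewrite sumEFin lee_fin ltW.
apply: le_trans (nneseries_lim_ge M _).
  by apply: lee_sum => n _; have [_ _ _] := hq n.
by move=> n _ _; rewrite adde_ge0// lee_fin ltW.
Qed.

Variable h : R -> \bar R.
Hypothesis hg : gauge_fun h.
Let hr r := fine (h r).
Variables (e : R).
Hypothesis he : forall r, 0 <= r -> r <= e -> h r = (hr r)%:E.
Hypothesis hgo : gauge_on d hr e.
Hypothesis heps : (e%:E <= eps_h d h)%E.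

Definition net_adm : set (set 'rV[R]_d) :=
  [set Q | Q = set0 \/ (dyadic Q /\ (diam N Q < eps_h d h)%E)].
Definition diam_cost (g : R -> \bar R) (Q : set 'rV[R]_d) : \bar R := g (fine (diam N Q)).

Notation net_covered := (covered net_adm id (diam_cost h)).

Lemma diam_cost_ge0 (g : R -> \bar R) Q : gauge_fun g -> (0 <= diam_cost g Q)%E.
Proof. by move=> [g0 _ _ _]; apply: g0; exact/fine_ge0/diam_ge0. Qed.

Lemma diam_cost_set0 (g : R -> \bar R) : gauge_fun g -> diam_cost g set0 = 0%E.
Proof. by move=> [_ _ g00 _]; rewrite /diam_cost diam_set0. Qed.

Lemma net_cost_ge0 Q : net_adm Q -> (0 <= diam_cost h Q)%E.
Proof. by move=> _; exact: diam_cost_ge0. Qed.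

Lemma net_cost_null : exists2 Q, net_adm Q & diam_cost h Q = 0%E.
Proof. by exists set0; [left|exact: diam_cost_set0]. Qed.

Lemma Mh_le E v : net_covered E v -> (Mh N h E <= v)%E.
Proof.
move=> [C [aC cC sC]]; apply: le_trans sC; apply: ereal_inf_lbound; exists C => //.
Qed.

Lemma Mh_ge E v : (forall C : nat -> set 'rV[R]_d, (forall n, net_adm (C n)) ->
    E `<=` \bigcup_n C n -> (v <= \sum_(n <oo) diam_cost h (C n))%E) -> (v <= Mh N h E)%E.
Proof. by move=> hC; apply/ereal_infP => _ [C [cC aC] <-]; exact: hC. Qed.

Lemma dcube_index_uniq (j : int) k (x : 'rV[R]_d) : dcube j k x -> k = dcube_index j x.
Proof.
move=> xk; apply/rowP => i; rewrite mxE; apply/esym/floor_def.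
by have := xk i; rewrite intrD.
Qed.

Lemma nneseries_tail_small (u : nat -> \bar R) (eps : R) : (forall n, 0 <= u n)%E ->
  (\sum_(n <oo) u n < +oo)%E -> 0 < eps ->
  exists M : nat, (\sum_(n <oo) (if (M <= n)%N then u n else 0) <= eps%:E)%E.
Proof.
move=> u0 Sfin eps0; set S := (\sum_(n <oo) u n)%E in Sfin *.
have S0 : (0 <= S)%E by apply: nneseries_ge0.
have SE : S = (fine S)%:E by rewrite fineK// ge0_fin_numE.
have [M hM] : exists M, ((fine S - eps)%:E < \sum_(0 <= n < M) u n)%E.
  apply: contrapT => nM; have : (S <= (fine S - eps)%:E)%E.
    by apply: nneseries_le => // M; rewrite leNgt; apply/negP => hM; apply: nM; exists M.
  by rewrite SE lee_fin; lra.
exists M; set T := (\sum_(n <oo) _)%E.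
have T0 : (0 <= T)%E by apply: nneseries_ge0 => n _ _; case: ifP.
have : (S = \sum_(0 <= n < M) u n + T)%E.
  rewrite /S (eq_eseriesr (g := fun n => (if (n < M)%N then u n else 0) +
      (if (M <= n)%N then u n else 0))%E); last first.
    by move=> n _; case: ltnP => _; rewrite ?adde0 ?add0e.
  rewrite nneseriesD; [|by move=> n _ _; case: ifP|by move=> n _ _; case: ifP].
  congr (_ + _)%E; rewrite (@nneseries_finite _ _ M).
  - by apply: eq_big_nat => n /andP[_ ->].
  - by move=> n; case: ifP.
  - by move=> n Mn; rewrite ltnNge Mn.
move=> ST; move: hM; have := ST; rewrite {1}SE.
have P0 : (0 <= \sum_(0 <= n < M) u n)%E by apply: sume_ge0.
case: (\sum_(0 <= n < M) u n)%E P0 => [p| |]// _; last by case: T T0 {ST}.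
by case: T T0 {ST} => [t| |]// _; rewrite -EFinD lte_fin lee_fin => -[->]; lra.
Qed.

Lemma nneseries_single (u : nat -> \bar R) (i0 : nat) : (0 <= u i0)%E ->
  (forall i, i != i0 -> u i = 0%E) -> (\sum_(i <oo) u i = u i0)%E.
Proof.
move=> u0 ui.
have uge i : (0 <= u i)%E by have [->//|/ui ->] := eqVneq i i0.
rewrite (@nneseries_finite _ _ i0.+1)//; last by move=> i ii; apply: ui; rewrite gtn_eqF.
rewrite big_nat_recr//= big_nat big1 ?add0e// => i /andP[_ ii].
by apply: ui; rewrite ltn_eqF.
Qed.

(** A point of [W] missed by the cover [C] lies in a maximal dyadic cube of [W], of generation at
    least [J], contained in no [C n]. Pieces meeting such a cube lie inside it and have index at
    least [N0]; they cover [F] in an inscribed ball, so they weigh at least [kap] times the cube.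
    These cubes being disjoint, adding them all to [C] costs at most the tail of [C] divided by
    [kap]. *)
Lemma Mh_large_int (c : R) (W : set 'rV[R]_d) : 0 < c -> content_lower hr e c ->
  norm_open N W -> W `<=` U -> Mh N h (F `&` W) = Mh N h W.
Proof.
move=> c0 hlow Wo WU; apply/eqP; rewrite eq_le; apply/andP; split.
  apply: Mh_ge => C aC cC; apply: Mh_le; exists C; split=> //.
  by apply: subset_trans cC; exact: subIsetr.
apply: Mh_ge => C aC cC.
have cost0 n : (0 <= diam_cost h (C n))%E by exact: diam_cost_ge0.
have [Soo|Sfin] := eqVneq (\sum_(n <oo) diam_cost h (C n))%E +oo%E; first by rewrite Soo leey.
apply/lee_addgt0Pr => eps eps0.
have [B hB] := coord_equiv_ex hN hd.
have [B1 _ _] := hB; have B0 : 0 < B by exact: lt_le_trans B1.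
have [e0 hr0 hrD hrS hrT] := hgo.
(* [2 * B ^+ 2] is the ratio of the diameter bound of a dyadic cube to the radius of the inscribed
   ball in [dcube_ball]. *)
pose kap := c * (2 * B ^+ 2) ^- d.
have kap0 : 0 < kap.
  by rewrite mulr_gt0 ?invr_gt0 ?exprn_gt0// mulr_gt0// exprn_gt0.
have Slt : (\sum_(n <oo) diam_cost h (C n) < +oo)%E by rewrite ltey.
have [N0 hN0] := nneseries_tail_small cost0 Slt (mulr_gt0 kap0 eps0).
have /choice[jk hjk] : forall n, exists jk : int * 'rV[int]_d, C n = set0 \/ C n = dcube jk.1 jk.2.
  move=> n; have [->|[[j [k ->]] _]] := aC n; first by exists (0, 0); left.
  by exists (j, k); right.
(* No nonempty piece among the first [N0] is finer than generation [J], so none lies strictly inside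
   a selected cube; cubes from [J] on are also small enough for the gauge. *)
have [J hJ1 hJ2] : exists2 J : nat, (forall n, (n < N0)%N -> (jk n).1 <= J%:Z) &
    forall j, (J <= j)%N -> B * (2 ^+ j)^-1 < e.
  have half (j : nat) : B * (2 ^+ j.+1)^-1 <= B * (2 ^+ j)^-1 / 2 :> R.
    by rewrite exprS invfM mulrCA [leRHS]mulrC.
  have [J0 J1 hJ0] := halving_small e0 half (\sum_(n < N0) `|(jk n).1|)%N.
  exists J0 => [n nN|j Jj].
    apply: le_trans (lez_abs _) _; rewrite lez_nat; apply: leq_trans J1.
    by rewrite (bigD1 (Ordinal nN))//= leq_addr.
  apply: le_lt_trans hJ0; rewrite ler_pM2l// lef_pV2 ?posrE ?exprn_gt0//.
  by rewrite ler_weXn2l// ler1n.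
(* Maximality is stated along one point [x]: the coarser dyadic cubes containing the selected one
   are those of [x]. *)
pose sel (m : nat * 'rV[int]_d) := exists x : 'rV[R]_d, [/\ W x, m.2 = dcube_index (Posz m.1) x,
  (J <= m.1)%N, (forall n, ~ dcube (Posz m.1) m.2 `<=` C n) & 
  dcube (Posz m.1) m.2 `<=` W /\ forall j, (J <= j)%N -> (j < m.1)%N -> ~ dcube (Posz j) (dcube_index (Posz j) x) `<=` W].
have sel_uniq m m' (u : 'rV[R]_d) : sel m -> sel m' -> dcube (Posz m.1) m.2 u -> dcube (Posz m'.1) m'.2 u -> m = m'.
  wlog : m m' / (m.1 <= m'.1)%N => [hw sm sm' um um'|].
    have [mm|/ltnW mm] := leqP m.1 m'.1; first exact: hw.
    by apply/esym/hw.
  move=> mm sm sm' um um'.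
  have sub := dcube_nested (j := Posz m.1) (j' := Posz m'.1) mm um um'.
  move: mm; rewrite leq_eqVlt => /orP[/eqP mm|mm].
    rewrite [m]surjective_pairing [m']surjective_pairing.
    by rewrite (dcube_index_uniq um) (dcube_index_uniq um') mm.
  have [x [_ _ Jm _ [mW _]]] := sm; have [x' [_ kx' _ _ [_ hmin]]] := sm'.
  have xm : dcube (Posz m.1) m.2 x' by apply: sub; rewrite kx'; exact: dcube_mem.
  by case: (hmin _ Jm mm); rewrite -(dcube_index_uniq xm).
have sel_nested m n (u : 'rV[R]_d) : sel m -> dcube (Posz m.1) m.2 u -> C n u ->
    [/\ (N0 <= n)%N, C n `<=` dcube (Posz m.1) m.2 & C n = dcube (jk n).1 (jk n).2].
  move=> [x [_ _ Jm nC _]] um uC.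
  have CE : C n = dcube (jk n).1 (jk n).2 by case: (hjk n) => // Cn; rewrite Cn in uC.
  rewrite CE in uC.
  have lt : Posz m.1 < (jk n).1.
    by rewrite ltNge; apply/negP => le; apply: (nC n); rewrite CE; exact: dcube_nested le uC um.
  split=> //; last by rewrite CE; exact: dcube_nested (ltW lt) um uC.
  rewrite leqNgt; apply/negP => nN; have := hJ1 _ nN.
  by rewrite leNgt => /negP; apply; apply: le_lt_trans lt; rewrite lez_nat.
pose inside m n := sel m /\ (C n !=set0 /\ C n `<=` dcube (Posz m.1) m.2).
pose a m n : \bar R := if `[< inside m n >] then diam_cost h (C n) else 0%E.
have a0 m n : (0 <= a m n)%E by rewrite /a; case: ifP.
have weight m : sel m -> ((kap)%:E * diam_cost h (dcube (Posz m.1) m.2) <= \sum_(n <oo) a m n)%E.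
  move=> sm; have [x [_ _ Jm _ [mW _]]] := sm.
  have [z hz] := dcube_ball hB (Posz m.1) m.2.
  have [DE D1 D2] := dcube_diam hN hd hB (Posz m.1) m.2.
  set dm := fine _ in DE D1 D2; set rho := _ / _ in hz D1.
  have q0 : 0 < (2 ^+ m.1)^-1 :> R by rewrite invr_gt0 exprn_gt0.
  have rho0 : 0 < rho by rewrite divr_gt0// mulr_gt0.
  have dme : dm <= e by apply: le_trans D2 (ltW (hJ2 _ Jm)).
  have dm0 : 0 < dm by exact: lt_le_trans D1.
  have key : (kap%:E * diam_cost h (dcube (Posz m.1) m.2) <= (c * hr rho)%:E)%E.
    rewrite /diam_cost -/dm he ?(ltW dm0)// -EFinM lee_fin /kap -mulrA ler_pM2l//.
    rewrite ler_pdivrMl ?exprn_gt0 ?mulr_gt0 ?exprn_gt0//.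
    have rd : 0 < rho ^+ d by rewrite exprn_gt0.
    rewrite -(ler_pM2r rd) (le_trans (hrS _ _ rho0 D1 dme))// mulrAC mulrC -exprMn.
    rewrite ler_wpM2r ?(ltW (hr0 _ rho0 (le_trans D1 dme)))//.
    rewrite lerXn2r ?nnegrE ?(ltW dm0)//.
      by apply: mulr_ge0; [rewrite mulr_ge0 ?exprn_ge0 ?(ltW B0)|exact: ltW].
    apply: le_trans D2 _; rewrite /rho le_eqVlt; apply/orP; left; apply/eqP.
    by field; rewrite !gt_eqF// exprn_gt0.
  apply: le_trans key _.
  (* Pieces outside the cube are emptied, so that only the weight inside it is used. *)
  pose Q n := if `[< inside m n >] then C n else set0.
  apply: (content_weights hlow rho0 (le_trans D1 dme) (subset_trans hz (subset_trans mW WU)) (Q := Q)).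
  - exact: a0.
  - move=> n eta eta0; rewrite /Q /a; case: asboolP => [[_ [[u uC] Csub]]|_].
      have um := Csub _ uC; have [_ _ CE] := sel_nested _ _ _ sm um uC.
      have Cle : (diam N (C n) <= dm%:E)%E.
        apply: diam_le => [|y y' Cy Cy']; first exact: ltW.
        by rewrite -lee_fin -DE; apply: diam_ge; exact: Csub.
      have [CDE C0 C1 C2] := diam_fin Cle.
      have Cp : 0 < fine (diam N (C n)) by rewrite CE; exact: dcube_diam_gt0 hB _ _.
      exists (fine (diam N (C n))); split=> //; first exact: le_trans C1 dme.
      by rewrite /diam_cost he ?(le_trans C1 dme)// -EFinD lee_fin; lra.
    have [e' e'0 he'] := gauge_small hg eta0.
    have q0' : 0 < Num.min e e' by rewrite lt_min e0.
    exists (Num.min e e'); split=> //; first by rewrite ge_min lexx.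
    by rewrite add0e -he ?(ltW q0') ?ge_min ?lexx// he'// ge_min lexx orbT.
  - move=> u [Fu uz]; have um := hz _ uz.
    have [n _ uC] := cC u (conj Fu (mW _ um)); exists n => //.
    have [_ Csub _] := sel_nested _ _ _ sm um uC.
    by rewrite /Q; case: asboolP => // ni; case: ni; split=> //; split=> //; exists u.
pose D i : set 'rV[R]_d := if pickle_inv i is Some m then
  if `[< sel m >] then dcube (Posz m.1) m.2 else set0 else set0.
pose aD i n : \bar R := if pickle_inv i is Some m then a m n else 0%E.
have coverW : W `<=` (\bigcup_n C n) `|` (\bigcup_i D i).
  move=> x Wx.
  have [j0 Jj0 j0W] := open_dcube_cover hd hN Wo J Wx.
  have ex : exists j, (J <= j)%N && `[< dcube (Posz j) (dcube_index (Posz j) x) `<=` W >].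
    by exists j0; rewrite Jj0; apply/asboolP.
  have [j /andP[Jj /asboolP jW] jmin] := ex_minnP ex.
  have [[n nC]|nC] := pselect (exists n, dcube (Posz j) (dcube_index (Posz j) x) `<=` C n).
    by left; exists n => //; apply: nC; exact: dcube_mem.
  right; exists (pickle (j, dcube_index (Posz j) x)) => //.
  rewrite /D pickleK_inv; case: asboolP => [_|nsel]; first exact: dcube_mem.
  case: nsel; exists x; split=> //=; first by move=> n h'; apply: nC; exists n.
  split=> // j' Jj' j'j; have := jmin j'; rewrite Jj'/= => hj' j'W.
  by have := hj' (introT (asboolP _) j'W); rewrite leqNgt j'j.
have costD : (\sum_(i <oo) diam_cost h (D i) <= eps%:E)%E.
  have kapE : (0 < kap%:E)%E by rewrite lte_fin.
  rewrite -(lee_pmul2l _ kapE) ?fin_numE// -nneseriesZl; last by move=> i _; exact: diam_cost_ge0.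
  apply: (@le_trans _ _ (\sum_(i <oo) \sum_(n <oo) aD i n)%E).
    apply: lee_nneseries => [i _ _|i _].
      by apply: mule_ge0; [exact: ltW|exact: diam_cost_ge0].
    rewrite /D /aD; case: pickle_inv => [m|]; last first.
      by rewrite diam_cost_set0// mule0 nneseries_ge0.
    case: asboolP => [sm|_]; first exact: weight.
    by rewrite diam_cost_set0// mule0 nneseries_ge0.
  have aD0 i n : (0 <= aD i n)%E by rewrite /aD; case: pickle_inv.
  rewrite nneseries_interchange//.
  rewrite -EFinM; apply: le_trans hN0; apply: lee_nneseries => [n _ _|n _].
    exact: nneseries_ge0.
  (* Selected cubes are disjoint and [C n] is nonempty when counted, so at most one [i] contributes
     for each [n]. *)
  have [[i0 hi0]|none] := pselect (exists i, aD i n != 0%E); last first.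
    rewrite eseries0; first by case: ifP.
    by move=> i _ _; apply/eqP; apply: contrapT => /negP hi; apply: none; exists i.
  have haD i : aD i n != 0%E -> exists m, [/\ pickle m = i, sel m, C n !=set0 & C n `<=` dcube (Posz m.1) m.2].
    rewrite /aD; case E : (pickle_inv i) => [m|]; last by rewrite eqxx.
    rewrite /a; case: asboolP => [[sm [Cn Csub]]|_]; last by rewrite eqxx.
    by move=> _; exists m; split=> //; have := @pickle_invK (nat * 'rV[int]_d)%type i; rewrite E.
  have [m0 [pm0 sm0 [u uC] Csub]] := haD _ hi0.
  rewrite (@nneseries_single _ i0)//; last first.
    move=> i; apply: contra_neq_eq => /haD[m [pm sm _ Csub']].
    by rewrite -pm -pm0 (sel_uniq _ _ u sm sm0 (Csub' _ uC) (Csub _ uC)).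
  have [-> _ _] := sel_nested _ _ _ sm0 (Csub _ uC) uC.
  rewrite /aD; case: pickle_inv => [m|]; last exact: cost0.
  by rewrite /a; case: ifP => _; [exact: lexx|exact: cost0].
apply: Mh_le.
have covC : net_covered (\bigcup_n C n) (\sum_(n <oo) diam_cost h (C n))%E.
  by exists C; split; [exact: aC|exact: subset_refl|exact: lexx].
have covD : net_covered (\bigcup_i D i) eps%:E.
  exists D; split=> // i; rewrite /D; case: pickle_inv => [m|]; last by left.
  case: asboolP => [[x [_ _ Jm _ _]]|_]; last by left.
  right; split; first exact: dcube_dyadic.
  have [-> _ D2] := dcube_diam hN hd hB (Posz m.1) m.2.
  by apply: lt_le_trans heps; rewrite lte_fin (le_lt_trans D2)// hJ2.
exact: (covered_sub coverW (lexx _) (covered_setU net_cost_ge0 net_cost_null covC covD)).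
Qed.

End NetMeasure.

(** * The convergence half *)

Section LimsupNull.
Variables (R : realType) (d : nat) (N : 'rV[R]_d -> R).
Hypotheses (hN : is_norm N) (hd : (1 <= d)%N).
Variables (U A : set 'rV[R]_d) (H : 'rV[R]_d -> R).
Hypothesis hUo : norm_open N U.
Hypothesis hAc : countable A.
Hypothesis hH : forall a, A a -> 0 < H a.
Hypothesis hopt : optimal_system N U A H.

Definition system_part (B : set 'rV[R]_d) (K : R) : set 'rV[R]_d :=
  [set a | [/\ A a, U a, B a & K < H a]].

(** Optimality bounds the number of points of height in []2 ^ j, 2 ^ (j + 1)]] by [kap * 2 ^+ d]
    times [(2 ^ j) ^+ d], and each contributes at most [psi (2 ^ j)]. [K] does not depend on [s], so
    the bound passes to infinite sums. *)
Lemma optimal_tail_sum (B : set 'rV[R]_d) (psi : R -> R) (eta0 eps : R) : open_ballN N B ->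
  (forall t, 0 <= psi t) ->
  (forall s t, eta0 <= s -> s <= t -> psi t <= psi s) ->
  ~ diverges (fun k => (2%:R ^+ k) ^+ d * psi (2%:R ^+ k)) -> 0 < eps ->
  exists K : R, forall s : seq 'rV[R]_d, uniq s -> (forall a, a \in s -> system_part B K a) ->
    \sum_(a <- s) psi (H a) <= eps.
Proof.
move=> oB psi0 psiD nd eps0.
have [_ /(_ _ oB)[kap [hB [kap0 hB0 hcount]]]] := hopt.
have kd0 : 0 < kap * 2 ^+ d by rewrite mulr_gt0// exprn_gt0.
have x0 k : 0 <= (2%:R ^+ k) ^+ d * psi (2%:R ^+ k) by rewrite mulr_ge0// !exprn_ge0.
have [k0 hk0] := not_diverges_tail x0 nd (divr_gt0 eps0 kd0).
pose k1 := maxn k0 (Num.truncn (`|eta0| + hB)).+1.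
have p2 k : 0 < 2 ^+ k :> R by rewrite exprn_gt0.
have hk1 k : (k1 <= k)%N -> eta0 <= 2 ^+ k /\ hB < 2 ^+ k.
  rewrite geq_max => /andP[_ kk].
  have : `|eta0| + hB < 2 ^+ k.
    apply: lt_le_trans (truncnS_gt _) _; rewrite -natrX ler_nat.
    exact: leq_trans kk (ltnW (ltn_expl _ (ltnSn 1))).
  by have := ler_norm eta0; have := normr_ge0 eta0; split; lra.
exists (2 ^+ k1) => s us hs.
have [k2 hk2] : exists k2, forall a, a \in s -> H a <= 2 ^+ k2.
  exists (Num.truncn (\sum_(a <- s) `|H a|)).+1 => a sa.
  apply: (@le_trans _ _ (Num.truncn (\sum_(a <- s) `|H a|)).+1%:R); last first.
    by rewrite -natrX ler_nat ltnW// ltn_expl.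
  apply: le_trans (ltW (truncnS_gt _)).
  by rewrite (le_trans (ler_norm _))// (big_rem a)//= lerDl sumr_ge0.
pose lev (a : 'rV[R]_d) j := (2 ^+ j < H a) && (H a <= 2 ^+ j.+1).
have level a : a \in s -> exists2 j, (k1 <= j < k2)%N & lev a j.
  move=> sa; have [_ _ _ Ka] := hs _ sa.
  have [j hj jmin] := ex_minnP (ex_intro (fun j => H a <= 2 ^+ j) _ (hk2 _ sa)).
  have j1 : (k1 < j)%N.
    rewrite ltnNge; apply/negP => jk.
    by have : 2 ^+ j <= 2 ^+ k1 :> R; [rewrite ler_weXn2l// ler1n|lra].
  case: j hj jmin j1 => // j hj jmin j1; exists j.
    by rewrite -ltnS j1/=; exact: jmin (hk2 _ sa).
  rewrite /lev hj andbT ltNge; apply/negP => hj'.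
  by have := jmin _ hj'; rewrite ltnn.
have Ha0 a : a \in s -> 0 < H a by move=> /hs[Aa _ _ _]; exact: hH.
apply: (@le_trans _ _ (\sum_(k1 <= j < k2) \sum_(a <- [seq a <- s | lev a j]) psi (H a))).
  have -> : \sum_(k1 <= j < k2) \sum_(a <- [seq a <- s | lev a j]) psi (H a) =
      \sum_(a <- s) \sum_(k1 <= j < k2) (if lev a j then psi (H a) else 0).
    by rewrite exchange_big/=; apply: eq_bigr => j _; rewrite big_filter big_mkcond.
  rewrite [leLHS]big_seq [leRHS]big_seq ler_sum// => a sa.
  have [j hj laj] := level a sa.
  rewrite (bigD1_seq j)/= ?iota_uniq ?mem_index_iota// laj lerDl sumr_ge0// => i _.
  by case: ifP.
apply: (@le_trans _ _ (\sum_(k1 <= j < k2) kap * 2 ^+ d * ((2 ^+ j) ^+ d * psi (2 ^+ j)))).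
  rewrite big_nat [leRHS]big_nat ler_sum// => j /andP[kj jk].
  have [ej hBj] := hk1 _ kj.
  apply: (@le_trans _ _ (\sum_(a <- [seq a <- s | lev a j]) psi (2 ^+ j))).
    rewrite big_seq [leRHS]big_seq ler_sum// => a; rewrite mem_filter => /andP[/andP[la _] _].
    by apply: psiD => //; exact: ltW.
  rewrite big_const_seq count_predT iter_addr_0 -[leLHS]mulr_natl.
  have hB' : hB < 2 ^+ j.+1 by apply: lt_le_trans hBj _; rewrite ler_weXn2l// ler1n.
  have := hcount _ hB' [seq a <- s | lev a j] (filter_uniq _ us).
  have h a : a \in [seq a <- s | lev a j] -> [/\ A a, U a, B a & H a <= 2 ^+ j.+1].
    by rewrite mem_filter => /andP[/andP[_ ?] /hs[]].
  move=> /(_ h) => hc; apply: (le_trans (ler_wpM2r (psi0 _) hc)).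
  by rewrite exprS exprMn !mulrA.
rewrite -mulr_sumr mulrC -ler_pdivlMr//; apply: le_trans (hk0 k2).
have [k2k1|k1k2] := leqP k2 k1; first by rewrite big_geq// sumr_ge0.
rewrite [leRHS](big_cat_nat (n := k1)) ?leq_maxl ?(ltnW k1k2)//= lerDr sumr_ge0//.
Qed.

Variable phi : R -> R.
Hypothesis hphi : admissible_rate phi.
Hypothesis phi_small : forall e : R, 0 < e -> exists2 t, 0 <= t & phi t <= e.

(** Optimality counts only points of [U] in a ball, while [F_phi] uses all of [A]. As [phi] tends to
    0 and [U] is open, approximating points of large height lie in [U] and within 1 of [x]; those of
    smaller height are finitely many by admissibility. *)
Lemma F_phi_approx (x : 'rV[R]_d) (m K : R) : F_phi N A H phi x -> U x -> N x + 1 <= m ->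
  exists a, system_part (ballN N 0 m) K a /\ N (x - a) < phi (H a).
Proof.
move=> Fx Ux xm; have [phi0 phiD] := hphi.
have [r r0 BU] := hUo Ux.
have r1 : 0 < Num.min r 1 by rewrite lt_min r0 ltr01.
have [t t0 ht] := phi_small r1.
have [adm _] := hopt.
have [S hS] := @admissible_bounded R d N hN A H x (phi 0) (`|K| + t) adm.
apply: contrapT => na; apply: Fx.
apply: (@sub_finite_set _ _ [set` S]); last exact: finite_seq.
move=> a [Aa xa] /=; apply: hS => //.
  by rewrite norm_distC// (le_trans (ltW xa))// phiD// ltW// hH.
rewrite leNgt; apply/negP => Ka; apply: na; exists a; split=> //.
have tH : t <= H a by have := normr_ge0 K; lra.
have : phi (H a) <= Num.min r 1 by apply: le_trans ht; exact: phiD.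
rewrite le_min => /andP[pr p1]; split=> //.
- by apply: BU; rewrite /ballN/= norm_distC//; lra.
- rewrite /ballN/= subr0; have := norm_distD hN x a 0; rewrite !subr0 (norm_distC hN a x); lra.
- by have := ler_norm K; lra.
Qed.

Variables (X : Type) (adm : set X) (piece : X -> set 'rV[R]_d) (cost : X -> \bar R).
Hypothesis cost_ge0 : forall x, adm x -> (0 <= cost x)%E.
Hypothesis cost_null : exists2 x0, adm x0 & cost x0 = 0%E.
Variables (Psi : R -> R) (e : R).
Hypothesis e0 : 0 < e.
Hypothesis Psi_ge0 : forall r, 0 <= Psi r.
Hypothesis Psi_homo : forall r s, 0 < r -> r <= s -> s <= e -> Psi r <= Psi s.
Hypothesis ball_covered : forall a s, 0 < s -> s <= e ->
  covered adm piece cost (ballN N a s) (Psi s)%:E.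
Hypothesis Psi_conv : ~ diverges (fun k => (2%:R ^+ k) ^+ d * Psi (phi (2%:R ^+ k))).

(** The cost [Psi] of covering a ball is abstract, so that boxes (Lebesgue measure) and small dyadic
    cubes (gauges) are treated together. *)
Lemma limsup_null (eps : R) : 0 < eps ->
  covered adm piece cost (F_phi N A H phi `&` U) eps%:E.
Proof.
have [phi0 phiD] := hphi.
(* Optimality gives its constants ball by ball, hence the exhaustion by bounded parts. *)
suff Hm (m : nat) (eps' : R) : 0 < eps' ->
    covered adm piece cost ([set x | N x + 1 <= m.+1%:R] `&` (F_phi N A H phi `&` U)) eps'%:E.
  move=> eps0; apply: covered_sub (covered_null_bigcup cost_ge0 Hm eps0) => // x [Fx Ux].
  exists (Num.truncn (N x + 1)) => //; split=> //=; exact/ltW/truncnS_gt.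
move=> eps0; have [t0 t00 ht0] := phi_small e0.
have oB : open_ballN N (ballN N 0 m.+1%:R) by exists 0, m.+1%:R => //; rewrite ltr0n.
have psiD s t : t0 <= s -> s <= t -> Psi (phi t) <= Psi (phi s).
  move=> t0s st; have s0 : 0 <= s by exact: le_trans t0s.
  apply: Psi_homo; [exact/phi0/(le_trans s0)|exact: phiD|].
  by apply: le_trans ht0; exact: phiD.
have [K hK] := optimal_tail_sum oB (fun t => Psi_ge0 (phi t)) psiD Psi_conv eps0.
pose K' := Num.max K t0.
have KK a : system_part (ballN N 0 m.+1%:R) K' a -> system_part (ballN N 0 m.+1%:R) K a /\ t0 < H a.
  by move=> [Aa Ua Ba]; rewrite gt_max => /andP[h1 h2].
(* The injection [f] arranges the balls in a sequence; [ea] is a partial inverse with a default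
   value. *)
have /countable_injP[f finj] := hAc.
pose val i a := system_part (ballN N 0 m.+1%:R) K' a /\ f a = i.
have /choice[ea hea] : forall i, exists a, (exists b, val i b) -> val i a.
  by move=> i; have [[b hb]|nb] := pselect (exists b, val i b); [exists b|exists 0].
pose E i : set 'rV[R]_d := if `[< exists b, val i b >] then ballN N (ea i) (phi (H (ea i))) else set0.
pose v i : \bar R := if `[< exists b, val i b >] then (Psi (phi (H (ea i))))%:E else 0%E.
have v0 i : (0 <= v i)%E by rewrite /v; case: ifP => _//; rewrite lee_fin.
have hcov i : covered adm piece cost (E i) (v i).
  rewrite /E /v; case: asboolP => [hb|_]; last exact: covered_set0 cost_null.
  have [/KK[[Aa _ _ _] tH] _] := hea _ hb.
  apply: ball_covered; first exact/phi0/ltW/hH.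
  by apply: le_trans ht0; apply: phiD => //; exact: ltW.
apply: covered_sub (covered_bigcup cost_ge0 hcov).
  move=> x [xm [Fx Ux]]; have [a [sa xa]] := F_phi_approx K' Fx Ux xm.
  have hb : exists b, val (f a) b by exists a.
  exists (f a) => //; rewrite /E; case: asboolP => // _.
  have [[Ab _ _ _] fb] := hea _ hb; have [Aa _ _ _] := sa.
  by have -> : ea (f a) = a by apply: finj => //; rewrite inE.
apply: nneseries_le => // M.
pose s := [seq ea i | i <- iota 0 M & `[< exists b, val i b >]].
have -> : (\sum_(0 <= i < M) v i = (\sum_(a <- s) Psi (phi (H a)))%:E)%E.
  rewrite -sumEFin big_map big_filter [RHS]big_mkcond/= /index_iota subn0.
  by apply: eq_bigr => i _; rewrite /v; case: ifP.
rewrite lee_fin; apply: hK.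
- rewrite map_inj_in_uniq ?filter_uniq ?iota_uniq// => i j.
  rewrite !mem_filter => /andP[/asboolP hi _] /andP[/asboolP hj _] eij.
  by have [_ <-] := hea _ hi; have [_ <-] := hea _ hj; rewrite eij.
- move=> a /mapP[i]; rewrite mem_filter => /andP[/asboolP hi _] ->.
  by have [/KK[]] := hea _ hi.
Qed.

End LimsupNull.

Section BallPieces.
Variables (R : realType) (d : nat) (N : 'rV[R]_d -> R).
Hypotheses (hN : is_norm N) (hd : (1 <= d)%N).

Definition net_small (delta : R) : set (set 'rV[R]_d) :=
  [set Q | Q = set0 \/ (dyadic Q /\ (diam N Q <= delta%:E)%E)].

(** The cubes pay [g], yet the cost is a multiple of [gdr d g s]: their diameters are at most the
    scale [rho] of [gdr_witness]. *)
Lemma ball_net_covered (g : R -> \bar R) (delta : R) : Ginf d g -> 0 < delta ->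
  exists (c e : R), [/\ 0 < c, 0 < e,
    forall r s, 0 < r -> r <= s -> s <= e -> gdr d g r <= gdr d g s
  & forall a s, 0 < s -> s <= e ->
      covered (net_small delta) id (diam_cost N g) (ballN N a s) (c * gdr d g s)%:E].
Proof.
move=> hG delta0; have [hg _] := hG.
have [C hC] := coord_equiv_ex hN hd.
have [C1 _ _] := hC; have C0 : 0 < C by exact: lt_le_trans C1.
have [e1 [e10 gd0 gdD _ _]] := gauge_on_gdr hG.
have [g0 [e2 e20 gD] _ _] := hg.
pose e := Num.min (Num.min e1 e2) (Num.min delta 1).
have e0 : 0 < e by rewrite !lt_min e10 e20 delta0 ltr01.
have [ee1 ee2 edelta e_1] : [/\ e <= e1, e <= e2, e <= delta & e <= 1].
  by split; rewrite /e !ge_min lexx ?orbT.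
exists (2 * (6 * C ^+ 2) ^+ d), e; split=> //.
- by rewrite mulr_gt0// exprn_gt0// mulr_gt0// exprn_gt0.
- by move=> r s r0 rs se; apply: gdD => //; exact: le_trans ee1.
move=> a s s0 se.
have G0 : 0 < gdr d g s by apply: gd0 => //; exact: le_trans ee1.
have [rho [rho0 rhos hrho]] := gdr_witness hg s0 G0.
have [|j [l [sl diamj cov]]] := ball_dyadic_cover hN hd hC a rho0 rhos.
  exact: le_trans rhos (le_trans se e_1).
have cost0 Q : net_small delta Q -> (0 <= diam_cost N g Q)%E by move=> _; exact: diam_cost_ge0.
have costN : exists2 Q, net_small delta Q & diam_cost N g Q = 0%E.
  by exists set0; [left|exact: diam_cost_set0].
have adm k : net_small delta (dcube j k).
  right; split; first exact: dcube_dyadic.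
  by apply: le_trans (diamj k) _; rewrite lee_fin (le_trans rhos)// (le_trans se).
apply: covered_sub (covered_seq cost0 costN (s := l) (E := fun k => dcube j k)
    (v := fun k => diam_cost N g (dcube j k)) _).
- by move=> x xa; have [k kl xk] := cov x (ltW xa); exists k.
- apply: (@le_trans _ _ (\sum_(k <- l) (2 * gdr d g s * (rho / s) ^+ d)%:E)%E).
    apply: lee_sum => k _; apply: le_trans hrho; rewrite /diam_cost.
    have [_ D0 D1 _] := diam_fin (diamj k).
    by apply: gD => //; rewrite (le_trans rhos)// (le_trans se).
  rewrite sumEFin lee_fin big_const_seq count_predT iter_addr_0 -[leLHS]mulr_natl.
  have p0 : 0 <= 2 * gdr d g s * (rho / s) ^+ d.
    by rewrite mulr_ge0 ?mulr_ge0 ?exprn_ge0 ?divr_ge0 ?ltW.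
  apply: le_trans (ler_wpM2r p0 sl) _.
  rewrite le_eqVlt; apply/orP; left; apply/eqP.
  have -> : (6 * C ^+ 2) ^+ d * (s / rho) ^+ d * (2 * gdr d g s * (rho / s) ^+ d) =
      2 * (6 * C ^+ 2) ^+ d * gdr d g s * ((s / rho) * (rho / s)) ^+ d.
    by rewrite [X in _ = _ * X]exprMn; ring.
  have -> : (s / rho) * (rho / s) = 1 by field; rewrite !gt_eqF.
  by rewrite expr1n mulr1.
- by move=> k _; exact: (covered1 id cost0 costN (adm k)).
Qed.

(** The absolute value makes the cost nonnegative for every real [s], as [limsup_null] requires of
    [Psi]. *)
Lemma ball_box_covered : exists2 c : R, 0 < c & forall a s, 0 < s ->
  covered box_adm box_piece box_cost (ballN N a s) (c * `|s| ^+ d)%:E.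
Proof.
have [C hC] := coord_equiv_ex hN hd.
have [C1 _ hC2] := hC; have C0 : 0 < C by exact: lt_le_trans C1.
exists ((2 * C) ^+ d); first by rewrite exprn_gt0// mulr_gt0.
move=> a s s0; rewrite gtr0_norm// -exprMn.
have L0 : 0 < 2 * C * s by rewrite !mulr_gt0.
apply: covered_sub (cube_covered hd (\row_i (a 0 i - C * s)) L0) => // x xa i.
have := hC2 (x - a) i; rewrite !mxE ler_norml => /andP[h1 h2].
have h3 : C * N (x - a) < C * s by rewrite ltr_pM2l.
by apply/andP; split; lra.
Qed.
End BallPieces.

Section LimsupStructure.
Variables (R : realType) (d : nat) (N : 'rV[R]_d -> R).
Hypothesis hN : is_norm N.
Variables (A : set 'rV[R]_d) (H : 'rV[R]_d -> R) (phi : R -> R).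
Hypothesis hAc : countable A.

(** With [A] injected into [nat] by [f], infinitely many [a] qualify exactly when for each [m] some
    [a] with [m <= f a] does, and each such condition is open in [x]. *)
Lemma F_phi_Gdelta : GdeltaN N (F_phi N A H phi).
Proof.
have /countable_injP[f finj] := hAc.
exists (fun m => [set x | exists a, [/\ A a, (m <= f a)%N & N (x - a) < phi (H a)]]); split.
  move=> m x [a [Aa ma xa]]; exists (phi (H a) - N (x - a)); first by rewrite subr_gt0.
  move=> y; rewrite /ballN/= => yx; exists a; split=> //.
  by have := norm_distD hN x y a; lra.
apply/seteqP; split=> x.
  move=> Fx m _ /=; apply: contrapT => nm; apply: Fx.
  have /choice[g hg] : forall i, exists a, (exists b, A b /\ f b = i) -> A a /\ f a = i.
    by move=> i; have [[b hb]|nb] := pselect (exists b, A b /\ f b = i); [exists b|exists 0].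
  apply: (@sub_finite_set _ _ [set` [seq g i | i <- iota 0 m]]); last exact: finite_seq.
  move=> a [Aa xa] /=; apply/mapP; exists (f a).
    by rewrite mem_iota/= add0n ltnNge; apply/negP => ma; apply: nm; exists a.
  have [Ag fg] : A (g (f a)) /\ f (g (f a)) = f a by apply: hg; exists a.
  by apply/esym/finj => //; rewrite inE.
move=> hx /finite_seqP[s hs].
have [a [Aa ma xa]] := hx (\sum_(a <- s) f a).+1 I.
have sa : a \in s by move/seteqP: hs => [h _]; exact: (h a).
by move: ma; rewrite (big_rem a)//= ltnNge leq_addr.
Qed.

Lemma Gdelta_borel (F : set 'rV[R]_d) : GdeltaN N F -> borelN N F.
Proof.
move=> [W [Wo ->]] S SO S0 SC SU.
rewrite (_ : \bigcap_n W n = ~` \bigcup_n ~` W n); last first.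
  by rewrite setC_bigcup; apply: eq_bigcapr => n _; rewrite setCK.
exact: (SC _ (SU _ (fun n => SC _ (SO _ (Wo n))))).
Qed.
End LimsupStructure.

Section PrecFacts.
Variables (R : realType) (d : nat).

(** The alternative of [prec] for a gauge vanishing near 0 is excluded, because [gdr d g] is
    positive near 0 for [g] in [Ginf]. *)
Lemma prec_ge (g h : R -> \bar R) (M : R) : Ginf d g -> gauge_fun h -> prec h (gd d g) -> 0 < M ->
  exists2 e : R, 0 < e & forall r, 0 < r -> r <= e -> ((M * gdr d g r)%:E <= h r)%E.
Proof.
move=> hG hh [[e e0 ge]|[e e0 [gpos _ hlim]]] M0.
  have [e1 [e10 g0 _ _ _]] := gauge_on_gdr hG.
  have [hg _] := hG.
  have m0 : 0 < Num.min e e1 by rewrite lt_min e0.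
  have := ge (Num.min e e1) (ltW m0); rewrite ge_min lexx => /(_ isT).
  rewrite gdrE// => -[] gz; have := g0 _ m0; rewrite ge_min lexx orbT gz ltxx.
  by move=> /(_ isT).
have /near0P[e1 e10 he1] : \forall r \near 0^'+, (M%:E <= h r * (fine (gd d g r))^-1%:E)%E.
  by move/cvgeyPge : hlim; apply.
have m0 : 0 < Num.min (e / 2) e1 by rewrite lt_min e10 divr_gt0.
exists (Num.min (e / 2) e1) => // r r0; rewrite le_min => /andP[re re1].
have /andP[gp _] : (0 < gd d g r < +oo)%E by apply: gpos => //; lra.
have [hg _] := hG.
have gr0 : 0 < gdr d g r by rewrite -lte_fin -gdrE.
have := he1 _ r0 re1; rewrite -/(gdr d g r) -(@lee_pmul2r _ (gdr d g r)%:E) ?lte_fin//.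
by rewrite -muleA -!EFinM mulVf ?gt_eqF// mule1.
Qed.

Lemma prec_Ginf (g h : R -> \bar R) : Ginf d g -> gauge_fun h -> prec h (gd d g) -> Ginf d h.
Proof.
move=> hG hh hp; split=> // M; apply/near0P.
have [e e0 he] := prec_ge hG hh hp ltr01.
have M1 : 0 < `|M| + 1 by have := normr_ge0 M; lra.
have [e1 e10 he1] := gdr_large hG M1.
exists (Num.min e e1) => [|r r0]; first by rewrite lt_min e0.
rewrite le_min => /andP[re re1].
have rd : 0 < r ^+ d by rewrite exprn_gt0.
apply: (@le_trans _ _ ((1 * gdr d g r)%:E * (r ^+ d)^-1%:E)%E).
  rewrite -EFinM lee_fin mul1r ler_pdivlMr//; apply: le_trans (he1 _ r0 re1).
  by rewrite ler_pM2r//; have := ler_norm M; lra.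
by rewrite lee_pmul2r ?lte_fin ?invr_gt0//; exact: he.
Qed.

Lemma normalized_gauge_on (h : R -> \bar R) : Ginf d h -> d_normalized d h ->
  exists e, [/\ gauge_on d (fine \o h) e, (e%:E <= eps_h d h)%E,
    forall r, 0 <= r -> r <= e -> h r = (fine (h r))%:E
  & forall r, 0 <= r -> r <= e -> fine (h r) = gdr d h r].
Proof.
move=> hG [e1 e10 hn]; have [hh _] := hG.
have [e2 [e20 h0 hD hS hT]] := gauge_on_gdr hG.
pose e := Num.min e1 e2.
have e0 : 0 < e by rewrite lt_min e10.
have ee1 : e <= e1 by rewrite ge_min lexx.
have ee2 : e <= e2 by rewrite ge_min lexx orbT.
have hE r : 0 <= r -> r <= e -> h r = (gdr d h r)%:E.
  by move=> r0 re; rewrite hn ?gdrE//; exact: le_trans ee1.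
have hf r : 0 <= r -> r <= e -> fine (h r) = gdr d h r by move=> r0 re; rewrite hE.
exists e; split=> //.
- split=> //=.
  + by move=> r r0 re; rewrite hf ?(ltW r0)// h0// (le_trans re).
  + move=> r s r0 rs se; have s0 := lt_le_trans r0 rs.
    by rewrite !hf ?(ltW r0) ?(ltW s0) ?(le_trans rs)// hD// (le_trans se).
  + move=> r s r0 rs se; have s0 := lt_le_trans r0 rs.
    by rewrite !hf ?(ltW r0) ?(ltW s0) ?(le_trans rs)// hS// (le_trans se).
  + move=> T T0; have [e' e'0 he'] := hT T T0.
    exists (Num.min e e') => [|r r0]; first by rewrite lt_min e0.
    by rewrite le_min => /andP[re re']; rewrite hf ?(ltW r0)// he'.
- apply: ereal_sup_ubound; exists e => //; split=> //; split.
  + move=> r s; rewrite le_eqVlt => /orP[/eqP <-|r0] rs se.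
      by have [+ _ -> _] := hh; apply.
    have s0 := lt_le_trans r0 rs.
    by rewrite !hE ?(ltW r0) ?(ltW s0) ?(le_trans rs)// lee_fin hD// (le_trans se).
  + move=> r s r0 rs se; have s0 := lt_le_trans r0 rs.
    rewrite !hE ?(ltW r0) ?(ltW s0) ?(le_trans rs)// -!EFinM lee_fin.
    by rewrite ler_pdivrMr ?exprn_gt0// mulrAC ler_pdivlMr ?exprn_gt0// gdr_scale.
- by move=> r r0 re; rewrite hE.
Qed.
End PrecFacts.

(** * Slower gauges *)

Section SlowerGauge.
Variables (R : realType) (d : nat) (g : R -> \bar R).
Hypothesis hG : Ginf d g.
Variable X : nat -> R.
Hypothesis X_gt0 : forall i, 0 < X i.
Hypothesis X_le : forall i, X i <= 1 / (2 ^ i.+1)%N%:R.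

Let hg : gauge_fun g. Proof. by have [] := hG. Qed.

Let G := gdr d g.
Let G0 r : 0 <= G r. Proof. exact: gdr_ge0. Qed.

Definition truncated (i : nat) (r : R) : R := Num.min (G r) (X i).

(* Writing y for gd g, the sum of the min(y, X i) is a concave function of y whose ratio to y
   increases to infinity as y decreases to 0. *)
Definition slower_gauge (r : R) : \bar R := (\sum_(i <oo) (truncated i r)%:E)%E.

Let tr0 i r : 0 <= truncated i r. Proof. by rewrite le_min G0 ltW. Qed.

Let h0 r : (0 <= slower_gauge r)%E.
Proof. by apply: nneseries_ge0 => i _ _; rewrite lee_fin. Qed.

Let h1 r : (slower_gauge r <= 1%:E)%E.
Proof.
apply: le_trans (epsilon_trick0 xpredT (@ler01 R)).
apply: lee_nneseries => [i _ _|i _]; first by rewrite lee_fin.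
by rewrite lee_fin; apply: le_trans (X_le i); rewrite ge_min lexx orbT.
Qed.

Lemma slower_gaugeE r : slower_gauge r = (fine (slower_gauge r))%:E.
Proof. by rewrite fineK// ge0_fin_numE// (le_lt_trans (h1 r))// ltry. Qed.

Let hE := slower_gaugeE.

Let h_scale (r s a b : R) : 0 <= a -> 0 <= b ->
  (forall i, truncated i s * a <= truncated i r * b) ->
  fine (slower_gauge s) * a <= fine (slower_gauge r) * b.
Proof.
move=> a0 b0 hi; rewrite -lee_fin !EFinM -!hE muleC [leRHS]muleC /slower_gauge.
rewrite -!nneseriesZl; [|by move=> i _; rewrite lee_fin|by move=> i _; rewrite lee_fin].
apply: lee_nneseries => [i _ _|i _]; first by rewrite -EFinM lee_fin mulr_ge0.
by rewrite -!EFinM lee_fin mulrC [leRHS]mulrC.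
Qed.

(** Capping both sides keeps the inequality because [a <= b]. It is used with powers of the radii
    and with values of [G]. *)
Let min_scale (i : nat) (u v a b : R) : 0 <= u -> 0 <= v -> 0 <= a -> a <= b ->
  v * a <= u * b -> Num.min v (X i) * a <= Num.min u (X i) * b.
Proof.
move=> u0 v0 a0 ab vu; have b0 : 0 <= b by exact: le_trans ab.
have Xi := X_gt0 i.
have [uX|Xu] := leP u (X i).
  by apply: le_trans vu; rewrite ler_wpM2r// ge_min lexx.
by apply: ler_pM => //; [rewrite le_min v0 ltW|rewrite ge_min lexx orbT].
Qed.

Lemma slower_gauge0 : slower_gauge 0 = 0%E.
Proof.
rewrite /slower_gauge eseries0// => i _ _; rewrite /truncated /G /gdr gd0/=.
by rewrite (min_idPl (ltW (X_gt0 i))).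
Qed.

Lemma slower_gauge_small (eps : R) : 0 < eps ->
  exists2 e : R, 0 < e & forall r, 0 < r -> r <= e -> fine (slower_gauge r) <= eps.
Proof.
move=> eps0; have eps2 : 0 < eps / 2 by rewrite divr_gt0.
pose t i : \bar R := (1 / (2 ^ i.+1)%N%:R)%:E.
have t0 i : (0 <= t i)%E by rewrite lee_fin divr_ge0.
have tfin : (\sum_(i <oo) t i < +oo)%E.
  by apply: le_lt_trans (epsilon_trick0 xpredT (@ler01 R)) _; rewrite ltry.
have [M hM] := nneseries_tail_small t0 tfin eps2.
have M1 : 0 < M%:R + 1 :> R by rewrite ltr_wpDl.
have [e e0 he] := gdr_small d hg (divr_gt0 eps2 M1); exists e => // r r0 re.
rewrite -lee_fin -hE (splitr eps) EFinD.
apply: (@le_trans _ _ (\sum_(i <oo) ((if (i < M)%N then (G r)%:E else 0) +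
    (if (M <= i)%N then t i else 0)))%E).
  apply: lee_nneseries => [i _ _|i _]; first by rewrite lee_fin.
  case: ltnP => _; rewrite ?adde0 ?add0e /truncated lee_fin ge_min ?lexx//.
  by rewrite X_le orbT.
rewrite nneseriesD; [|by move=> i _ _; case: ifP; rewrite ?lee_fin|by move=> i _ _; case: ifP].
apply: leeD => //; rewrite (@nneseries_finite _ _ M).
- rewrite (eq_big_nat _ _ (F2 := fun=> (G r)%:E)); last by move=> i /andP[_ ->].
  rewrite sumEFin lee_fin big_const_nat subn0 iter_addr_0 -[leLHS]mulr_natl.
  have := he r r0 re; rewrite -/(G r) ler_pdivlMr// => h; apply: le_trans h.
  by rewrite mulrC ler_wpM2l// lerDl.
- by move=> i; case: ifP; rewrite ?lee_fin.
- by move=> i Mi; rewrite ltnNge Mi.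
Qed.

Lemma slower_gauge_scale r s : 0 < r -> r <= s ->
  fine (slower_gauge s) * r ^+ d <= fine (slower_gauge r) * s ^+ d.
Proof.
move=> r0 rs; have s0 := lt_le_trans r0 rs.
apply: h_scale; rewrite ?exprn_ge0 ?ltW// => i.
apply: min_scale => //; [exact/exprn_ge0/ltW| |exact: gdr_scale].
by rewrite lerXn2r ?nnegrE ?(ltW r0) ?(ltW s0).
Qed.

Lemma slower_gauge_gauge : gauge_fun slower_gauge.
Proof.
split=> //; last 1 first.
- apply/fine_cvgP; split; first by near=> r; rewrite hE.
  apply/cvgrPdist_le => eps eps0; have [e e0 he] := slower_gauge_small eps0.
  near=> r; rewrite sub0r normrN ger0_norm ?fine_ge0//=; apply: he; near: r.
    exact: nbhs_right_gt.
  exact: nbhs_right_le.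
- have [e e0 he] := gdr_homo d hg; exists e => // r s.
  rewrite le_eqVlt => /orP[/eqP <-|r0] rs se; first by rewrite slower_gauge0.
  apply: lee_nneseries => [i _ _|i _]; rewrite lee_fin// /truncated.
  by rewrite le_min !ge_min lexx orbT andbT he.
- exact: slower_gauge0.
Unshelve. all: by end_near. Qed.

(** By [slower_gauge_scale] the infimum in [gd] is attained at [r] itself. *)
Lemma gd_slower_gauge r : 0 <= r -> gd d slower_gauge r = slower_gauge r.
Proof.
rewrite le_eqVlt => /orP[/eqP <-|r0]; first by rewrite gd0 slower_gauge0.
apply/eqP; rewrite eq_le gd_le ?(ltW r0)//=; last exact: slower_gauge_gauge.
have rd : 0 < r ^+ d by rewrite exprn_gt0.
rewrite gd_gt0// hE -[fine _](divfK (lt0r_neq0 rd)) mulrC EFinM lee_pmul2l ?lte_fin//.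
apply/ereal_infP => _ [rho /= + <-]; rewrite in_itv/= => /andP[rho0 rhor].
rewrite (hE rho) -EFinM lee_fin ler_pdivrMr// mulrAC ler_pdivlMr ?exprn_gt0//.
exact: slower_gauge_scale.
Qed.

Lemma gdr_slower_gauge r : 0 <= r -> gdr d slower_gauge r = fine (slower_gauge r).
Proof. by move=> r0; rewrite /gdr gd_slower_gauge. Qed.

Lemma slower_gauge_normalized : d_normalized d slower_gauge.
Proof. by exists 1 => // r r0 _; rewrite gd_slower_gauge. Qed.

Lemma slower_gauge_prec : prec slower_gauge (gd d g).
Proof.
right; have [e [e0 Gpos GD _ _]] := gauge_on_gdr hG.
exists e => //; split.
- by move=> r r0 re; rewrite gdrE// lte_fin ltry andbT Gpos// ltW.
- move=> r s r0 rs se; have s0 := lt_le_trans r0 rs.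
  have Gr : 0 < G r by apply: Gpos => //; lra.
  have Gs : 0 < G s by apply: Gpos => //; lra.
  have Grs : G r <= G s by apply: GD => //; lra.
  rewrite hE (hE r) -!EFinM lee_fin -/(gdr d g s) -/(gdr d g r) -/G.
  rewrite ler_pdivrMr// mulrAC ler_pdivlMr//.
  apply: h_scale => // i; apply: min_scale => //.
  by rewrite mulrC.
- apply/cvgeyPge => M.
  (* Once [G r] is below the first [K] caps, those [K] terms all equal [G r], so the ratio to [G r]
     is at least [K]. *)
  pose K := (Num.truncn `|M|).+1.
  have MK : M <= K%:R by apply: le_trans (ler_norm _) (ltW (truncnS_gt _)).
  have [m m0 hm] : exists2 m : R, 0 < m & forall i, (i < K)%N -> m <= X i.
    elim: (K) => [|k [m m0 hm]]; first by exists 1.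
    exists (Num.min m (X k)) => [|i]; first by rewrite lt_min m0 X_gt0.
    by rewrite ltnS leq_eqVlt => /orP[/eqP ->|/hm mi]; rewrite ge_min ?lexx ?orbT// mi.
  have [e' e'0 he'] := gdr_small d hg m0.
  apply/near0P; exists (Num.min (e / 2) e') => [|r r0]; first by rewrite lt_min e'0 divr_gt0.
  rewrite le_min => /andP[re re'].
  have Gr : 0 < G r by apply: Gpos => //; lra.
  rewrite hE -EFinM lee_fin -/(gdr d g r) -/G ler_pdivlMr//.
  apply: (@le_trans _ _ (K%:R * G r)); first by rewrite ler_pM2r.
  rewrite -lee_fin -hE; apply: le_trans (nneseries_lim_ge K _); last by move=> i _ _; rewrite lee_fin.
  rewrite sumEFin lee_fin.
  have -> : K%:R * G r = \sum_(0 <= i < K) G r.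
    by rewrite big_const_nat subn0 iter_addr_0 mulr_natl.
  rewrite big_nat [leRHS]big_nat ler_sum// => i /andP[_ iK].
  by rewrite le_min lexx (le_trans (he' _ r0 re'))// hm.
Qed.

End SlowerGauge.

(** The cap [X i] is so small that the series of the gauge truncated at it is at most the [i]-th
    term of a geometric series of sum 1; exchanging the sums bounds the series of the new gauge by
    1. *)
Lemma slower_gauge_exists (R : realType) (d : nat) (g : R -> \bar R) (w : nat -> R) (y : nat -> R) :
  Ginf d g -> (forall k, 0 <= w k) -> (forall k, 0 <= y k) ->
  ~ diverges (fun k => w k * gdr d g (y k)) ->
  exists h : R -> \bar R, [/\ gauge_fun h, d_normalized d h, prec h (gd d g)
    & ~ diverges (fun k => w k * gdr d h (y k))].
Proof.
move=> hG w0 y0 nd; have [hg _] := hG.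
have x0 k : 0 <= w k * gdr d g (y k) by rewrite mulr_ge0// gdr_ge0.
have t0 i : 0 < 1 / (2 ^ i.+1)%N%:R :> R by rewrite divr_gt0// ltr0n expn_gt0.
have /choice[X hX] : forall i, exists X : R, [/\ 0 < X, X <= 1 / (2 ^ i.+1)%N%:R &
    forall M, \sum_(0 <= k < M) w k * Num.min (gdr d g (y k)) X <= 1 / (2 ^ i.+1)%N%:R].
  move=> i; set t := 1 / _; have ti : 0 < t := t0 i.
  (* Whatever the cap, the tail from [k0] takes at most half of the target; the finitely many terms
     before [k0] are made small by the cap. *)
  have [k0 hk0] := not_diverges_tail x0 nd (divr_gt0 ti (ltr0Sn R 1)).
  pose S := \sum_(0 <= k < k0) w k.
  have S0 : 0 <= S by apply: sumr_ge0.
  have S1 : 0 < 2 * (S + 1) by rewrite mulr_gt0// ltr_wpDl.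
  exists (Num.min t (t / (2 * (S + 1)))); split; first by rewrite lt_min ti divr_gt0.
    by rewrite ge_min lexx.
  set X := Num.min t _ => M.
  have X0 : 0 <= X by rewrite le_min ltW//= divr_ge0// ltW.
  have term k : 0 <= w k * Num.min (gdr d g (y k)) X by rewrite mulr_ge0// le_min gdr_ge0.
  apply: (@le_trans _ _ (\sum_(0 <= k < k0) w k * Num.min (gdr d g (y k)) X +
      \sum_(k0 <= k < maxn M k0) w k * Num.min (gdr d g (y k)) X)).
    rewrite -big_cat_nat ?leq_maxr//= [leRHS](big_cat_nat (n := M)) ?leq_maxl//= lerDl.
    by rewrite sumr_ge0.
  rewrite (splitr t) lerD//.
    apply: (@le_trans _ _ (\sum_(0 <= k < k0) w k * (t / (2 * (S + 1))))).
      by apply: ler_sum => k _; rewrite ler_wpM2l// !ge_min lexx !orbT.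
    rewrite -mulr_suml -/S mulrA ler_pdivrMr//; nra.
  apply: le_trans (hk0 (maxn M k0)); apply: ler_sum => k _.
  by rewrite ler_wpM2l// ge_min lexx.
have X0 i : 0 < X i by have [] := hX i.
have X1 i : X i <= 1 / (2 ^ i.+1)%N%:R by have [] := hX i.
exists (slower_gauge d g X); split.
- exact: slower_gauge_gauge.
- exact: slower_gauge_normalized.
- exact: slower_gauge_prec.
move=> dv; have [M _] := dv 0%N 1.
rewrite ltNge => /negP; apply.
have E : (\sum_(0 <= k < M) w k * gdr d (slower_gauge d g X) (y k))%:E =
    (\sum_(i <oo) (\sum_(0 <= k < M) w k * truncated d g X i (y k))%:E)%E.
  under [RHS]eq_eseriesr => i _ do rewrite -sumEFin.
  rewrite nneseries_sum_nat; last first.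
    by move=> i j; rewrite lee_fin mulr_ge0// le_min gdr_ge0// ltW.
  rewrite -sumEFin; apply: eq_bigr => k _.
  rewrite gdr_slower_gauge// EFinM -slower_gaugeE// -nneseriesZl//.
  by move=> i _; rewrite lee_fin le_min gdr_ge0// ltW.
rewrite -lee_fin E; apply: le_trans (epsilon_trick0 xpredT (@ler01 R)).
apply: lee_nneseries => [i _ _|i _].
  by rewrite lee_fin sumr_ge0// => k _; rewrite mulr_ge0// le_min gdr_ge0// ltW.
by rewrite lee_fin; have [_ _] := hX i; exact.
Qed.

(** * Describability *)

Lemma diverges_cst (R : realType) (x : nat -> R) (c : R) : 0 < c -> (forall k, c <= x k) -> diverges x.
Proof.
move=> c0 cx k0 B; pose n := (Num.truncn (B / c)).+1.
exists (k0 + n)%N; first exact: leq_addr.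
apply: (@lt_le_trans _ _ (n%:R * c)); first by rewrite -ltr_pdivrMr// truncnS_gt.
have -> : n%:R * c = \sum_(k0 <= j < k0 + n) c.
  by rewrite big_const_nat addKn iter_addr_0 mulr_natl.
by apply: ler_sum.
Qed.

Lemma nonincreasing_in_measurable (R : realType) (D : set R) (f : R -> R) :
  is_interval D -> (forall x y, D x -> D y -> x <= y -> f y <= f x) -> measurable_fun D f.
Proof.
move=> iD f_ni; apply: (measurability (@RGenCInfty.G R)) => [|/= _ [_] [r] -> <-].
  exact: RGenCInfty.measurableE.
apply: is_interval_measurable => s t/= [Ds fs] [Dt ft] u /andP[su ut].
have Du : D u by apply: (iD _ _ Ds Dt); rewrite su.
split=> //; move: ft; rewrite !in_itv/= !andbT => /le_trans; apply.
exact: f_ni.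
Qed.

Section RateFacts.
Variables (R : realType) (phi : R -> R).
Hypothesis hphi : admissible_rate phi.
Hypothesis phi_small : forall e : R, 0 < e -> exists2 t, 0 <= t & phi t <= e.

Lemma rate_pow_small (b : nat) (e : R) : (2 <= b)%N -> 0 < e ->
  exists k1, forall k, (k1 <= k)%N -> phi (b%:R ^+ k) <= e.
Proof.
move=> b2 e0; have [_ phiD] := hphi; have [t t0 ht] := phi_small e0.
exists (Num.truncn t).+1 => k kk; apply: le_trans ht; apply: phiD => //.
apply: (le_trans (ltW (truncnS_gt t))); rewrite -natrX ler_nat.
apply: leq_trans kk (leq_trans (ltnW (ltn_expl k (ltnSn 1))) _).
by case: k => // k; rewrite leq_exp2r.
Qed.
End RateFacts.

Section IntegralOfGauge.
Variables (R : realType) (d : nat) (phi : R -> R).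
Hypothesis hd : (1 <= d)%N.
Hypothesis hphi : admissible_rate phi.
Hypothesis phi_cont : {within `[0%R, +oo[, continuous phi}.

Lemma rate_measurable : measurable_fun (`[0%R, +oo[%classic : set R) phi.
Proof. exact: subspace_continuous_measurable_fun. Qed.

Hypothesis phi_small : forall e : R, 0 < e -> exists2 t, 0 <= t & phi t <= e.
Variable g : R -> \bar R.
Hypothesis hG : Ginf d g.

Let hg : gauge_fun g. Proof. by have [] := hG. Qed.

(** Cut off outside []0, 1]] to be an admissible test function in [is_n_phi]. *)
Definition gdr01 (x : R) : R := if (0 < x) && (x <= 1) then gdr d g x else 0.

(** [gdr d g] is known to be monotone only near 0, whereas its quotient by [x ^+ d] is monotone on
    all of []0, 1]]. *)
Lemma gdr01_measurable : measurable_fun [set: R] gdr01.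
Proof.
have -> : gdr01 = (gdr d g) \_ `]0%R, 1%R].
  apply/funext => x; rewrite /gdr01 patchE; case: ifPn => hx.
    by rewrite mem_set//= in_itv.
  by rewrite memNset//= in_itv/=; exact/negP.
apply/(measurable_restrictT _ (measurable_itv _)).
apply: (@eq_measurable_fun _ _ _ _ _ (fun x : R => x ^+ d * (gdr d g x / x ^+ d))).
  move=> x; rewrite inE/= in_itv/= => /andP[x0 _].
  by rewrite mulrC divfK// gt_eqF// exprn_gt0.
apply: measurable_funM; first exact: exprn_measurable.
apply: nonincreasing_in_measurable => [|x y]; first exact: interval_is_interval.
rewrite /= !in_itv/= => /andP[x0 _] /andP[y0 _] xy.
by rewrite ler_pdivrMr ?exprn_gt0// mulrAC ler_pdivlMr ?exprn_gt0// gdr_scale.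
Qed.

Lemma integral_gauge (n : {measure set R -> \bar R}) : is_n_phi d phi n ->
  (\int[n]_(x in `]0%R, 1%R]) gd d g x =
   \int[@lebesgue_measure R]_(x in `[0%R, +oo[) (x ^+ d.-1 * gdr01 (phi x))%:E)%E.
Proof.
move=> hn.
have h1 : measurable_fun [set: R] (EFin \o gdr01).
  by apply/measurable_EFinP; exact: gdr01_measurable.
have h2 x : (0 <= (EFin \o gdr01) x)%E.
  by rewrite lee_fin /gdr01; case: ifP => // _; exact: gdr_ge0.
have h3 x : ~ (0 < x <= 1) -> (EFin \o gdr01) x = 0%E.
  by move=> nx; rewrite /= /gdr01; case: ifP.
transitivity (\int[n]_(x in `]0%R, 1%R]) (EFin \o gdr01) x)%E.
  apply: eq_integral => x; rewrite inE/= in_itv/= => x01.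
  by rewrite gdrE// /gdr01 x01.
by rewrite (hn _ h1 h2 h3).
Qed.

Lemma gdr01_rate_ge0 t : 0 <= gdr01 (phi t).
Proof. by rewrite /gdr01; case: ifP => // _; exact: gdr_ge0. Qed.

(** Beyond the range of monotonicity the bound comes from [gdr_scale]. It serves the first block of
    the integral test. *)
Lemma gdr01_bounded : exists B, forall x, gdr01 x <= B.
Proof.
have [e [e0 G0 GD _ _]] := gauge_on_gdr hG.
have ed : 0 < e ^+ d by rewrite exprn_gt0.
exists (gdr d g e + gdr d g e / e ^+ d) => x.
have Ge : 0 < gdr d g e by exact: G0.
have Ged : 0 < gdr d g e / e ^+ d by rewrite divr_gt0.
rewrite /gdr01; case: ifP => [/andP[x0 x1]|_]; last by rewrite ltW// addr_gt0.
have [xe|/ltW ex] := leP x e.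
  by apply: le_trans (GD _ _ x0 xe (lexx _)) _; rewrite lerDl ltW.
apply: (@le_trans _ _ (gdr d g e / e ^+ d)); last by rewrite lerDr ltW.
rewrite ler_pdivlMr//; apply: le_trans (gdr_scale d hg e0 ex) _.
by rewrite ger_pMr// exprn_ile1// ltW.
Qed.

Lemma gdr01_eventually : exists eta0 : R, [/\ 0 <= eta0,
  forall s t, eta0 <= s -> s <= t -> gdr01 (phi t) <= gdr01 (phi s)
  & forall t, eta0 <= t -> gdr01 (phi t) = gdr d g (phi t)].
Proof.
have [phi0 phiD] := hphi.
have [e [e0 G0 GD _ _]] := gauge_on_gdr hG.
have m0 : 0 < Num.min e 1 by rewrite lt_min e0 ltr01.
have [eta0 eta00 hm] := phi_small m0.
have small t : eta0 <= t -> [/\ 0 < phi t, phi t <= e & phi t <= 1].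
  move=> et; have t0 := le_trans eta00 et.
  have : phi t <= Num.min e 1 by apply: le_trans hm; exact: phiD.
  by rewrite le_min => /andP[? ?]; split=> //; exact: phi0.
have hE t : eta0 <= t -> gdr01 (phi t) = gdr d g (phi t).
  by move=> /small[p0 _ p1]; rewrite /gdr01 p0 p1.
exists eta0; split=> // s t es st; have et := le_trans es st.
rewrite !hE//; have [ps0 pse _] := small _ es; have [pt0 _ _] := small _ et.
by apply: GD => //; apply: phiD => //; exact: le_trans es.
Qed.

Let psi_measurable : measurable_fun (`[0%R, +oo[%classic : set R) (gdr01 \o phi).
Proof. exact: (measurableT_comp gdr01_measurable rate_measurable). Qed.

Let pow_ge (b : nat) (eta0 : R) : (2 <= b)%N -> exists k1, forall k, (k1 <= k)%N -> eta0 <= b%:R ^+ k.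
Proof.
move=> b2; exists (Num.truncn eta0).+1 => k kk.
apply: (le_trans (ltW (truncnS_gt eta0))); rewrite -natrX ler_nat.
apply: leq_trans kk (leq_trans (ltnW (ltn_expl k (ltnSn 1))) _).
by case: k => // k; rewrite leq_exp2r.
Qed.

Lemma gauge_integral_diverges (n : {measure set R -> \bar R}) (b : nat) :
  is_n_phi d phi n -> (2 <= b)%N -> (\int[n]_(x in `]0%R, 1%R]) gd d g x = +oo)%E ->
  diverges (fun k => (b%:R ^+ k) ^+ d * gdr d g (phi (b%:R ^+ k))).
Proof.
move=> hn b2; rewrite (integral_gauge hn) => Ioo.
have [eta0 [eta00 psiD psiE]] := gdr01_eventually.
have [B hB] := gdr01_bounded.
have [k1 hk1] := pow_ge eta0 b2.
have := integral_infty_diverges hd b2 psi_measurable (fun t _ => gdr01_rate_ge0 t) psiD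
  (hk1 k1 (leqnn _)) (fun t _ => hB (phi t)) Ioo.
apply: (@diverges_le _ _ _ 1 k1) => //.
  by move=> k; rewrite mulr_ge0 ?exprn_ge0// gdr_ge0.
by move=> k /hk1 kk; rewrite mul1r /= psiE.
Qed.

Lemma gauge_integral_not_diverges (n : {measure set R -> \bar R}) :
  is_n_phi d phi n -> (\int[n]_(x in `]0%R, 1%R]) gd d g x != +oo)%E ->
  ~ diverges (fun k => (2%:R ^+ k) ^+ d * gdr d g (phi (2%:R ^+ k))).
Proof.
move=> hn; rewrite (integral_gauge hn) -ltey => Ifin dv.
have [eta0 [eta00 psiD psiE]] := gdr01_eventually.
have [k1 hk1] := pow_ge eta0 (leqnn 2).
apply: (integral_fin_not_diverges hd (leqnn 2) psi_measurable (fun t _ => gdr01_rate_ge0 t) psiD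
  (hk1 k1 (leqnn _)) Ifin).
apply: (@diverges_le _ _ _ 1 k1) dv => //.
  by move=> k; rewrite mulr_ge0 ?exprn_ge0// gdr01_rate_ge0.
by move=> k /hk1 kk; rewrite mul1r /= psiE.
Qed.
End IntegralOfGauge.

Section Describability.
Variables (R : realType) (d : nat) (N : 'rV[R]_d -> R).
Hypotheses (hN : is_norm N) (hd : (1 <= d)%N).
Variables (U A : set 'rV[R]_d) (H : 'rV[R]_d -> R).
Hypotheses (hU0 : U !=set0) (hUo : norm_open N U).
Hypothesis hAc : countable A.
Hypothesis hH : forall a, A a -> 0 < H a.
Hypotheses (hopt : optimal_system N U A H) (hreg : regular_system N U A H).

(** With [phi] constantly [2 * e] the series diverges trivially, and [F_phi_content] bounds the
    content of the balls themselves. *)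
Lemma content_lower_full (hr : R -> R) (e : R) : gauge_on d hr e ->
  exists2 c : R, 0 < c /\ c <= 1 & content_lower N U setT hr e c.
Proof.
move=> hgo; have [c [b [c0 c1 b2 hc]]] := F_phi_content hN hd hreg.
have [e0 hr0 _ _ _] := hgo.
exists c => // x rho rho0 rhoe BU Q q q0 Qq cover.
apply: (hc (fun=> 2 * e) hr e _ hgo _ x rho rho0 rhoe BU Q q q0 Qq).
- by split=> // t _; rewrite mulr_gt0.
- have -> : Num.min (2 * e / 2) e = e by rewrite mulrAC divff ?mul1r ?minxx.
  apply: (@diverges_cst _ _ (hr e)) => [|k]; first exact: hr0.
  rewrite ler_peMl ?(ltW (hr0 _ e0 (lexx _)))//.
  by rewrite exprn_ege1// exprn_ege1// ler1n; exact: leq_trans b2.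
- by apply: subset_trans cover => y [_ yB].
Qed.

Variable phi : R -> R.
Hypothesis hphi : admissible_rate phi.
Hypothesis phi_small : forall e : R, 0 < e -> exists2 t, 0 <= t & phi t <= e.
Let F := F_phi N A H phi.

(** [y] separates the series from the gauge: for the large intersection property divergence is known
    for [gdr d g], while the content is that of a gauge larger near 0. *)
Lemma content_lower_F_phi (hr y : R -> R) (e e' : R) : gauge_on d hr e -> 0 < e' ->
  (forall r, 0 < r -> r <= e' -> y r <= hr r) ->
  (forall b, (2 <= b)%N -> diverges (fun k => (b%:R ^+ k) ^+ d * y (phi (b%:R ^+ k)))) ->
  exists2 c : R, 0 < c /\ c <= 1 & content_lower N U F hr e c.
Proof.
move=> hgo e'0 yhr hdiv; have [c [b [c0 c1 b2 hc]]] := F_phi_content hN hd hreg.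
have [e0 hr0 hrD hrS _] := hgo; have [phi0 phiD] := hphi.
exists c => // x rho rho0 rhoe BU Q q q0 Qq cover.
apply: (hc phi hr e hphi hgo _ x rho rho0 rhoe BU Q q q0 Qq) => //.
have m0 : 0 < Num.min e e' by rewrite lt_min e0.
have [k1 hk1] := rate_pow_small hphi phi_small b2 m0.
have b0 k : 0 < b%:R ^+ k :> R by rewrite exprn_gt0// ltr0n; exact: leq_trans b2.
(* Halving [phi] costs at most [2 ^+ d], by the monotonicity of [hr r / r ^+ d]. *)
apply: (@diverges_le _ _ _ (2 ^+ d) k1) (hdiv b b2) => [|k|k kk].
- by rewrite exprn_gt0.
- have p0 := phi0 _ (ltW (b0 k)).
  rewrite mulr_ge0 ?exprn_ge0 ?(ltW (b0 k))// ltW// hr0 ?lt_min ?divr_gt0 ?e0//.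
  by rewrite ge_min lexx orbT.
- have p0 := phi0 _ (ltW (b0 k)); set p := phi _ in p0 *.
  have : p <= Num.min e e' by exact: hk1.
  rewrite le_min => /andP[pe pe'].
  have p2 : 0 < p / 2 by rewrite divr_gt0.
  have pp : p / 2 <= p by lra.
  rewrite (min_idPl _); last lra.
  rewrite mulrCA ler_wpM2l ?exprn_ge0 ?(ltW (b0 k))//.
  apply: le_trans (yhr _ p0 pe') _.
  have := hrS _ _ p2 pp pe; rewrite expr_div_n mulrA ler_pdivrMr ?exprn_gt0// [leRHS]mulrAC.
  by rewrite ler_pM2r ?exprn_gt0// [X in _ -> _ <= X]mulrC.
Qed.

Lemma interior_ball (e : R) : 0 < e ->
  exists x rho, [/\ 0 < rho, rho <= e & ballN N x rho `<=` U].
Proof.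
move=> e0; have [x Ux] := hU0; have [r r0 BU] := hUo Ux.
exists x, (Num.min r e); split; first by rewrite lt_min r0.
  by rewrite ge_min lexx orbT.
by apply: subset_trans BU => y; rewrite /ballN/= lt_min => /andP[].
Qed.

(** The content bound concerns [gdr d g], which lies below [g], so it also bounds the weight of
    covers for [g]. *)
Lemma hausdorff_pos (g : R -> \bar R) : Ginf d g ->
  (forall b, (2 <= b)%N -> diverges (fun k => (b%:R ^+ k) ^+ d * gdr d g (phi (b%:R ^+ k)))) ->
  hausdorff N g (F `&` U) <> 0%E.
Proof.
move=> hG hdiv H0; have [hg _] := hG.
have [e hgo] := gauge_on_gdr hG.
have [e0 G0 GD GS _] := hgo.
have [c [c0 c1] hlow] := content_lower_F_phi hgo e0 (fun r _ _ => lexx _) hdiv.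
have [x [rho [rho0 rhoe BU]]] := interior_ball e0.
have cG : 0 < c * gdr d g rho by rewrite mulr_gt0// G0.
have : (hausdorff_delta N g e (F `&` U) < (c * gdr d g rho)%:E)%E.
  apply: (@le_lt_trans _ _ 0%E); last by rewrite lte_fin.
  by rewrite -H0; apply: ereal_sup_ubound; exists e => //=; rewrite in_itv/= e0.
move=> /ereal_inf_lt[_ [C [cC dC] <-]]; rewrite ltNge => /negP; apply.
apply: (content_weights hlow rho0 rhoe BU (Q := C)).
- by move=> n; exact: (diam_cost_ge0 N (C n) hg).
- move=> n eta eta0.
  have [_ D0 D1 D2] := diam_fin (dC n); set q := fine _ in D0 D1 D2 *.
  move: (D0); rewrite le_eqVlt => /orP[/eqP qz|q0]; last first.
    exists q; split=> //; rewrite -gdrE//; apply: (le_trans (gd_le d hg D0)).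
    by rewrite leeDl// lee_fin ltW.
  have [e2 e20 he2] := gdr_small d hg eta0.
  exists (Num.min e e2); split.
  + by rewrite lt_min e0.
  + by rewrite ge_min lexx.
  + move=> y z Cy Cz; apply: le_trans (D2 _ _ Cy Cz) _.
    by rewrite -qz le_min !ltW.
  + rewrite -qz; have [_ _ -> _] := hg; rewrite add0e lee_fin he2//.
      by rewrite lt_min e0.
    by rewrite ge_min lexx orbT.
- by move=> y [Fy yB]; apply: cC; split=> //; exact: BU.
Qed.

Lemma F_phi_net_null (g : R -> \bar R) : Ginf d g ->
  ~ diverges (fun k => (2%:R ^+ k) ^+ d * gdr d g (phi (2%:R ^+ k))) ->
  forall delta eps : R, 0 < delta -> 0 < eps ->
  covered (net_small N delta) id (diam_cost N g) (F `&` U) eps%:E.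
Proof.
move=> hG nd delta eps delta0 eps0; have [hg _] := hG.
have [c [e [c0 e0 GD hcov]]] := ball_net_covered hN hd hG delta0.
apply: (@limsup_null R d N hN U A H hUo hAc hH hopt phi hphi phi_small _ _ _ _ _ _
  (fun r => c * gdr d g r) e e0) => //.
- by move=> Q _; exact: diam_cost_ge0.
- by exists set0; [left|exact: diam_cost_set0].
- by move=> r; rewrite mulr_ge0 ?gdr_ge0// ltW.
- by move=> r s r0 rs se; rewrite ler_pM2l//; exact: GD.
- move=> dv; apply: nd; apply: (@diverges_le _ _ _ c 0) dv => // k.
    by rewrite mulr_ge0 ?exprn_ge0// gdr_ge0.
  by move=> _; rewrite mulrCA.
Qed.

Lemma F_phi_hausdorff_null (g : R -> \bar R) : Ginf d g ->
  ~ diverges (fun k => (2%:R ^+ k) ^+ d * gdr d g (phi (2%:R ^+ k))) ->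
  hausdorff N g (F `&` U) = 0%E.
Proof.
move=> hG nd; have [hg _] := hG.
have ge0 delta : (0 <= hausdorff_delta N g delta (F `&` U))%E.
  apply/ereal_infP => _ [C _ <-]; apply: nneseries_ge0 => n _ _.
  exact: (diam_cost_ge0 N (C n) hg).
apply/eqP; rewrite eq_le; apply/andP; split; last first.
  apply: le_trans (ge0 1) _; apply: ereal_sup_ubound; exists 1 => //=.
  by rewrite in_itv/= ltr01.
apply: ge_ereal_sup => _ [delta /= + <-]; rewrite in_itv/= andbT => delta0.
apply/lee_addgt0Pr => eps eps0; rewrite add0e.
have [C [aC cC sC]] := F_phi_net_null hG nd delta0 eps0.
apply: le_trans sC; apply: ereal_inf_lbound; exists C => //; split=> // n.
case: (aC n) => [->|[_]//]; rewrite diam_set0 lee_fin; exact: ltW.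
Qed.

Lemma F_phi_large_int (g : R -> \bar R) : Ginf d g ->
  (forall b, (2 <= b)%N -> diverges (fun k => (b%:R ^+ k) ^+ d * gdr d g (phi (b%:R ^+ k)))) ->
  large_int N g U F.
Proof.
move=> hG hdiv; split; first exact: F_phi_Gdelta.
move=> h hh hn hp W Wo WU.
have hHi := prec_Ginf hG hh hp.
have [e [hgo heps he _]] := normalized_gauge_on hHi hn.
have [e0 _ _ _ _] := hgo.
have [e1 e10 he1] := prec_ge hG hh hp ltr01.
have m0 : 0 < Num.min e e1 by rewrite lt_min e0.
have [|c [c0 _] hlow] := content_lower_F_phi hgo m0 (y := gdr d g) _ hdiv.
  move=> r r0; rewrite le_min => /andP[re re1] /=.
  by rewrite -lee_fin -he ?(ltW r0)// -[gdr d g r]mul1r; exact: he1.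
exact: (Mh_large_int hN hd hh he hgo heps c0 hlow Wo WU).
Qed.

Lemma Mh_open_gt0 (h : R -> \bar R) : Ginf d h -> d_normalized d h -> (0 < Mh N h U)%E.
Proof.
move=> hHi hn; have [hh _] := hHi.
have [e [hgo heps he _]] := normalized_gauge_on hHi hn.
have [e0 hr0 hrD _ _] := hgo.
have [c [c0 c1] hlow] := content_lower_full hgo.
have [x [rho [rho0 rhoe BU]]] := interior_ball e0.
have hrho : 0 < (fine \o h) rho by exact: hr0.
apply: (@lt_le_trans _ _ (c * (fine \o h) rho)%:E); first by rewrite lte_fin mulr_gt0.
apply: Mh_ge => C aC cC.
have cost0 n : (0 <= diam_cost N h (C n))%E by exact: diam_cost_ge0.
(* Cubes of diameter between [e] and [eps_h d h] are out of reach of [content_lower], but a single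
   one already weighs at least [h e]. *)
have [[n nC]|small] := pselect (exists n, (e%:E < diam N (C n))%E).
  apply: (@le_trans _ _ (diam_cost N h (C n))).
    apply: (@le_trans _ _ (h e)).
      rewrite he ?(ltW e0)// lee_fin (le_trans (ler_piMl (ltW hrho) c1))//.
      exact: (hrD _ _ rho0 rhoe (lexx _)).
    case: (aC n) => [Cn|[_ Ceps]].
      by move: nC; rewrite Cn diam_set0 lte_fin ltNge (ltW e0).
    have [_ [e2 [e20 [hD _]] <-] Ce2] := ereal_sup_gt Ceps.
    have [CE D0 _ _] := diam_fin (ltW Ce2).
    rewrite /diam_cost; apply: hD; first exact: ltW.
    - by rewrite -lee_fin -CE ltW.
    - by rewrite -lee_fin -CE ltW.
  apply: le_trans (nneseries_lim_ge n.+1 _); last by move=> i _ _; exact: cost0.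
  by rewrite big_nat_recr//= leeDr// sume_ge0.
have dC n : (diam N (C n) <= e%:E)%E.
  by rewrite leNgt; apply/negP => hn'; apply: small; exists n.
apply: (content_weights hlow rho0 rhoe BU (Q := C)) => //; last first.
  by move=> y [_ yB]; apply: cC; exact: BU.
move=> n eta eta0; have [_ D0 D1 D2] := diam_fin (dC n).
move: (D0); rewrite le_eqVlt => /orP[/eqP qz|q0]; last first.
  by exists (fine (diam N (C n))); split=> //; rewrite /diam_cost he// -EFinD lee_fin /=; lra.
have [e2 e20 he2] := gauge_small hh eta0.
have m0 : 0 < Num.min e e2 by rewrite lt_min e0.
exists (Num.min e e2); split=> //.
- by rewrite ge_min lexx.
- move=> y z Cy Cz; apply: le_trans (D2 _ _ Cy Cz) _.
  by rewrite -qz ltW.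
- apply: (@le_trans _ _ eta%:E); last by rewrite leeDr.
  by rewrite /= -he ?(ltW m0) ?ge_min ?lexx// he2// ge_min lexx orbT.
Qed.

Lemma not_large_int (g : R -> \bar R) (E : set 'rV[R]_d) : Ginf d g ->
  ~ diverges (fun k => (2%:R ^+ k) ^+ d * gdr d g (phi (2%:R ^+ k))) ->
  large_int N g U E -> E `<=` F -> False.
Proof.
move=> hG nd [_ hE] EF; have [phi0 _] := hphi.
have w0 k : 0 <= (2%:R ^+ k) ^+ d :> R by rewrite !exprn_ge0.
have y0 k : 0 <= phi (2%:R ^+ k) by rewrite ltW// phi0// exprn_ge0.
have [h [hh hn hp hnd]] := slower_gauge_exists hG w0 y0 nd.
have hHi := prec_Ginf hG hh hp.
have [e [[e0 _ _ _ _] heps _ _]] := normalized_gauge_on hHi hn.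
have := Mh_open_gt0 hHi hn.
rewrite -(hE h hh hn hp U hUo (@subset_refl _ U)) ltNge => /negP; apply.
apply/lee_addgt0Pr => eps eps0; rewrite add0e.
(* Half of [e], because [net_small] bounds diameters weakly and the covers of [Mh] strictly. *)
apply: Mh_le; have e2 : 0 < e / 2 by rewrite divr_gt0.
have [C [aC cC sC]] := F_phi_net_null hHi hnd e2 eps0.
exists C; split=> //.
- move=> n; case: (aC n) => [->|[dC sCn]]; [by left|right; split=> //].
  by apply: le_lt_trans sCn (lt_le_trans _ heps); rewrite lte_fin; lra.
- by move=> x [Ex Ux]; apply: cC; split=> //; exact: EF.
Qed.

Lemma F_phi_leb_null :
  ~ diverges (fun k => (2%:R ^+ k) ^+ d * phi (2%:R ^+ k) ^+ d) -> leb_null (F `&` U).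
Proof.
move=> nd; have [phi0 _] := hphi.
have [c c0 hcov] := ball_box_covered hN hd.
apply: leb_null_covered => eps eps0.
apply: (@limsup_null R d N hN U A H hUo hAc hH hopt phi hphi phi_small _ _ _ _ _ _
  (fun r => c * `|r| ^+ d) 1 ltr01) => //.
- exact: box_cost_ge0.
- exact: box_cost_null.
- by move=> r; rewrite mulr_ge0 ?exprn_ge0// ltW.
- move=> r s r0 rs _; have s0 := lt_le_trans r0 rs.
  by rewrite ler_pM2l// !gtr0_norm// lerXn2r ?nnegrE// ltW.
- by move=> a s s0 _; exact: hcov.
- move=> dv; apply: nd; apply: (@diverges_le _ _ _ c 0) dv => // k.
    by rewrite mulr_ge0 ?exprn_ge0// ltW// phi0// exprn_ge0.
  by move=> _; rewrite mulrCA gtr0_norm// phi0// exprn_ge0.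
Qed.

End Describability.

Theorem theorem9p5 (R : realType) (d : nat) (hd : (1 <= d)%N)
  (N : 'rV[R]_d -> R) (hN : is_norm N)
  (U : set 'rV[R]_d) (hU0 : U !=set0) (hUo : norm_open N U)
  (A : set 'rV[R]_d) (hAc : countable A) (hAi : infinite_set A)
  (H : 'rV[R]_d -> R) (hH : forall a, A a -> 0 < H a)
  (hsys : optimal_regular_system N U A H)
  (phi : R -> R) (hphi_pos : forall t : R, 0 <= t -> 0 < phi t)
  (hphi_mono : forall s t : R, 0 <= s -> s <= t -> phi t <= phi s)
  (hphi_cont : {within `[0%R, +oo[, continuous phi}) :
  (I_phi d phi = +oo%E -> leb_null (U `\` F_phi N A H phi)) /\
  ((I_phi d phi < +oo)%E ->
     forall n : {measure set R -> \bar R}, is_n_phi d phi n ->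
       n_describable N U n (F_phi N A H phi)).
Proof.
have [hopt hreg] := hsys.
have hphi : admissible_rate phi by split.
have mphi := rate_measurable hphi_cont.
have mpsi : measurable_fun (`[0%R, +oo[%classic : set R) (fun t => phi t ^+ d).
  exact: (measurableT_comp (@exprn_measurable R setT d) mphi).
have psi0 t : 0 <= t -> 0 <= phi t ^+ d by move=> t0; rewrite exprn_ge0// ltW// hphi_pos.
have psiD s t : 0 <= s -> s <= t -> phi t ^+ d <= phi s ^+ d.
  move=> s0 st; have t0 := le_trans s0 st.
  by rewrite lerXn2r ?nnegrE ?hphi_mono// ltW// hphi_pos.
split=> [Ioo|Ifin n hn].
  apply: (full_measure hN hd hreg hUo hphi hH) => b b2.
  have p0 : 0 <= b%:R ^+ 0 :> R by rewrite expr0.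
  have psiB t : 0 <= t -> phi t ^+ d <= phi 0 ^+ d by move=> t0; exact: psiD.
  have := integral_infty_diverges hd b2 mpsi psi0 psiD p0 psiB Ioo.
  by under eq_fun do rewrite -exprMn.
have nd : ~ diverges (fun k => (2%:R ^+ k) ^+ d * phi (2%:R ^+ k) ^+ d).
  have p0 : 0 <= 2%:R ^+ 0 :> R by rewrite expr0.
  exact: (integral_fin_not_diverges hd (leqnn 2) mpsi psi0 psiD p0 Ifin).
(* Otherwise [phi] stays above [e] and the terms of the convergent series stay above [e ^+ d]. *)
have phi_small e : 0 < e -> exists2 t, 0 <= t & phi t <= e.
  move=> e0; apply: contrapT => ns; apply: nd.
  apply: (@diverges_cst _ _ (e ^+ d)) => [|k]; first by rewrite exprn_gt0.
  have k0 : 0 <= 2%:R ^+ k :> R by rewrite exprn_ge0.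
  have ek : e <= phi (2%:R ^+ k).
    by rewrite leNgt; apply/negP => h; apply: ns; exists (2%:R ^+ k) => //; exact: ltW.
  rewrite -[leLHS]mul1r ler_pM ?exprn_ge0 ?(ltW e0)//.
    by rewrite exprn_ege1// exprn_ege1// ler1n.
  by rewrite lerXn2r ?nnegrE ?(ltW e0)// (le_trans (ltW e0)).
have div g b : Ginf d g -> (\int[n]_(x in `]0%R, 1%R]) gd d g x)%E = +oo%E -> (2 <= b)%N ->
    diverges (fun k => (b%:R ^+ k) ^+ d * gdr d g (phi (b%:R ^+ k))).
  move=> hG Goo b2; exact: (gauge_integral_diverges hd hphi hphi_cont phi_small hG hn b2 Goo).
have ndiv g : Ginf d g -> (\int[n]_(x in `]0%R, 1%R]) gd d g x != +oo)%E ->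
    ~ diverges (fun k => (2%:R ^+ k) ^+ d * gdr d g (phi (2%:R ^+ k))).
  move=> hG Goo; exact: (gauge_integral_not_diverges hd hphi hphi_cont phi_small hG hn Goo).
split.
- split; first exact: (Gdelta_borel (F_phi_Gdelta hN H phi hAc)).
  exact: (F_phi_leb_null hN hd hUo hAc hH hopt hphi phi_small).
- apply/seteqP; split=> g.
    move=> [hG H0]; split=> // -[_ Goo].
    exact: (hausdorff_pos hN hd hU0 hUo hreg hphi phi_small hG (fun b b2 => div g b hG Goo b2)).
  move=> [hG nGn]; split=> //.
  apply: (F_phi_hausdorff_null hN hd hUo hAc hH hopt hphi phi_small hG).
  by apply: ndiv => //; apply/eqP => Goo; exact: nGn.
- apply/seteqP; split=> g.
    move=> [[_ [E hE EF]] hG]; split=> //; apply: contrapT => /eqP Gfin.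
    exact: (not_large_int hN hd hU0 hUo hAc hH hopt hreg hphi phi_small hG (ndiv g hG Gfin) hE EF).
  move=> [hG Goo]; split=> //; split.
    have [hg hinf] := hG; split=> //; exists 1 => //; exact: hinf.
  exists (F_phi N A H phi) => //.
  exact: (F_phi_large_int hN hd hAc hreg hphi phi_small hG (fun b b2 => div g b hG Goo b2)).
Qed.
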